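(* Let $H$, $A$, $W$, $V$ be as in the setting of the context (so that the structural hypotheses (i) and (ii) stated there hold), let $T>0$, and suppose in addition that there exists a Galerkin family $(F_n,\Pi_n)_{n\in\mathbb N}$ such that $$a(x,\Pi_n\tilde x)=a(\Pi_n x,\tilde x)\qquad\text{for all } x\in W,\ \tilde x\in V,\ n\in\mathbb N.$$ Then for every $x_0\in H$ and every $f\in L^2(0,T;W^* )$ the Cauchy problem $$\dot x=Ax+f\ \text{ on }[0,T],\qquad x(0)=x_0,$$ admits a unique $W$-weak solution $x$. Moreover, $x\in C([0,T];H)$, and, for any fixed $t\in[0,T]$ (and fixed $f$), the map $x_0\mapsto x(t)$ belongs to $C(H;H)$, i.e. it is a continuous map from $H$ to $H$.
   Context: **Setting.** $H$ is a separable real Hilbert space with inner product $(\cdot,\cdot)_H$ and norm $\|\cdot\|_H$, and $A:\mathcal D(A)\subset H\to H$ is a densely defined closed linear operator. $H$ is thought of as embedded in a bigger Hilbert space, allowing $A$ to be continuously extended outside of its domain. $W\hookrightarrow H$ is another Hilbert space (possibly $W=H$), with norm $\|\cdot\|_W$, such that: (i) $A$ extends to a bounded operator (still denoted $A$) from $W$ to its image $AW$. Moreover, identifying $H$ with its dual $H^*$, there is a Hilbert space $V$ with $V^*=AW$ such that the following chain of continuous and dense embeddings holds: $$V\hookrightarrow W\hookrightarrow H=H^*\hookrightarrow W^*\hookrightarrow V^*.$$ (ii) There exist constants $a\ge b>0$ such that, for all $x\in\mathcal D(A)$, $$-(Ax,x)_H\ \ge\ b\|x\|_W^2-a\|x\|_H^2$$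 (in particular, $\mathcal D(A)\subset W$). **Notation.** $\langle\cdot,\cdot\rangle$ is the duality pairing between $V^*$ and $V$, extending the inner product of $H$ whenever both are defined. The continuous bilinear form $a(\cdot,\cdot):W\times V\to\mathbb R$ is defined by $a(x,\tilde x)=-\langle Ax,\tilde x\rangle$. **Definition ($W$-weak solution).** Given $x_0\in H$ and $f\in L^2(0,T;W^* )$, a function $x\in L^\infty(0,T;H)\cap L^2(0,T;W)$ is a $W$-weak solution of $\dot x=Ax+f$, $x(0)=x_0$, if and only if $x(0)=x_0$ and, for a.e. $t\in[0,T]$ and every $y\in V$, $$\langle\dot x(t),y\rangle+a(x(t),y)=\langle f(t),y\rangle.$$ Here this equality dictates that $\dot x\in L^2(0,T;V^* )$, and $x(0)$ has meaning through the embedding $H^1(0,T;V^* )\hookrightarrow C([0,T];V^* )$. **Definition (Galerkin family).** Let $\{h_n\}$ be a basis of the space $H$ (not necessarily orthonormal) made of elements of $V$. Let $F_n$ be the $n$-dimensional subspace of $H$ generated by $h_1,\dots,h_n$, and let $\Pi_n$ be the self-adjoint projection from $H$ onto $F_n$. The pair of spaces and projections $(F_n,\Pi_n)$ is called a Galerkin family.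
   Formalization: The extension of A to W is assumed to have A as its part in H, i.e. D(A) = {x in W : Ax in H}; for an arbitrary smaller domain D(A), estimate (ii) does not control the extension and the existence claim can fail. *)

(* Defs.v *)
From HB Require Import structures.
From mathcomp Require Import all_boot all_order all_algebra.
From mathcomp Require Import all_classical all_reals all_analysis.
From mathcomp Require Import ring lra.

Set Implicit Arguments.
Unset Strict Implicit.
Unset Printing Implicit Defensive.

Import Order.TTheory GRing.Theory Num.Theory.
Import numFieldNormedType.Exports.

Local Open Scope classical_set_scope.
Local Open Scope ring_scope.

HB.mixin Record CompleteNormedModule_isHilbert (R : realType) X
    & CompleteNormedModule R X := {
  hdot : X -> X -> R ;
  hdotC : forall x y, hdot x y = hdot y x ;
  hdotPl : forall c x y z, hdot (c *: x + y) z = c * hdot x z + hdot y z ;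
  hdotxx : forall x, hdot x x = `|x| ^+ 2
}.

#[short(type="hilbertType")]
HB.structure Definition Hilbert (R : realType) :=
  {X of CompleteNormedModule R X & CompleteNormedModule_isHilbert R X}.

Definition separable (X : topologicalType) : Prop :=
  exists D : set X, countable D /\ dense D.

Section HilbertTheory.
Context {R : realType} {H : hilbertType R}.
Implicit Types x y z : H.

Lemma hdotPr c x y z : hdot x (c *: y + z) = c * hdot x y + hdot x z.
Proof. by rewrite hdotC hdotPl (hdotC y) (hdotC z). Qed.

Lemma hdot0l x : hdot 0 x = 0.
Proof.
by have := hdotPl (-1) 0 0 x; rewrite scaler0 addr0 mulN1r addNr.
Qed.

Lemma hdot0r x : hdot x 0 = 0.
Proof. by rewrite hdotC hdot0l. Qed.

Lemma hdotZl c x y : hdot (c *: x) y = c * hdot x y.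
Proof. by rewrite -[c *: x]addr0 hdotPl hdot0l addr0. Qed.

Lemma hdotDl x y z : hdot (x + y) z = hdot x z + hdot y z.
Proof. by rewrite -[x in LHS]scale1r hdotPl mul1r. Qed.

Lemma CauchySchwarz_hdot x y : `|hdot x y| <= `|x| * `|y|.
Proof.
have [->|y0] := eqVneq y 0; first by rewrite hdot0r !normr0 mulr0.
have ny2 : 0 < `|y| ^+ 2 by rewrite exprn_gt0// normr_gt0.
pose u := `|y| ^+ 2 *: x; pose v := - hdot x y *: y.
have : 0 <= hdot (u + v) (u + v) by rewrite hdotxx exprn_ge0.
rewrite hdotDl (hdotC u) (hdotC v) !hdotDl /u /v !hdotZl.
rewrite ![hdot _ (_ *: _)]hdotC !hdotZl !hdotxx (hdotC y x) => h.
rewrite -ler_sqr ?nnegrE ?mulr_ge0// real_normK ?num_real// exprMn.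
rewrite -(ler_pM2l ny2); lra.
Qed.

End HilbertTheory.

Section Dual.
Context {R : realType} {X : normedModType R}.

Definition dual_pred : {pred X -> R^o} :=
  fun phi => `[< linear phi /\ continuous phi >].

Lemma dual_predP (phi : X -> R^o) :
  reflect (linear phi /\ continuous phi) (phi \in dual_pred).
Proof. exact: asboolP. Qed.

Lemma dual_pred_submod : submod_closed dual_pred.
Proof.
split.
  apply/dual_predP; split; last exact: cst_continuous.
  by move=> c x y; rewrite scaler0 addr0.
move=> c f g /dual_predP[fl fc] /dual_predP[gl gc]; apply/dual_predP; split.
  move=> k x y; rewrite [LHS]/= [in RHS]/=.
  rewrite /GRing.add /GRing.scale/= fl gl /GRing.scale/=.
  by rewrite !mulrDr addrACA !mulrA (mulrC c k).
move=> x; apply: (@continuousD R R^o X (c \*: f) g); last exact: gc.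
by apply: continuousZr; exact: fc.
Qed.

HB.instance Definition _ :=
  GRing.isSubmodClosed.Build R (X -> R^o) dual_pred dual_pred_submod.

Record dual := Dual {
  dual_fun : X -> R^o ; dual_funP : dual_fun \in dual_pred }.

HB.instance Definition _ := [isSub for dual_fun].
HB.instance Definition _ := [Choice of dual by <:].
HB.instance Definition _ := [SubChoice_isSubLmodule of dual by <:].

Definition pairing (phi : dual) (x : X) : R := dual_fun phi x.
Coercion pairing : dual >-> Funclass.

Definition dual_norm (phi : dual) : R :=
  sup [set `|phi x| | x in [set x : X | `|x| <= 1]].

Lemma dual_linear (phi : dual) : linear (dual_fun phi).
Proof. by have /dual_predP[] := dual_funP phi. Qed.

Lemma dual_continuous (phi : dual) : continuous (dual_fun phi).
Proof. by have /dual_predP[] := dual_funP phi. Qed.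

HB.instance Definition _ (phi : dual) :=
  GRing.isLinear.Build R X R^o *:%R (dual_fun phi) (dual_linear phi).

Lemma pairing0r (phi : dual) : phi 0 = 0.
Proof. exact: (linear0 (dual_fun phi)). Qed.

Lemma pairingDr (phi : dual) x y : phi (x + y) = phi x + phi y.
Proof. exact: (linearD (dual_fun phi)). Qed.

Lemma pairingZr (phi : dual) c x : phi (c *: x) = c * phi x.
Proof. by rewrite /pairing linearZ. Qed.

Lemma pairingDl (phi psi : dual) x : (phi + psi) x = phi x + psi x.
Proof. by []. Qed.

Lemma pairingZl c (phi : dual) x : (c *: phi) x = c * phi x.
Proof. by []. Qed.

Lemma dual_eqP (phi psi : dual) : (forall x, phi x = psi x) -> phi = psi.
Proof. by move=> e; apply: val_inj; apply: funext => x; exact: e. Qed.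

Lemma dual_bounded (phi : dual) :
  exists2 M : R, 0 <= M & forall x, `|phi x| <= M * `|x|.
Proof.
have /linear_boundedP[M [Mr h]] := @continuous_linear_bounded _ _ _ 0
  (dual_fun phi) (@dual_continuous phi 0).
exists (`|M| + 1); first by rewrite addr_ge0.
by apply: h; rewrite (le_lt_trans (ler_norm _))// ltrDl.
Qed.

Lemma dual_norm_has_sup (phi : dual) :
  has_sup [set `|phi x| | x in [set x : X | `|x| <= 1]].
Proof.
split; first by exists `|phi 0|, 0 => //=; rewrite normr0.
have [M M0 h] := dual_bounded phi; exists M => _ [x /= x1 <-].
by rewrite (le_trans (h x))// ler_piMr.
Qed.

Lemma dual_norm_ub (phi : dual) x : `|phi x| <= dual_norm phi * `|x|.
Proof.
have [->|x0] := eqVneq x 0; first by rewrite pairing0r !normr0 mulr0.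
have nx : 0 < `|x| by rewrite normr_gt0.
rewrite -ler_pdivrMr//.
have -> : `|phi x| / `|x| = `|phi (`|x|^-1 *: x)|.
  by rewrite pairingZr normrM normfV normr_id mulrC.
apply: sup_upper_bound; first exact: dual_norm_has_sup.
exists (`|x|^-1 *: x) => //=.
by rewrite normrZ normfV normr_id mulVf// gt_eqF.
Qed.

Lemma dual_norm_le (phi : dual) (M : R) :
  (forall x, `|x| <= 1 -> `|phi x| <= M) -> dual_norm phi <= M.
Proof.
move=> h; apply: ge_sup; last by move=> _ [x /= x1 <-]; exact: h.
by have [] := dual_norm_has_sup phi.
Qed.

Lemma dual_norm_ge0 (phi : dual) : 0 <= dual_norm phi.
Proof.
apply: (le_trans (normr_ge0 (phi 0))).
apply: sup_upper_bound; first exact: dual_norm_has_sup.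
by exists 0 => //=; rewrite normr0.
Qed.

Lemma dual_normD (phi psi : dual) :
  dual_norm (phi + psi) <= dual_norm phi + dual_norm psi.
Proof.
apply: dual_norm_le => x x1; rewrite pairingDl (le_trans (ler_normD _ _))// lerD//.
  by rewrite (le_trans (dual_norm_ub _ _))// ler_piMr// dual_norm_ge0.
by rewrite (le_trans (dual_norm_ub _ _))// ler_piMr// dual_norm_ge0.
Qed.

Lemma dual_normZ_le (c : R) (phi : dual) :
  dual_norm (c *: phi) <= `|c| * dual_norm phi.
Proof.
apply: dual_norm_le => x x1.
rewrite pairingZl normrM ler_wpM2l//.
by rewrite (le_trans (dual_norm_ub _ _))// ler_piMr// dual_norm_ge0.
Qed.

Lemma dual_normZ (c : R) (phi : dual) :
  dual_norm (c *: phi) = `|c| * dual_norm phi.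
Proof.
apply/eqP; rewrite eq_le dual_normZ_le/=.
have [->|c0] := eqVneq c 0; first by rewrite normr0 mul0r dual_norm_ge0.
have := dual_normZ_le c^-1 (c *: phi).
by rewrite scalerA mulVf// scale1r normfV ler_pdivlMl// normr_gt0.
Qed.

Lemma dual_norm0_eq0 (phi : dual) : dual_norm phi = 0 -> phi = 0.
Proof.
move=> p0; apply: dual_eqP => x; apply/eqP; rewrite -normr_le0.
by have := dual_norm_ub phi x; rewrite p0 mul0r.
Qed.

HB.instance Definition _ :=
  Lmodule_isNormed.Build R dual dual_normD dual_normZ dual_norm0_eq0.

Lemma dual_normE (phi : dual) : `|phi| = dual_norm phi.
Proof. by []. Qed.

End Dual.
Arguments dual {R} X.

Section DualMaps.
Context {R : realType}.

(* Identification of a Hilbert space with its dual: h |-> (h, .)_H. *)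
Lemma riesz_subproof (H : hilbertType R) (h : H) :
  (hdot h : H -> R^o) \in dual_pred.
Proof.
have hl : linear (hdot h : H -> R^o) by move=> c x y; exact: hdotPr.
apply/dual_predP; split=> //.
pose L := GRing.isLinear.Build R H R^o *:%R (hdot h : H -> R^o) hl.
pose f : {linear H -> R^o} := HB.pack (hdot h : H -> R^o) L.
apply: (@bounded_linear_continuous _ _ _ f); apply/linear_boundedP.
near=> r => x; apply: le_trans (CauchySchwarz_hdot h x) _.
by rewrite ler_wpM2r//; near: r; exact: nbhs_pinfty_ge.
Unshelve. all: by end_near. Qed.

Definition riesz (H : hilbertType R) (h : H) : dual H :=
  Dual (riesz_subproof h).

Definition is_dense_embedding (X Y : normedModType R) (j : X -> Y) : Prop :=
  [/\ linear j, continuous j, injective j & dense (range j)].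

Record dense_embedding (X Y : normedModType R) := DenseEmbedding {
  embed :> X -> Y ; embedP : is_dense_embedding embed }.

(* The embedding of the dual of Y into the dual of X obtained by restricting
   functionals along j, i.e. the transpose of j. *)
Lemma dual_embed_subproof (X Y : normedModType R) (j : dense_embedding X Y)
  (phi : dual Y) : (dual_fun phi \o j : X -> R^o) \in dual_pred.
Proof.
have [jl jc _ _] := embedP j; apply/dual_predP; split.
  by move=> c x y; rewrite /= jl (dual_linear phi).
by move=> x; apply: continuous_comp; [exact: jc|exact: dual_continuous].
Qed.

Definition dual_embed (X Y : normedModType R) (j : dense_embedding X Y)
    (phi : dual Y) : dual X :=
  Dual (dual_embed_subproof j phi).

End DualMaps.

Section Bochner.
Context {R : realType} {X : normedModType R}.
Local Notation mu := (@lebesgue_measure R).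
Implicit Types (D : set R) (f s : R -> X).

Definition simple_function s : Prop :=
  finite_set (range s) /\ forall v, measurable (s @^-1` [set v]).

Definition simple_integral D s : X :=
  \sum_(v \in range s) fine (mu (D `&` s @^-1` [set v])) *: v.

Definition strongly_measurable D f : Prop :=
  exists s_ : nat -> R -> X, (forall n, simple_function (s_ n)) /\
    \forall t \ae mu, D t -> s_ n t @[n --> \oo] --> f t.

Definition has_bochner_integral D f (I : X) : Prop :=
  exists s_ : nat -> R -> X,
    [/\ strongly_measurable D f,
        forall n, simple_function (s_ n),
        (\int[mu]_(t in D) (`|f t - s_ n t|%:E) @[n --> \oo] --> 0)%E
      & simple_integral D (s_ n) @[n --> \oo] --> I].

(* The elements of L^2(0,T;X) and L^oo(0,T;X) are represented by functions on R
   of which only the values almost everywhere on [0,T] matter. *)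
Definition in_L2 (T : R) f : Prop :=
  strongly_measurable `[0, T] f /\
  (\int[mu]_(t in `[0%R, T]) ((`|f t| ^+ 2)%:E) < +oo)%E.

Definition in_Loo (T : R) f : Prop :=
  strongly_measurable `[0, T] f /\
  exists M : R, \forall t \ae mu, t \in `[0, T] -> `|f t| <= M.

Definition C1c (T : R) (phi : R -> R) : Prop :=
  [/\ forall t, derivable phi t 1,
      continuous (derive1 phi)
    & exists K : set R,
        [/\ compact K, K `<=` `]0, T[ & forall t, ~ K t -> phi t = 0]].

(* Derivative in the sense of distributions, tested against C^1 functions with
   compact support in the open interval ]0,T[ (as in Brezis, Functional
   Analysis, Sobolev Spaces and PDE, Section 8.2); the integrals are Bochner
   integrals in X. *)
Definition weak_derivative (T : R) (x g : R -> X) : Prop :=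
  forall phi : R -> R, C1c T phi -> exists I : X,
    has_bochner_integral `[0, T] (fun t => derive1 phi t *: x t) I /\
    has_bochner_integral `[0, T] (fun t => phi t *: g t) (- I).

End Bochner.

Section Operator.
Context {R : realType}.

(* An operator is a map A together with its domain D; the values of A outside
   of D are irrelevant. *)
Definition linear_operator (H : hilbertType R) (D : set H) (A : H -> H) :=
  D 0 /\ forall c x y, D x -> D y ->
    D (c *: x + y) /\ A (c *: x + y) = c *: A x + A y.

Definition closed_operator (H : hilbertType R) (D : set H) (A : H -> H) :=
  closed [set p : H * H | D p.1 /\ p.2 = A p.1].

Context {H W V : hilbertType R}.
Variables (jVW : dense_embedding V W) (jWH : dense_embedding W H).

Definition H_to_Wdual (h : H) : dual W := dual_embed jWH (riesz h).
Definition H_to_Vdual (h : H) : dual V := dual_embed jVW (H_to_Wdual h).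

(* A is the part in H of its extension [Aw]: Aw agrees with A on D(A), and
   D(A) = { w in W | Aw w in H }.  Without the second half, [Aw] may have
   arbitrarily large positive eigenvalues outside of D(A), which a coercivity
   estimate on D(A) does not see. *)
Definition extends_operator (D : set H) (A : H -> H) (Aw : W -> dual V) :=
  forall (w : W) (h : H),
    Aw w = H_to_Vdual h <-> D (jWH w) /\ A (jWH w) = h.

Definition a_form (Aw : W -> dual V) (w : W) (v : V) : R := - (Aw w v).

(* Membership of x in H^1(0,T;V^* ) is that of H_to_Vdual \o x.  Here w is x
   regarded as an element of L^2(0,T;W), xc is the continuous representative in
   C([0,T];V^* ), at which the initial condition is read, and x' is the
   derivative in L^2(0,T;V^* ). *)
Definition weak_solution (T : R) (Aw : W -> dual V) (x0 : H)
    (f : R -> dual W) (x : R -> H) : Prop :=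
  in_Loo T x /\
  exists (w : R -> W) (xc x' : R -> dual V),
  [/\ in_L2 T w /\
        (\forall t \ae @lebesgue_measure R, t \in `[0, T] -> jWH (w t) = x t),
      [/\ {within `[0, T], continuous xc},
          \forall t \ae @lebesgue_measure R,
            t \in `[0, T] -> xc t = H_to_Vdual (x t)
        & xc 0 = H_to_Vdual x0],
      in_L2 T x' /\ weak_derivative T (H_to_Vdual \o x) x'
    & \forall t \ae @lebesgue_measure R, t \in `[0, T] ->
        forall y : V, x' t y + a_form Aw (w t) y = f t (jVW y)].

End Operator.

Section Galerkin.
Context {R : realType} {H : hilbertType R}.

Definition schauder_basis (h : nat -> H) : Prop :=
  forall x : H, exists! c : nat -> R,
    \sum_(i < n) c i *: h i @[n --> \oo] --> x.

Definition first_span (h : nat -> H) (n : nat) : set H :=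
  [set x | exists c : nat -> R, x = \sum_(i < n) c i *: h i].

Definition selfadjoint_projection (F : set H) (P : H -> H) : Prop :=
  [/\ linear P, forall x, P (P x) = P x,
      forall x y, hdot (P x) y = hdot x (P y) & range P = F].

Definition galerkin_family (V : hilbertType R) (jVH : V -> H)
    (h : nat -> V) (Pi : nat -> H -> H) : Prop :=
  schauder_basis (jVH \o h) /\
  forall n, selfadjoint_projection (first_span (jVH \o h) n) (Pi n).

End Galerkin.

(* Main.v *)
(** The compatibility of the form with the Galerkin projections forces each
    [F_n] to be an invariant subspace of [A], on which [A] is diagonal: with
    [e_n] the normalization of [h_n - Pi_n h_n], the [e_n] form an orthonormal
    basis of [H] made of elements of [V] with [A e_n = lam_n e_n], and
    coercivity bounds the norm of [W] by the energy [sum_n (a - lam_n) x_n^2].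
    The equation thus splits into the scalar equations
    [x_n' = lam_n x_n + <f, e_n>], solved by Duhamel's formula.  Testing
    [f(t)] against the [e_n] gives
    [sum_n <f, e_n>^2 / (a - lam_n) <= |f|^2 / b], so that the scalar estimates
    add up to convergence of [sum_n x_n(t) e_n] in [H] uniformly in [t], and
    in [W] for a.e. [t].  The span of the [e_n] need not be dense in [V]: that
    the limit satisfies the equation against all of [V] uses that every
    functional on [W] is of the form [Aw u], where [u] has finite energy.
    For uniqueness, each coordinate of a weak solution is a continuous function
    satisfying the scalar equation in the sense of distributions. *)
Require Import Defs.
From HB Require Import structures.
From mathcomp Require Import all_boot all_order all_algebra finmap.
From mathcomp Require Import all_classical all_reals all_analysis.
From mathcomp Require Import measurable_realfun.
From mathcomp Require Import ring lra.
Import Order.TTheory GRing.Theory Num.Theory.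
Import numFieldNormedType.Exports.
Local Open Scope classical_set_scope.
Local Open Scope ring_scope.

Set Implicit Arguments.
Unset Strict Implicit.
Unset Printing Implicit Defensive.

(** * Lower integrals and simple functions *)

(** The eigenvalues lie below [a] but may tend to minus infinity, so every scalar estimate has to be
    uniform in the gap [m = a - lam]. The kernel [exp (- m t)] has mass at most [1 / m], and [1 / m]
    is precisely the weight that makes the squared coefficients of a functional on [W] summable. A
    single number per mode, [duhamel_bound], therefore controls both the supremum of the squared
    mode and [m] times its integral; summed over the modes, the first control is the one in [H] and
    the second the one in [W].

    A second obstacle is that the forcing is only square integrable in time: a mode need not be
    differentiable everywhere, so the equation is handled against test functions, with Fubini on a
    triangle in the role of the product rule. Derivatives live in the dual of [V], where a Bochner
    integral is determined by its pairings with vectors; identities between such integrals thus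
    become scalar ones. *)

Section LowerIntegral.
Local Open Scope ereal_scope.
Context d (T : measurableType d) (R : realType).
Variable mu : {measure set T -> \bar R}.
Implicit Types (D N : set T) (f g : T -> \bar R).

Import HBNNSimple.

(* The integral of a non-measurable nonnegative function is the supremum of the
   integrals of the simple functions below it, so that monotonicity and
   invariance under a.e. equality do not need measurability. *)
Lemma ge0_ae_le_integral_nomeas D f g :
  (forall x, D x -> 0 <= f x) -> (forall x, D x -> 0 <= g x) ->
  {ae mu, forall x, D x -> f x <= g x} ->
  \int[mu]_(x in D) f x <= \int[mu]_(x in D) g x.
Proof.
move=> f0 g0 [N [mN N0 subN]].
rewrite !ge0_integralE//; apply: ge_ereal_sup => _ [h /= hf <-].
(* Cutting [h] off on the exceptional null set keeps its integral and puts it below [g] at every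
   point. *)
pose h' := mul_nnsfun h (indic_nnsfun R (measurableC mN)).
have h'E t : h' t = (h t * \1_(~` N) t)%R by [].
have hh' : sintegral mu h = sintegral mu h'.
  rewrite -!integralT_nnsfun; apply: ge0_ae_eq_integral => //.
  - exact/measurable_EFinP.
  - exact/measurable_EFinP.
  - by move=> x _; rewrite lee_fin.
  - by move=> x _; rewrite lee_fin.
  - exists N; split=> // x /= /not_implyP[_ xN]; apply: contrapT => nxN.
    by apply: xN; rewrite -[RHS]/((h' x)%:E) h'E indicE mem_set// mulr1.
rewrite hh'; apply: ereal_sup_ubound; exists h' => // x.
rewrite -[X in X%:E]/(h' x) h'E indicE; have [xN|xN] := boolP (x \in ~` N); last first.
  by rewrite mulr0 /patch; case: ifP => //; rewrite inE => /g0.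
rewrite mulr1; apply: (le_trans (hf x)); rewrite /patch.
case: ifP => //; rewrite inE => Dx; apply: contrapT => fg.
by move: xN; rewrite inE; apply; apply: subN => /= /(_ Dx).
Qed.

Lemma ge0_le_integral_nomeas D f g :
  (forall x, D x -> 0 <= f x) -> (forall x, D x -> f x <= g x) ->
  \int[mu]_(x in D) f x <= \int[mu]_(x in D) g x.
Proof.
move=> f0 fg; apply: ge0_ae_le_integral_nomeas => //; last exact: aeW.
by move=> x Dx; rewrite (le_trans (f0 _ Dx))// fg.
Qed.

Lemma ae_eq_integral_nomeas D f g : {ae mu, forall x, D x -> f x = g x} ->
  \int[mu]_(x in D) f x = \int[mu]_(x in D) g x.
Proof.
move=> fg; rewrite integralE [RHS]integralE.
congr (_ - _); apply/eqP; rewrite eq_le; apply/andP; split;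
  apply: ge0_ae_le_integral_nomeas => //;
  by apply: filterS fg => x /= + Dx => /(_ Dx) e; rewrite ?funeposE ?funenegE e.
Qed.

Lemma ae_eq_Rintegral_nomeas D (f g : T -> R) :
  {ae mu, forall x, D x -> f x = g x} ->
  (\int[mu]_(x in D) f x = \int[mu]_(x in D) g x)%R.
Proof.
move=> fg; rewrite /Rintegral; congr fine; apply: ae_eq_integral_nomeas.
by apply: filterS fg => x /= + Dx => /(_ Dx) ->.
Qed.

End LowerIntegral.

Section SimpleFunctions.
Context {R : realType}.
Local Notation mu := (@lebesgue_measure R).

Lemma ae_mono (P Q : R -> Prop) : (forall t, P t -> Q t) ->
  (\forall t \ae mu, P t) -> \forall t \ae mu, Q t.
Proof.
move=> PQ [N [mN N0 PN]]; exists N; split=> // t /= nQ; apply: PN => /= Pt.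
exact/nQ/PQ.
Qed.

Lemma ae_mono2 (P Q S : R -> Prop) : (forall t, P t -> Q t -> S t) ->
  (\forall t \ae mu, P t) -> (\forall t \ae mu, Q t) -> \forall t \ae mu, S t.
Proof.
move=> PQS [N1 [mN1 N10 PN1]] [N2 [mN2 N20 QN2]]; exists (N1 `|` N2); split.
- exact: measurableU.
- exact: null_set_setU.
- move=> t /= nS; apply: contrapT => /not_orP[n1 n2]; apply: nS; apply: PQS.
    by apply: contrapT => nP; exact/n1/PN1.
  by apply: contrapT => nQ; exact/n2/QN2.
Qed.

Lemma lebesgue_ae_le_integral (D : set R) (f g : R -> \bar R) :
  (forall t, D t -> 0 <= f t)%E -> (forall t, D t -> 0 <= g t)%E ->
  (\forall t \ae mu, D t -> (f t <= g t)%E) ->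
  (\int[mu]_(t in D) f t <= \int[mu]_(t in D) g t)%E.
Proof. exact: (@ge0_ae_le_integral_nomeas _ _ R mu D f g). Qed.

Lemma lebesgue_ae_eq_integral (D : set R) (f g : R -> \bar R) :
  (\forall t \ae mu, D t -> f t = g t) ->
  (\int[mu]_(t in D) f t = \int[mu]_(t in D) g t)%E.
Proof. exact: (@ae_eq_integral_nomeas _ _ R mu D f g). Qed.

Lemma lebesgue_ae_eq_Rintegral (D : set R) (f g : R -> R) :
  (\forall t \ae mu, D t -> f t = g t) ->
  \int[mu]_(t in D) f t = \int[mu]_(t in D) g t.
Proof. exact: (@ae_eq_Rintegral_nomeas _ _ R mu D f g). Qed.

(** Since the range is finite, the preimage of any [B] whatsoever is a finite union of level sets.
    Hence composition with arbitrary maps preserves simple functions. *)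
Lemma simple_function_preimage (X : normedModType R) (s : R -> X) (B : set X) :
  simple_function s -> measurable (s @^-1` B).
Proof.
move=> [sfin sm].
have -> : s @^-1` B = \bigcup_(v in range s `&` B) s @^-1` [set v].
  rewrite eqEsubset; split=> [t Bt|t [v [_ Bv] /= ->]//].
  by exists (s t) => //; split => //; exists t.
by apply: fin_bigcup_measurable => //; exact: finite_setIl.
Qed.

Lemma simple_function_comp (X Y : normedModType R) (g : X -> Y) (s : R -> X) :
  simple_function s -> simple_function (g \o s).
Proof.
move=> ss; split=> [|v].
  have [sfin _] := ss.
  apply: sub_finite_set (finite_image g sfin) => _ [t _ <-] /=.
  by exists (s t) => //; exists t.
by rewrite comp_preimage; exact: simple_function_preimage.
Qed.

Lemma simple_function_pair (X Y : normedModType R) (s : R -> X) (u : R -> Y) :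
  simple_function s -> simple_function u ->
  simple_function (fun t => (s t, u t)).
Proof.
move=> ss su; split=> [|v].
  have [sfin _] := ss; have [ufin _] := su.
  apply: sub_finite_set (finite_setX sfin ufin) => _ [t _ <-] /=.
  by split; exists t.
have -> : (fun t => (s t, u t)) @^-1` [set v] =
    s @^-1` [set v.1] `&` u @^-1` [set v.2].
  rewrite eqEsubset; split=> t /=; first by move=> <-.
  by case: v => v1 v2 /= [-> ->].
by apply: measurableI; exact: simple_function_preimage.
Qed.

Lemma simple_function_comp2 (X Y Z : normedModType R) (g : X -> Y -> Z)
    (s : R -> X) (u : R -> Y) : simple_function s -> simple_function u ->
  simple_function (fun t => g (s t) (u t)).
Proof.
move=> ss su.
exact: (simple_function_comp (fun p : X * Y => g p.1 p.2)
  (simple_function_pair ss su)).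
Qed.

Lemma simple_function_indic (D : set R) :
  measurable D -> simple_function (\1_D : R -> R^o).
Proof.
move=> mD; split=> [|v].
  apply: (@sub_finite_set _ _ [set 0; 1]) => // _ [t _ <-].
  by rewrite indicE; case: (_ \in _); [right|left].
rewrite -[_ @^-1` _]setTI.
exact: (@measurable_indic _ _ R setT D mD measurableT _ (measurable_set1 v)).
Qed.

Lemma simple_functionD (X : normedModType R) (s u : R -> X) :
  simple_function s -> simple_function u ->
  simple_function (fun t => s t + u t).
Proof. exact: (simple_function_comp2 (fun x y : X => x + y)). Qed.

Lemma simple_functionM (X : normedModType R) (k : R -> R^o) (s : R -> X) :
  simple_function k -> simple_function s ->
  simple_function (fun t => (k t : R) *: s t).
Proof. exact: (simple_function_comp2 (fun (c : R^o) (x : X) => (c : R) *: x)). Qed.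

Lemma simple_function_measurable (s : R -> R^o) :
  simple_function s -> measurable_fun setT (s : R -> R).
Proof. by move=> ss _ B mB; rewrite setTI; exact: simple_function_preimage. Qed.

Lemma simple_function_norm_bounded (X : normedModType R) (s : R -> X) :
  simple_function s -> exists2 M : R, 0 <= M & forall t, `|s t| <= M.
Proof.
move=> [sfin _]; pose M := \sum_(v \in range s) `|v|.
exists M => [|t]; first exact: fsumr_ge0.
have st : s t \in fset_set (range s) by rewrite in_fset_set// inE; exists t.
by rewrite /M fsbig_finite//= (bigD1_seq (s t)) ?fset_uniq//= lerDl sumr_ge0.
Qed.

Lemma bounded_integrable (D : set R) (f : R -> R) (M : R) :
  measurable D -> (mu D < +oo)%E -> measurable_fun D f ->
  (forall t, D t -> `|f t| <= M) -> mu.-integrable D (EFin \o f).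
Proof.
move=> mD Doo mf fM; apply: measurable_bounded_integrable => //.
rewrite /bounded_near; near=> K => t Dt /=; apply: (le_trans (fM _ Dt)).
by near: K; apply: nbhs_pinfty_ge; exact: num_real.
Unshelve. all: by end_near. Qed.

Lemma EFin_integrableZ (D : set R) (f : R -> R) (k : R) : measurable D ->
  mu.-integrable D (EFin \o f) -> mu.-integrable D (EFin \o (fun t => k * f t)).
Proof.
move=> mD fi; have := @integrableZl _ _ R mu D mD k _ fi.
by apply: eq_integrable.
Qed.

Lemma EFin_integrableD (D : set R) (f g : R -> R) : measurable D ->
  mu.-integrable D (EFin \o f) -> mu.-integrable D (EFin \o g) ->
  mu.-integrable D (EFin \o (fun t => f t + g t)).
Proof.
move=> mD fi gi; have := @integrableD _ _ R mu D mD _ _ fi gi.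
by apply: eq_integrable.
Qed.

Lemma EFin_integrable_le (D : set R) (f g : R -> R) : measurable D ->
  measurable_fun D f -> (forall t, D t -> `|f t| <= g t) ->
  mu.-integrable D (EFin \o g) -> mu.-integrable D (EFin \o f).
Proof.
move=> mD mf fg gi; apply: (le_integrable _ _ _ gi) => //.
  exact/measurable_EFinP.
by move=> t Dt; rewrite /= lee_fin (le_trans (fg t Dt))// ler_norm.
Qed.

(** Multiplying by the indicator of [D] minus a measurable null set turns almost-everywhere
    convergence into convergence at every point. Measurability of norms and pairings of [g] then
    follows from pointwise limits. *)
Lemma strongly_measurable_normalize (X : normedModType R) (D : set R)
    (f : R -> X) : measurable D -> strongly_measurable D f ->
  exists (g : R -> X) (s_ : nat -> R -> X),
    [/\ forall n, simple_function (s_ n),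
        forall t, s_ n t @[n --> \oo] --> g t,
        forall t, ~ D t -> g t = 0
      & \forall t \ae mu, D t -> f t = g t].
Proof.
move=> mD [s_ [ss [N [mN N0 subN]]]].
pose E := D `\` N; have mE : measurable E by exact: measurableD.
exists (fun t => \1_E t *: f t), (fun n t => \1_E t *: s_ n t); split.
- by move=> n; apply: simple_functionM => //; exact: simple_function_indic.
- move=> t; rewrite indicE; have [tE|tE] := boolP (t \in E); last first.
    by rewrite scale0r; under eq_fun do rewrite scale0r; exact: cvg_cst.
  rewrite scale1r; under eq_fun do rewrite scale1r.
  move: tE; rewrite inE => -[Dt Nt]; apply: contrapT => h; apply: Nt.
  by apply: subN => /= /(_ Dt).
- by move=> t Dt; rewrite indicE memNset ?scale0r// => -[].
- exists N; split=> // t /= h; apply: contrapT => Nt; apply: h => Dt.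
  by rewrite indicE mem_set// scale1r.
Qed.

Lemma measurable_fun_cvg_simple (s_ : nat -> R -> R^o) (g : R -> R) :
  (forall n, simple_function (s_ n)) ->
  (forall t, s_ n t @[n --> \oo] --> (g t : R^o)) -> measurable_fun setT g.
Proof.
move=> ss sg; apply: (@measurable_fun_cvg _ _ R setT s_) => // n.
exact: simple_function_measurable.
Qed.

Lemma simple_integral_pairing (X : normedModType R) (D : set R)
    (s : R -> dual X) (v : X) : measurable D -> (mu D < +oo)%E ->
  simple_function s ->
  (simple_integral D s) v = \int[mu]_(t in D) (s t v).
Proof.
move=> mD Doo ss; have [sfin sm] := ss.
rewrite /simple_integral fsbig_finite//=.
have pairing_sum (r : seq (dual X)) (c : dual X -> R) :
    (\sum_(i <- r) c i *: i) v = \sum_(i <- r) c i * i v.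
  elim: r => [|x r ih]; first by rewrite !big_nil.
  by rewrite !big_cons pairingDl pairingZl ih.
rewrite pairing_sum.
have mI i : measurable (D `&` s @^-1` [set i]) by apply: measurableI.
have finI i : (mu (D `&` s @^-1` [set i]) < +oo)%E.
  by apply: (le_lt_trans _ Doo); apply: le_measure; rewrite ?inE//; exact: mI.
have iI i : mu.-integrable D (fun t => (\1_(s @^-1` [set i]) t : R)%:E).
  apply/integrableP; split.
    by apply/measurable_EFinP; apply: measurable_indic; exact: sm.
  under eq_integral do rewrite gee0_abs ?lee_fin//.
  rewrite integral_indic//; [by rewrite setIC; exact: finI|exact: sm].
(* Splitting over the level sets of [s] turns the scalar integral into the sum that defines
   [simple_integral]. *)
have sE t : s t v =
    \sum_(i <- fset_set (range s)) i v * \1_(s @^-1` [set i]) t.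
  have st : s t \in fset_set (range s) by rewrite in_fset_set// inE; exists t.
  rewrite (bigD1_seq (s t)) ?fset_uniq//= big1 ?addr0 => [|i /eqP ist].
    by rewrite indicE mem_set// mulr1.
  by rewrite indicE memNset ?mulr0// => /= /esym.
rewrite /Rintegral.
under eq_integral do rewrite sE -sumEFin.
rewrite integral_sum//=; last first.
  move=> i; under eq_fun do rewrite EFinM.
  by apply: integrableZl => //; exact: iI.
rewrite -sum_fine; last first.
  move=> i _; under eq_integral do rewrite EFinM.
  rewrite integralZl//.
  rewrite integral_indic//=; last exact: sm.
  rewrite fin_numM//.
  by rewrite ge0_fin_numE// setIC finI.
apply: eq_bigr => i _; under eq_integral do rewrite EFinM.
rewrite integralZl//.
rewrite integral_indic//; last exact: sm.
rewrite fineM//= 1?mulrC 1?setIC//.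
by rewrite ge0_fin_numE//; exact: finI.
Qed.

End SimpleFunctions.

(** * Bochner integrals in dual spaces *)

Section Functionals.
Context {R : realType}.

Lemma dual_of_bounded_linear (X : normedModType R) (phi : X -> R) (M : R) :
  (forall c x y, phi (c *: x + y) = c * phi x + phi y) ->
  (forall x, `|phi x| <= M * `|x|) -> exists F : dual X, forall x, F x = phi x.
Proof.
move=> phil phiM.
suff h : (phi : X -> R^o) \in dual_pred by exists (Dual h).
have hl : linear (phi : X -> R^o) by move=> c x y; exact: phil.
apply/dual_predP; split=> //.
pose L := GRing.isLinear.Build R X R^o *:%R (phi : X -> R^o) hl.
pose f : {linear X -> R^o} := HB.pack (phi : X -> R^o) L.
apply: (@bounded_linear_continuous _ _ _ f); apply/linear_boundedP.
near=> r => x; apply: le_trans (phiM x) _.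
by rewrite ler_wpM2r//; near: r; exact: nbhs_pinfty_ge.
Unshelve. all: by end_near. Qed.

(** Evaluation at [v] is itself a functional on [dual X], bounded by the norm of [v]. *)
Lemma pairing_continuous (X : normedModType R) (v : X) :
  continuous (fun F : dual X => F v : R).
Proof.
have [|F|G GE] := @dual_of_bounded_linear (dual X) (fun F => F v) `|v|.
- by move=> c F G; rewrite pairingDl pairingZl.
- by rewrite mulrC dual_normE dual_norm_ub.
have -> : (fun F : dual X => F v) = dual_fun G by apply/funext => F; rewrite -GE.
exact: dual_continuous.
Qed.

End Functionals.

Section BochnerDual.
Context {R : realType} {X : normedModType R}.
Local Notation mu := (@lebesgue_measure R).
Implicit Types (D : set R) (g : R -> dual X).

Lemma pairing_cvg (F_ : nat -> dual X) (F : dual X) (v : X) :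
  F_ n @[n --> \oo] --> F -> F_ n v @[n --> \oo] --> F v.
Proof.
move=> FF; apply: (@continuous_cvg _ _ _ _ _ F_ (fun G : dual X => G v : R) F) => //.
exact: pairing_continuous.
Qed.

Lemma simple_function_pairing (s : R -> dual X) (v : X) :
  simple_function s -> simple_function (fun t => s t v : R^o).
Proof. by move=> ss; exact: (simple_function_comp (fun F : dual X => F v : R^o) ss). Qed.

Lemma measurable_norm_dist (u_ : nat -> R -> dual X) g (s : R -> dual X) :
  (forall n, simple_function (u_ n)) ->
  (forall t, u_ n t @[n --> \oo] --> g t) -> simple_function s ->
  measurable_fun setT (fun t => `|g t - s t|).
Proof.
move=> su ug ss.
apply: (@measurable_fun_cvg_simple _ (fun n t => `|u_ n t - s t| : R^o)).
  move=> n.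
  exact: (simple_function_comp2 (fun x y : dual X => `|x - y| : R^o) (su n) ss).
by move=> t; apply: cvg_norm; apply: cvgB; [exact: ug|exact: cvg_cst].
Qed.

Lemma simple_pairing_integrable D (s : R -> dual X) (v : X) : measurable D ->
  (mu D < +oo)%E -> simple_function s -> mu.-integrable D (EFin \o (fun t => s t v)).
Proof.
move=> mD Doo ss; have [M M0 hM] := simple_function_norm_bounded ss.
apply: (@bounded_integrable _ _ _ (M * `|v|)) => //.
  by apply: measurable_funTS; apply: simple_function_measurable;
    exact: simple_function_pairing.
by move=> t _; rewrite (le_trans (dual_norm_ub _ _))// ler_wpM2r//; exact: hM.
Qed.

(** The estimate depends on [v] only through its norm. For a fixed [v] it identifies the pairings of
    a given Bochner integral; taken over the unit ball it gives convergence in the dual norm.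
    Integrability of the pairing comes from writing [g] as [g - s] plus the bounded function [s]. *)
Lemma pairing_integral_dist (u_ : nat -> R -> dual X) g D
    (s : R -> dual X) (v : X) :
  measurable D -> (mu D < +oo)%E -> (forall n, simple_function (u_ n)) ->
  (forall t, u_ n t @[n --> \oo] --> g t) -> simple_function s ->
  (\int[mu]_(t in D) `|g t - s t|%:E < +oo)%E ->
  mu.-integrable D (EFin \o (fun t => g t v)) /\
  `|\int[mu]_(t in D) g t v - (simple_integral D s) v| <=
    (\int[mu]_(t in D) `|g t - s t|) * `|v|.
Proof.
move=> mD Doo su ug ss foo.
have mgv : measurable_fun setT (fun t => g t v).
  apply: (@measurable_fun_cvg_simple _ (fun n t => u_ n t v : R^o)).
    by move=> n; exact: simple_function_pairing.
  by move=> t; exact: pairing_cvg (ug t).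
have msv : measurable_fun setT (fun t => s t v).
  by apply: simple_function_measurable; exact: simple_function_pairing.
have mgs := measurable_norm_dist su ug ss.
have igs : mu.-integrable D (EFin \o (fun t => `|g t - s t|)).
  apply/integrableP; split; first exact/measurable_EFinP/measurable_funTS.
  by under eq_integral do rewrite /= normr_id.
have le_gs t : `|g t v - s t v| <= `|v| * `|g t - s t|.
  rewrite mulrC; have -> : g t v - s t v = (g t - s t) v by [].
  exact: dual_norm_ub.
have igsv : mu.-integrable D (EFin \o (fun t => `|v| * `|g t - s t|)).
  by apply: EFin_integrableZ.
have isv := simple_pairing_integrable v mD Doo ss.
have id : mu.-integrable D (EFin \o (fun t => g t v - s t v)).
  by apply: EFin_integrable_le igsv => //; apply: measurable_funTS;
    exact: measurable_funB.
have ig : mu.-integrable D (EFin \o (fun t => g t v)).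
  have := EFin_integrableD mD id isv; apply: eq_integrable => // t _.
  by rewrite /= subrK.
split=> //; rewrite simple_integral_pairing// -RintegralB//.
apply: (le_trans (le_normr_Rintegral _ _)) => //.
rewrite mulrC -RintegralZl//; apply: le_Rintegral => //.
by apply: integrable_norm.
Qed.

Lemma bochner_integral_pairing D g (I : dual X) (v : X) :
  measurable D -> (mu D < +oo)%E -> has_bochner_integral D g I ->
  I v = \int[mu]_(t in D) g t v.
Proof.
move=> mD Doo [s_ [smg ss gs0 sI]].
have [g' [u_ [su ug _ gg']]] := strongly_measurable_normalize mD smg.
rewrite (@lebesgue_ae_eq_Rintegral _ D _ (fun t => g' t v)); last first.
  by apply: ae_mono gg' => t + Dt => /(_ Dt) ->.
have {gs0} : (\int[mu]_(t in D) (`|g' t - s_ n t|%:E) @[n --> \oo] --> 0)%E.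
  apply: cvg_trans gs0; apply: near_eq_cvg; apply: nearW => n.
  apply: lebesgue_ae_eq_integral.
  by apply: ae_mono gg' => t /= + Dt => /(_ Dt) ->.
move=> /fine_cvgP[fin dist0].
rewrite -(cvg_lim (@Rhausdorff R) (pairing_cvg (v := v) sI)).
apply: cvg_lim; first exact: Rhausdorff.
pose d n := \int[mu]_(t in D) `|g' t - s_ n t|.
have d0 : d n * `|v| @[n --> \oo] --> 0.
  by rewrite -(mul0r `|v|); apply: cvgM; [exact: dist0|exact: cvg_cst].
apply/cvgrPdist_le => e e0; move/cvgrPdist_le : d0 => /(_ _ e0).
apply: filterS2 fin => n /= fin; rewrite sub0r normrN => de.
have [|_ h] := @pairing_integral_dist _ _ _ (s_ n) v mD Doo su ug (ss n).
  by rewrite ltey_eq fin.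
by rewrite (le_trans h)// (le_trans _ de)// ler_norm.
Qed.

(** Truncated simple approximations converge to [g] in the integral norm by dominated convergence,
    and [pairing_integral_dist] then upgrades the weak identity for [I] to a limit in norm. *)
Lemma has_bochner_integral_dominated D g (B : R -> R) (I : dual X) :
  measurable D -> (mu D < +oo)%E -> strongly_measurable D g ->
  mu.-integrable D (EFin \o B) ->
  (\forall t \ae mu, D t -> `|g t| <= B t) ->
  (forall v, I v = \int[mu]_(t in D) g t v) ->
  has_bochner_integral D g I.
Proof.
move=> mD Doo smg iB gB IE.
have [g' [u_ [su ug _ gg']]] := strongly_measurable_normalize mD smg.
have mB : measurable_fun D B by apply/measurable_EFinP; case/integrableP: iB.
(* The truncation level is [B t + 1] rather than [B t]: since the limit has norm at most [B t], the
   strict margin makes the truncation inactive for large [n]. *)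
pose E n := D `&` [set t | `|u_ n t| <= B t + 1].
have mE n : measurable (E n).
  apply: measurable_fun_le => //; last exact: measurable_funD.
  apply: measurable_funTS; apply: simple_function_measurable.
  exact: (simple_function_comp (fun F : dual X => `|F| : R^o) (su n)).
pose s_ n t : dual X := \1_(E n) t *: u_ n t.
have ss n : simple_function (s_ n).
  by apply: simple_functionM => //; exact: simple_function_indic.
have s_le n t : D t -> `|g' t| <= B t -> `|s_ n t| <= B t + 1.
  move=> Dt gBt; have B0 : 0 <= B t by rewrite (le_trans _ gBt).
  rewrite /s_ indicE; have [|tE] := boolP (t \in E n).
    by rewrite inE => -[_ /= h]; rewrite scale1r.
  by rewrite scale0r normr0 addr_ge0.
have s_g t : D t -> `|g' t| <= B t -> s_ n t @[n --> \oo] --> g' t.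
  move=> Dt gBt; apply: cvg_trans (ug t); apply: near_eq_cvg.
  have : \forall n \near \oo, `|u_ n t| < B t + 1.
    apply: (cvgr_lt _ (cvg_norm (ug t))).
    by rewrite (le_lt_trans gBt)// ltrDl.
  by apply: filterS => n un; rewrite /s_ indicE mem_set ?scale1r//; split => //=;
    exact: ltW.
have g'B : {ae mu, forall t, D t -> `|g' t| <= B t}.
  by apply: ae_mono2 gB gg' => t + + Dt => /(_ Dt) + /(_ Dt) <-.
have mgs n : measurable_fun setT (fun t => `|g' t - s_ n t|).
  exact: (measurable_norm_dist su ug (ss n)).
have iB2 : mu.-integrable D (EFin \o (fun t => B t + (B t + 1))).
  have i1 : mu.-integrable D (EFin \o (fun=> 1 : R)).
    by apply: (@bounded_integrable _ _ _ 1) => // t _; rewrite normr1.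
  by do 2 apply: EFin_integrableD => //.
have mgsE n : measurable_fun D (fun t => `|g' t - s_ n t|%:E).
  by apply/measurable_EFinP; exact: measurable_funTS.
have cv : {ae mu, forall t, D t -> `|g' t - s_ n t|%:E @[n --> \oo] --> 0%E}.
  apply: ae_mono g'B => t gB' Dt; apply: cvg_EFin; first exact: nearW.
  rewrite -(normr0 (dual X)) -(subrr (g' t)); apply: cvg_norm.
  by apply: cvgB; [exact: cvg_cst|exact: s_g (gB' Dt)].
have dom : {ae mu, forall t n, D t ->
    (`| `|g' t - s_ n t|%:E | <= ((B t + (B t + 1))%R)%:E)%E}.
  apply: ae_mono g'B => t gB' n Dt; rewrite /= lee_fin normr_id.
  rewrite (le_trans (ler_normB _ _))// lerD ?gB'//.
  by apply: s_le => //; exact: gB'.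
have [_ _] := @dominated_convergence _ _ R mu D mD
  (fun n t => `|g' t - s_ n t|%:E) (fun=> 0%E) _ mgsE (measurable_cst _) cv iB2 dom.
rewrite integral0 => dist0.
exists s_; split; [exact: smg|exact: ss| |].
  apply: cvg_trans dist0; apply: near_eq_cvg; apply: nearW => n.
  apply: lebesgue_ae_eq_integral.
  by apply: ae_mono gg' => t /= + Dt => /(_ Dt) ->.
move/fine_cvgP : dist0 => [fin dist0].
apply/cvgrPdist_le => e e0; move/cvgrPdist_le : dist0 => /(_ _ e0).
apply: filterS2 fin => n /= fin; rewrite sub0r normrN => de.
rewrite dual_normE; apply: dual_norm_le => v v1.
have [|_ h] := @pairing_integral_dist _ _ _ (s_ n) v mD Doo su ug (ss n).
  by rewrite ltey_eq fin.
have -> : (I - simple_integral D (s_ n)) v = I v - (simple_integral D (s_ n)) v.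
  by [].
rewrite IE (lebesgue_ae_eq_Rintegral (g := fun t => g' t v)); last first.
  by apply: ae_mono gg' => t /= + Dt => /(_ Dt) ->.
rewrite (le_trans h)// (le_trans _ de)// (le_trans _ (ler_norm _))//.
by rewrite ler_piMr// fine_ge0// integral_ge0.
Qed.

(** In a dual space the candidate can be written down at once: it is the functional sending [v] to
    the integral of [g t v], bounded by the integral of the majorant. *)
Lemma bochner_integral_exists D g (B : R -> R) :
  measurable D -> (mu D < +oo)%E -> strongly_measurable D g ->
  mu.-integrable D (EFin \o B) ->
  (\forall t \ae mu, D t -> `|g t| <= B t) ->
  exists2 I : dual X, has_bochner_integral D g I &
    forall v, I v = \int[mu]_(t in D) g t v.
Proof.
move=> mD Doo smg iB gB.
suff [I IE] : exists I : dual X, forall v, I v = \int[mu]_(t in D) g t v.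
  by exists I => //; exact: (has_bochner_integral_dominated mD Doo smg iB gB IE).
have [g' [u_ [su ug _ gg']]] := strongly_measurable_normalize mD smg.
have gg'v v : \int[mu]_(t in D) g t v = \int[mu]_(t in D) g' t v.
  apply: lebesgue_ae_eq_Rintegral.
  by apply: ae_mono gg' => t /= + Dt => /(_ Dt) ->.
have mg v : measurable_fun D (fun t => g' t v).
  apply: measurable_funTS.
  apply: (@measurable_fun_cvg_simple _ (fun n t => u_ n t v : R^o)).
    by move=> n; exact: simple_function_pairing.
  by move=> t; exact: pairing_cvg (ug t).
have g'B : {ae mu, forall t, D t -> `|g' t| <= B t}.
  by apply: ae_mono2 gB gg' => t + + Dt => /(_ Dt) + /(_ Dt) <-.
have inB : mu.-integrable D (EFin \o (fun t => `|B t|)).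
  by apply: integrable_norm.
have iBv (v : X) : mu.-integrable D (EFin \o (fun t => `|v| * `|B t|)).
  by apply: EFin_integrableZ.
have le_int (v : X) : (\int[mu]_(t in D) `|(g' t v)%:E| <=
    \int[mu]_(t in D) (`|v| * `|B t|)%:E)%E.
  apply: lebesgue_ae_le_integral => [t _|t _|].
  - exact: abse_ge0.
  - by rewrite lee_fin mulr_ge0.
  apply: ae_mono g'B => t + Dt => /(_ Dt) gBt; rewrite lee_fin.
  rewrite (le_trans (dual_norm_ub _ _))// mulrC ler_wpM2l//.
  exact: le_trans gBt (ler_norm _).
have ig (v : X) : mu.-integrable D (EFin \o (fun t => g' t v)).
  apply/integrableP; split; first by apply/measurable_EFinP; exact: mg.
  apply: le_lt_trans (le_int v) _.
  have /integrableP[_] := iBv v; apply: le_lt_trans.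
  by apply: ge0_le_integral_nomeas => t _; rewrite ?lee_fin ?mulr_ge0// ler_norm.
have [|v|I IE] := @dual_of_bounded_linear _ X
  (fun v => \int[mu]_(t in D) g' t v) (\int[mu]_(t in D) `|B t|).
- move=> c x y; rewrite -RintegralZl// -RintegralD//; last first.
    exact: (EFin_integrableZ c mD (ig x)).
  by apply: eq_Rintegral => t _; rewrite pairingDr pairingZr.
- apply: (le_trans (le_normr_Rintegral _ _)) => //.
  rewrite mulrC -RintegralZl//; apply: fine_le.
  + apply: integrable_fin_num => //; exact: integrable_norm.
  + by apply: integrable_fin_num => //; exact: iBv.
  + exact: le_int.
by exists I => v; rewrite gg'v IE.
Qed.

End BochnerDual.

(** * Calculus on intervals *)

Section Calculus.
Context {R : realType}.
Local Notation mu := (@lebesgue_measure R).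
Implicit Types (a b t T : R) (f g k : R -> R).

Lemma lebesgue_itv_lty (a b : R) : (mu `[a, b] < +oo)%E.
Proof. by rewrite lebesgue_measure_itv/=; case: ifP => _; rewrite ?ltry// -EFinB ltry. Qed.

Lemma continuous_itv_integrable a b f :
  {within `[a, b], continuous f} -> mu.-integrable `[a, b] (EFin \o f).
Proof. by apply: continuous_compact_integrable; exact: segment_compact. Qed.

Lemma continuous_measurable f : continuous f -> measurable_fun setT f.
Proof. by move=> cf; exact: continuous_measurable_fun. Qed.

Lemma EFin_integrableM_bounded (D : set R) f g (M : R) : measurable D ->
  measurable_fun D f -> (forall t, D t -> `|f t| <= M) ->
  mu.-integrable D (EFin \o g) ->
  mu.-integrable D (EFin \o (fun t => f t * g t)).
Proof.
move=> mD mf fM ig.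
have mg : measurable_fun D g by apply/measurable_EFinP; case/integrableP: ig.
have ing : mu.-integrable D (EFin \o (fun t => `|g t|)) by apply: integrable_norm.
apply: (@EFin_integrable_le _ _ _ (fun t => M * `|g t|)) => //.
- exact: measurable_funM.
- by move=> t Dt; rewrite normrM ler_wpM2r// fM.
- exact: (EFin_integrableZ M mD ing).
Qed.

Lemma continuous_itv_bounded a b f : {within `[a, b], continuous f} ->
  exists2 M : R, 0 <= M & forall t, t \in `[a, b] -> `|f t| <= M.
Proof.
move=> cf; have [ab|ba] := leP a b; last first.
  by exists 0 => // t; rewrite in_itv/= => /andP[/le_trans h /h]; rewrite leNgt ba.
have cnf : {within `[a, b], continuous (fun t => `|f t|)}.
  by move=> t; apply: continuous_comp; [exact: cf|exact: norm_continuous].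
by have [c _ fc] := EVT_max ab cnf; exists `|f c|.
Qed.

Lemma continuous_integrableM a b f g : continuous f ->
  mu.-integrable `[a, b] (EFin \o g) ->
  mu.-integrable `[a, b] (EFin \o (fun t => f t * g t)).
Proof.
move=> cf ig.
have [M _ fM] := continuous_itv_bounded
  (@continuous_subspaceT _ _ `[a, b]%classic _ cf).
apply: (@EFin_integrableM_bounded _ _ _ M) => //.
by apply: measurable_funTS; exact: continuous_measurable.
Qed.

Lemma Rintegral_FTC (F f : R -> R) a b : a <= b ->
  (forall x : R, is_derive x 1 F (f x)) -> continuous f ->
  \int[mu]_(t in `[a, b]) f t = F b - F a.
Proof.
rewrite le_eqVlt => /predU1P[<-|ab] dF cf.
  by rewrite set_itv1 Rintegral_set1 subrr.
have dF' (x : R) : derivable F x 1 by apply: ex_derive; exact: dF.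
have cF : continuous F.
  by move=> x; exact/differentiable_continuous/derivable1_diffP.
rewrite /Rintegral (@continuous_FTC2 _ f F) //.
- exact: continuous_subspaceT.
- split => //; first exact/cvg_at_right_filter/cF.
  exact/cvg_at_left_filter/cF.
- by move=> x _; rewrite derive1E derive_val.
Qed.

Lemma integral_mul_indic (D : set R) (h : R -> R) :
  (\int[mu]_t (h t * \1_D t)%:E = \int[mu]_(t in D) (h t)%:E)%E.
Proof.
rewrite [RHS]integral_mkcond; apply: eq_integral => t _.
by rewrite /patch indicE; case: ifP => _; rewrite ?mulr1 ?mulr0.
Qed.

(** Fubini on the triangle [0 <= s <= t <= T]. It serves as integration by parts against a primitive
    of [k], where [k] is merely integrable and the product rule is out of reach. *)
Lemma Rintegral_triangle T (phi k : R -> R) :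
  measurable_fun setT phi -> measurable_fun setT k ->
  mu.-integrable `[0, T] (EFin \o phi) -> mu.-integrable `[0, T] (EFin \o k) ->
  \int[mu]_(t in `[0, T]) (phi t * \int[mu]_(s in `[0, t]) k s) =
  \int[mu]_(s in `[0, T]) (k s * \int[mu]_(t in `[s, T]) phi t).
Proof.
move=> mphi mk iphi ik.
pose A := [set z : R * R | [/\ 0 <= z.2, z.2 <= z.1 & z.1 <= T]].
have mA : measurable A.
  have -> : A = [set z | 0 <= z.2] `&` [set z | z.2 <= z.1] `&` [set z | z.1 <= T].
    by apply/seteqP; split=> z /=; [move=> []|move=> [[]]].
  apply: measurableI; first apply: measurableI.
  - rewrite -[X in measurable X]setTI; apply: measurable_fun_le => //.
  - by rewrite -[X in measurable X]setTI; apply: measurable_fun_le.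
  - by rewrite -[X in measurable X]setTI; apply: measurable_fun_le.
pose f (z : R * R) : \bar R := (phi z.1 * k z.2 * \1_A z)%:E.
have mf : measurable_fun setT f.
  apply/measurable_EFinP; apply: measurable_funM; last exact: measurable_indic.
  by apply: measurable_funM; apply: measurableT_comp.
pose I : set R := `[0, T]%classic.
have mI : measurable I by exact: measurable_itv.
(* On the triangle both variables lie in [[0, T]], so a product of two integrable functions of one
   variable dominates; this gives the integrability that Fubini asks for. *)
have fle t s : (`|f (t, s)| <=
    ((`|phi t| * \1_I t) * (`|k s| * \1_I s))%:E)%E.
  rewrite /f /= lee_fin !normrM; case: (boolP ((t, s) \in A)) => tsA; last first.
    by rewrite indicE (negbTE tsA) normr0 mulr0 !mulr_ge0.
  move: tsA; rewrite inE => -[/= s0 st tT].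
  have [tI sI] : t \in I /\ s \in I.
    by rewrite !inE /I /= !in_itv/= s0 tT (le_trans s0 st) (le_trans st tT).
  by rewrite !indicE tI sI !mulr1 mem_set//= normr1 mulr1.
have mabs (h : R -> R) : measurable_fun setT h ->
    measurable_fun setT (fun t => (`|h t| * \1_I t)%:E).
  move=> mh; apply/measurable_EFinP; apply: measurable_funM.
    exact: measurableT_comp.
  exact: measurable_indic.
have intabs (h : R -> R) : mu.-integrable `[0, T] (EFin \o h) ->
    (\int[mu]_t (`|h t| * \1_I t)%:E < +oo)%E.
  by move=> /integrableP[_]; rewrite integral_mul_indic.
have pos (h : R -> R) t : (0 <= (`|h t| * \1_I t)%:E)%E by rewrite lee_fin mulr_ge0.
have If : (mu \x mu)%E.-integrable setT f.
  apply/integrable12ltyP => //.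
  apply: (@le_lt_trans _ _ (\int[mu]_t ((`|phi t| * \1_I t)%:E *
      \int[mu]_s (`|k s| * \1_I s)%:E))%E).
    apply: ge0_le_integral_nomeas => t _; first exact: integral_ge0.
    rewrite -ge0_integralZl//; last exact: mabs.
    apply: ge0_le_integral_nomeas => s _; first exact: abse_ge0.
    by rewrite (le_trans (fle t s))// EFinM.
  rewrite ge0_integralZr//; [|exact: mabs|exact: integral_ge0].
  by rewrite lte_mul_pinfty// ?intabs// ?ge0_fin_numE ?intabs// integral_ge0.
have sub t : t \in I -> `[0, t] `<=` `[0, T].
  rewrite inE /I /= in_itv/= => /andP[_ tT] s /=.
  by rewrite !in_itv/= => /andP[-> /le_trans]; apply.
have sub' s : s \in I -> `[s, T] `<=` `[0, T].
  rewrite inE /I /= in_itv/= => /andP[s0 _] t /=.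
  by rewrite !in_itv/= => /andP[st ->]; rewrite (le_trans s0 st).
have inner1 t : (\int[mu]_s f (t, s) =
    ((phi t * \int[mu]_(s in `[0%R, t]) k s)%R * \1_I t)%:E)%E.
  rewrite indicE; have [tI|tI] := boolP (t \in I); last first.
    rewrite mulr0 integral0_eq// => s _; rewrite /f indicE memNset ?mulr0//=.
    move=> -[s0 st tT]; move/negP: tI; apply.
    by rewrite inE /I /= in_itv/= tT (le_trans s0 st).
  have ikt : mu.-integrable `[0, t] (EFin \o k).
    by apply: integrableS ik => //; exact: sub.
  transitivity (\int[mu]_s ((phi t * k s) * \1_(`[0%R, t]) s)%:E)%E.
    apply: eq_integral => s _; rewrite /f /=; congr (_ * _)%:E.
    rewrite !indicE; congr (nat_of_bool _)%:R.
    move: tI; rewrite !inE /I /= in_itv/= => /andP[t0 tT].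
    apply/idP/idP; rewrite !inE /= in_itv/=; first by case=> s0 st _; apply/andP; split.
    by case/andP => h1 h2; split.
  rewrite integral_mul_indic mulr1 EFinM /Rintegral fineK; last first.
    exact: integrable_fin_num.
  by rewrite -integralZl.
have inner2 s : (\int[mu]_t f (t, s) =
    ((k s * \int[mu]_(t in `[s, T]) phi t)%R * \1_I s)%:E)%E.
  rewrite indicE; have [sI|sI] := boolP (s \in I); last first.
    rewrite mulr0 integral0_eq// => t _; rewrite /f indicE memNset ?mulr0//=.
    move=> -[s0 st tT]; move/negP: sI; apply.
    by rewrite inE /I /= in_itv/= s0 (le_trans st tT).
  have ikt : mu.-integrable `[s, T] (EFin \o phi).
    by apply: integrableS iphi => //; exact: sub'.
  transitivity (\int[mu]_t ((k s * phi t) * \1_(`[s, T]) t)%:E)%E.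
    apply: eq_integral => t _; rewrite /f /= [k s * _]mulrC; congr (_ * _)%:E.
    rewrite !indicE; congr (nat_of_bool _)%:R.
    move: sI; rewrite !inE /I /= in_itv/= => /andP[s0 sT].
    apply/idP/idP; rewrite !inE /= in_itv/=; first by case=> _ st tT'; apply/andP; split.
    by case/andP => h1 h2; split.
  rewrite integral_mul_indic mulr1 EFinM /Rintegral fineK; last first.
    exact: integrable_fin_num.
  by rewrite -integralZl.
have e1 : (\int[mu]_t \int[mu]_s f (t, s) =
    \int[mu]_(t in I) (phi t * \int[mu]_(s in `[0%R, t]) k s)%R%:E)%E.
  by rewrite -integral_mul_indic; apply: eq_integral => t _; exact: inner1.
have e2 : (\int[mu]_s \int[mu]_t f (t, s) =
    \int[mu]_(s in I) (k s * \int[mu]_(t in `[s, T]) phi t)%R%:E)%E.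
  by rewrite -integral_mul_indic; apply: eq_integral => s _; exact: inner2.
by have := Fubini If; rewrite e1 e2 /Rintegral => ->.
Qed.

End Calculus.

(** * The scalar equation *)

Section ScalarODE.
Context {R : realType}.
Local Notation mu := (@lebesgue_measure R).
Implicit Types (a b c t T m lam : R) (f g k : R -> R).

Lemma is_derive_expRZ c (t : R) :
  is_derive t 1 (fun s : R => expR (c * s)) (c * expR (c * t)).
Proof.
have h : is_derive t (1 : R) (fun s : R => c * s) c.
  have := @is_deriveZ R R R id c t 1 1 (is_derive_id _ _).
  by rewrite /GRing.scale /= mulr1.
have := @is_derive1_comp R expR (fun s => c * s) t _ _ (is_derive_expR (c * t)) h.
by rewrite mulrC.
Qed.

Lemma continuous_expRZ c : continuous (fun s : R => expR (c * s)).
Proof.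
move=> s; apply: continuous_comp; last exact: continuous_expR.
by apply: cvgMr; exact: cvg_id.
Qed.

Lemma Rintegral_expRZ c a b : a <= b -> c != 0 ->
  \int[mu]_(t in `[a, b]) expR (c * t) = (expR (c * b) - expR (c * a)) / c.
Proof.
move=> ab c0.
have dF (x : R) : is_derive x 1 (fun t : R => c^-1 * expR (c * t)) (expR (c * x)).
  have := is_deriveZ c^-1 (is_derive_expRZ c x).
  by rewrite /GRing.scale /= mulKf.
rewrite (Rintegral_FTC ab dF (@continuous_expRZ c)).
by rewrite -mulrBr mulrC.
Qed.

Lemma integrable_sqr_integrable T k : measurable_fun setT k ->
  mu.-integrable `[0, T] (EFin \o (fun s => k s ^+ 2)) ->
  mu.-integrable `[0, T] (EFin \o k).
Proof.
move=> mk ik2; apply: (@EFin_integrable_le _ _ _ (fun s => 1 + k s ^+ 2)) => //.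
- exact: measurable_funTS.
- by move=> t _; have := normr_ge0 (k t); rewrite -real_normK ?num_real//; nra.
- apply: EFin_integrableD => //.
  apply: (@bounded_integrable _ _ _ 1) => //; first exact: lebesgue_itv_lty.
  by move=> t _; rewrite normr1.
Qed.

(** Variation of constants for [x' = lam x + k], [x 0 = c]. The factor [expR (lam * t)] stays
    outside, so that the integrand is independent of [t] and the integral is a genuine primitive. *)
Definition duhamel lam k c t : R :=
  expR (lam * t) * (c + \int[mu]_(s in `[0, t]) (expR (- lam * s) * k s)).

Lemma duhamel_continuous lam k c T : 0 <= T ->
  mu.-integrable `[0, T] (EFin \o k) ->
  {within `[0, T], continuous (duhamel lam k c)}.
Proof.
move=> T0 ik t; apply: cvgM.
  exact: (continuous_subspaceT (@continuous_expRZ lam)).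
apply: cvgD; first exact: cvg_cst.
apply: (parameterized_integral_continuous T0).
by apply: continuous_integrableM => //; exact: continuous_expRZ.
Qed.

Lemma sub_itv_left t T : t <= T -> `[0, t] `<=` `[0, T].
Proof.
move=> tT s /=; rewrite !in_itv/= => /andP[-> st]; exact: le_trans st tT.
Qed.

Lemma EFin_integrable_left t T f : t <= T -> mu.-integrable `[0, T] (EFin \o f) ->
  mu.-integrable `[0, t] (EFin \o f).
Proof. by move=> tT; apply: integrableS => //; exact: sub_itv_left. Qed.

(* Cauchy-Schwarz for the measure [exp (- m (t - s)) ds] on [0, t], whose mass
   is at most [1 / m]: expand the square of [k - m * I], where [I] is the
   integral of [k]. *)
Lemma exp_convolution_sqr_le m k t : 0 < m -> 0 <= t ->
  mu.-integrable `[0, t] (EFin \o k) ->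
  mu.-integrable `[0, t] (EFin \o (fun s => k s ^+ 2)) ->
  m * (expR (- m * t) * \int[mu]_(s in `[0, t]) (expR (m * s) * k s)) ^+ 2 <=
  expR (- m * t) * \int[mu]_(s in `[0, t]) (expR (m * s) * k s ^+ 2).
Proof.
move=> m0 t0 ik ik2.
have mD : measurable `[0, t]%classic by exact: measurable_itv.
have iek := continuous_integrableM (@continuous_expRZ m) ik.
have iek2 := continuous_integrableM (@continuous_expRZ m) ik2.
have ie : mu.-integrable `[0, t] (EFin \o (fun s => expR (m * s))).
  by apply: continuous_itv_integrable; apply: continuous_subspaceT; exact: continuous_expRZ.
set E := expR (- m * t).
set J := \int[mu]_(s in `[0, t]) (expR (m * s) * k s ^+ 2).
set K := \int[mu]_(s in `[0, t]) (expR (m * s) * k s).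
pose th := m * (E * K).
have E0 : 0 < E by exact: expR_gt0.
have : 0 <= \int[mu]_(s in `[0, t]) (expR (m * s) * (k s - th) ^+ 2).
  by apply: Rintegral_ge0 => s _; rewrite mulr_ge0 ?expR_ge0 ?sqr_ge0.
have -> : \int[mu]_(s in `[0, t]) (expR (m * s) * (k s - th) ^+ 2) =
    J + (- (2 * th) * K + th ^+ 2 * \int[mu]_(s in `[0, t]) expR (m * s)).
  rewrite /J /K -RintegralZl// -RintegralZl// -RintegralD//.
  - rewrite -RintegralD//.
      by apply: eq_Rintegral => s _; ring.
    exact: (EFin_integrableD mD (EFin_integrableZ _ mD iek) (EFin_integrableZ _ mD ie)).
  - exact: (EFin_integrableZ _ mD iek).
  - exact: (EFin_integrableZ _ mD ie).
rewrite Rintegral_expRZ ?gt_eqF// mulr0 expR0.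
have -> : expR (m * t) = E^-1 by rewrite /E mulNr expRN invrK.
move=> /(mulr_ge0 (ltW E0)).
have -> : E * (J + (- (2 * th) * K + th ^+ 2 * ((E^-1 - 1) / m))) =
   E * J - m * (E * K) ^+ 2 - E * m * (E * K) ^+ 2.
  by rewrite /th; field; rewrite !gt_eqF.
have : 0 <= E * m * (E * K) ^+ 2 by rewrite mulr_ge0 ?sqr_ge0// mulr_ge0// ltW.
by set x := E * m * _; set y := m * _; set z := E * J; lra.
Qed.

Lemma exp_convolution_le_integral m k t T : 0 < m -> t \in `[0, T] ->
  mu.-integrable `[0, T] (EFin \o k) -> (forall s, 0 <= k s) ->
  expR (- m * t) * \int[mu]_(s in `[0, t]) (expR (m * s) * k s) <=
  \int[mu]_(s in `[0, T]) k s.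
Proof.
rewrite in_itv/= => m0 /andP[t0 tT] ik k0.
have ikt := EFin_integrable_left tT ik.
have iek := continuous_integrableM (@continuous_expRZ m) ikt.
rewrite -RintegralZl//.
apply: (@le_trans _ _ (\int[mu]_(s in `[0, t]) k s)).
  apply: le_Rintegral => //; first exact: EFin_integrableZ.
  move=> s; rewrite /= in_itv/= => /andP[s0 st].
  rewrite mulrA -expRD ler_piMl// expR_le1; nra.
apply: fine_le; rewrite ?integrable_fin_num//.
apply: ge0_subset_integral => //.
- by case/integrableP: ik.
- by move=> s _; rewrite lee_fin.
- exact: sub_itv_left.
Qed.

Lemma exp_convolution_continuous m k T : 0 <= T ->
  mu.-integrable `[0, T] (EFin \o k) ->
  {within `[0, T], continuous
    (fun t => expR (- m * t) * \int[mu]_(s in `[0, t]) (expR (m * s) * k s))}.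
Proof.
move=> T0 ik t; apply: cvgM.
  exact: (continuous_subspaceT (@continuous_expRZ (- m))).
apply: (parameterized_integral_continuous T0).
by apply: continuous_integrableM => //; exact: continuous_expRZ.
Qed.

(** Young's inequality for convolution with [exp (- m t)]. After exchanging the integrals, the inner
    one over [[s, T]] equals [(1 - exp (- m (T - s))) / m], at most [1 / m]. *)
Lemma Rintegral_exp_convolution_le m k T : 0 < m -> 0 <= T ->
  measurable_fun setT k ->
  mu.-integrable `[0, T] (EFin \o k) -> (forall s, 0 <= k s) ->
  m * \int[mu]_(t in `[0, T])
    (expR (- m * t) * \int[mu]_(s in `[0, t]) (expR (m * s) * k s)) <=
  \int[mu]_(s in `[0, T]) k s.
Proof.
move=> m0 T0 mk ik k0.
have iek := continuous_integrableM (@continuous_expRZ m) ik.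
have ie : mu.-integrable `[0, T] (EFin \o (fun s => expR (- m * s))).
  by apply: continuous_itv_integrable; apply: continuous_subspaceT; exact: continuous_expRZ.
rewrite Rintegral_triangle//; last 2 first.
- by apply: continuous_measurable; exact: continuous_expRZ.
- by apply: measurable_funM => //; apply: continuous_measurable; exact: continuous_expRZ.
rewrite mulrC -ler_pdivlMr// mulrC -RintegralZl//.
have E s : s \in `[0, T] ->
    expR (m * s) * k s * \int[mu]_(t in `[s, T]) expR (- m * t) =
    m^-1 * k s * (1 - expR (- m * (T - s))).
  rewrite in_itv/= => /andP[s0 sT].
  rewrite Rintegral_expRZ// ?oppr_eq0 ?gt_eqF//.
  have -> : expR (- m * T) = expR (- m * (T - s)) * expR (- m * s).
    by rewrite -expRD; congr expR; ring.
  have -> : expR (- m * s) = (expR (m * s))^-1 by rewrite mulNr expRN.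
  by field; rewrite !gt_eqF// expR_gt0.
have -> : \int[mu]_(s in `[0, T]) (expR (m * s) * k s *
    \int[mu]_(t in `[s, T]) expR (- m * t)) =
    \int[mu]_(s in `[0, T]) (m^-1 * k s * (1 - expR (- m * (T - s)))).
  by apply: eq_Rintegral => s; rewrite inE; exact: E.
have cE : continuous (fun s => 1 - expR (- m * (T - s))).
  move=> s; apply: cvgB; first exact: cvg_cst.
  apply: continuous_comp; last exact: continuous_expR.
  by apply: cvgMr; apply: cvgB; [exact: cvg_cst|exact: cvg_id].
have imk : mu.-integrable `[0, T] (EFin \o (fun s => m^-1 * k s)).
  exact: EFin_integrableZ.
apply: le_Rintegral => //.
  have := continuous_integrableM cE imk; apply: eq_integrable => // s _.
  by rewrite /= mulrC.
move=> s; rewrite /= in_itv/= => /andP[s0 sT].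
by rewrite ler_piMr ?mulr_ge0 ?invr_ge0 ?(ltW m0)// lerBlDr lerDl expR_ge0.
Qed.

(** Write [exp ((a - m) (t - s))] as [exp (a t) exp (- m (t - s)) exp (- a s)]: the growth is
    bounded by [exp (a T)], the last factor is absorbed in [k'], and pure decay at rate [m] remains.
    The bound [(p + q)^2 <= 2 p^2 + 2 q^2] gives the factors 2, and [exp_convolution_sqr_le] gives
    [1 / m]. The decaying factors are kept so that both the supremum and the integral in [t] can be
    estimated from here. *)
Lemma duhamel_sqr_le a m k c t T : 0 <= a -> 0 < m -> t \in `[0, T] ->
  measurable_fun setT k ->
  mu.-integrable `[0, T] (EFin \o (fun s => k s ^+ 2)) ->
  duhamel (a - m) k c t ^+ 2 <= expR (2 * a * T) * (2 * c ^+ 2 * expR (- m * t) +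
    2 / m * (expR (- m * t) *
      \int[mu]_(s in `[0, t]) (expR (m * s) * k s ^+ 2))).
Proof.
move=> a0 m0; rewrite in_itv/= => /andP[t0 tT] mk ik2.
pose k' s := expR (- a * s) * k s.
have mk' : measurable_fun setT k'.
  by apply: measurable_funM => //; apply: continuous_measurable; exact: continuous_expRZ.
have ik2t := EFin_integrable_left tT ik2.
have le_k' s : s \in `[0, t] -> k' s ^+ 2 <= k s ^+ 2.
  rewrite in_itv/= => /andP[s0 _].
  rewrite /k' exprMn ler_piMl ?sqr_ge0// expr_le1// ?expR_ge0// expR_le1; nra.
have ik'2 : mu.-integrable `[0, t] (EFin \o (fun s => k' s ^+ 2)).
  apply: (@EFin_integrable_le _ _ _ (fun s => k s ^+ 2)) => //.
    by apply: measurable_funTS; exact: measurable_funX.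
  by move=> s sI; rewrite ger0_norm ?sqr_ge0// le_k'.
have ik' := integrable_sqr_integrable mk' ik'2.
have X : duhamel (a - m) k c t = expR (a * t) * (expR (- m * t) * c +
    expR (- m * t) * \int[mu]_(s in `[0, t]) (expR (m * s) * k' s)).
  rewrite /duhamel (_ : (a - m) * t = a * t + - m * t); last by ring.
  rewrite expRD -mulrA -mulrDr; congr (_ * (_ * (_ + _))).
  apply: eq_Rintegral => s _; rewrite /k' mulrA -expRD; congr (expR _ * _); ring.
rewrite {}X exprMn; apply: ler_pM; rewrite ?sqr_ge0//.
  by rewrite expr2 -expRD ler_expR; nra.
have CS := exp_convolution_sqr_le m0 t0 ik' ik'2.
move: CS.
set I := _ * \int[mu]_(s in _) _; set E := expR (- m * t).
move=> CS.
apply: (@le_trans _ _ (2 * (E * c) ^+ 2 + 2 * I ^+ 2)).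
  by have := sqr_ge0 (E * c - I); nra.
apply: lerD.
  rewrite -mulrA ler_wpM2l// exprMn mulrC ler_wpM2l ?sqr_ge0//.
  rewrite expr2 ler_piMl ?expR_ge0// expR_le1; nra.
rewrite -mulrA ler_wpM2l// -ler_pdivrMl ?invr_gt0// invrK (le_trans CS)//.
rewrite ler_wpM2l ?expR_ge0//; apply: le_Rintegral => //.
- exact: (continuous_integrableM (@continuous_expRZ m) ik'2).
- exact: (continuous_integrableM (@continuous_expRZ m) ik2t).
- by move=> s sI; rewrite ler_wpM2l ?expR_ge0// le_k'.
Qed.

(** Chosen to bound the squared mode uniformly in time and also [m] times its time integral. The
    weight [1 / m] on the forcing matches [dual_coef_sum_le], so these bounds can be summed over the
    modes. *)
Definition duhamel_bound a m k c T : R :=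
  expR (2 * a * T) * (2 * c ^+ 2 + 2 / m * \int[mu]_(s in `[0, T]) (k s ^+ 2)).

Lemma duhamel_sup_le a m k c t T : 0 <= a -> 0 < m -> t \in `[0, T] ->
  measurable_fun setT k ->
  mu.-integrable `[0, T] (EFin \o (fun s => k s ^+ 2)) ->
  duhamel (a - m) k c t ^+ 2 <= duhamel_bound a m k c T.
Proof.
move=> a0 m0 tT mk ik2; apply: le_trans (duhamel_sqr_le c a0 m0 tT mk ik2) _.
rewrite ler_wpM2l ?expR_ge0//; apply: lerD.
  rewrite ler_piMr//; first by rewrite mulr_ge0 ?sqr_ge0.
  by rewrite expR_le1; move: tT; rewrite in_itv/= => /andP[t0 _]; nra.
rewrite ler_wpM2l ?divr_ge0// ?(ltW m0)//.
exact: (exp_convolution_le_integral m0 tT ik2 (fun s => sqr_ge0 (k s))).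
Qed.

(** The prefactor [m] is absorbed in both terms: [m] times the integral of [exp (- m t)] is at most
    1, and [Rintegral_exp_convolution_le] treats the forcing. *)
Lemma duhamel_L2_le a m k c T : 0 <= a -> 0 < m -> 0 <= T ->
  measurable_fun setT k ->
  mu.-integrable `[0, T] (EFin \o (fun s => k s ^+ 2)) ->
  m * \int[mu]_(t in `[0, T]) (duhamel (a - m) k c t ^+ 2) <=
  duhamel_bound a m k c T.
Proof.
move=> a0 m0 T0 mk ik2.
have mD : measurable `[0, T]%classic by exact: measurable_itv.
have k20 s : 0 <= k s ^+ 2 by exact: sqr_ge0.
have ie : mu.-integrable `[0, T] (EFin \o (fun s => expR (- m * s))).
  by apply: continuous_itv_integrable; apply: continuous_subspaceT; exact: continuous_expRZ.
pose J t := expR (- m * t) * \int[mu]_(s in `[0, t]) (expR (m * s) * k s ^+ 2).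
have iJ : mu.-integrable `[0, T] (EFin \o J).
  by apply: continuous_itv_integrable; exact: exp_convolution_continuous.
have iX : mu.-integrable `[0, T] (EFin \o (fun t => duhamel (a - m) k c t ^+ 2)).
  have cX := @duhamel_continuous (a - m) k c T T0 (integrable_sqr_integrable mk ik2).
  by apply: continuous_itv_integrable => t; rewrite /continuous_at;
    apply: cvgM; exact: cX.
have i1 := EFin_integrableZ (2 * c ^+ 2) mD ie.
have i2 := EFin_integrableZ (2 / m) mD iJ.
have i12 := EFin_integrableD mD i1 i2.
apply: (@le_trans _ _ (m * (expR (2 * a * T) * (2 * c ^+ 2 *
    (\int[mu]_(t in `[0, T]) expR (- m * t)) + 2 / m *
    \int[mu]_(t in `[0, T]) J t)))).
  rewrite ler_wpM2l ?(ltW m0)// -!RintegralZl// -RintegralD// -RintegralZl//.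
  apply: le_Rintegral => //; first exact: (EFin_integrableZ _ mD i12).
  by move=> t tT; exact: duhamel_sqr_le.
rewrite mulrCA ler_wpM2l ?expR_ge0// mulrDr; apply: lerD.
  rewrite mulrCA ler_piMr//; first by rewrite mulr_ge0 ?sqr_ge0.
  rewrite Rintegral_expRZ ?oppr_eq0 ?gt_eqF// mulr0 expR0.
  have -> : m * ((expR (- m * T) - 1) / - m) = 1 - expR (- m * T).
    by field; rewrite gt_eqF.
  by rewrite ltW// ltrBlDr ltrDl expR_gt0.
rewrite mulrCA ler_wpM2l ?divr_ge0// ?(ltW m0)//.
apply: (Rintegral_exp_convolution_le m0 T0 _ ik2 k20).
exact: measurable_funX.
Qed.

End ScalarODE.

(** * Test functions *)

Section TestFunctions.
Context {R : realType}.
Local Notation mu := (@lebesgue_measure R).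
Implicit Types (c t T lam : R) (k d : R -> R).

Lemma C1c_is_derive T (phi : R -> R) (t : R) : C1c T phi ->
  is_derive t 1 phi (derive1 phi t).
Proof. by case=> dphi _ _; rewrite derive1E; apply: DeriveDef. Qed.

Lemma C1c_continuous T (phi : R -> R) : C1c T phi -> continuous phi.
Proof.
by case=> dphi _ _ x; exact/differentiable_continuous/derivable1_diffP.
Qed.

Lemma C1c_ends T (phi : R -> R) : C1c T phi -> phi 0 = 0 /\ phi T = 0.
Proof.
case=> _ _ [K [_ KT phiK]]; split; apply: phiK => /KT /=; rewrite in_itv/= ltxx ?andbF//.
Qed.

(** With [psi = phi e], the left side plus [lam] times the integral of [phi] against the mode equals
    the integral of [psi'] against [c + K]. The constant drops out since [psi] vanishes at both
    ends, and the triangle identity moves [psi'] onto [[s, T]], where it integrates to [- psi s]. *)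
Lemma duhamel_weak lam k c T (phi : R -> R) : 0 <= T -> measurable_fun setT k ->
  mu.-integrable `[0, T] (EFin \o k) -> C1c T phi ->
  \int[mu]_(t in `[0, T]) (derive1 phi t * duhamel lam k c t) =
  - \int[mu]_(t in `[0, T]) (phi t * (lam * duhamel lam k c t + k t)).
Proof.
move=> T0 mk ik phiC.
have mD : measurable `[0, T]%classic by exact: measurable_itv.
have [_ cphi' _] := phiC; have cphi := C1c_continuous phiC.
have [phi0 phiT] := C1c_ends phiC.
pose e t := expR (lam * t); pose K t := \int[mu]_(s in `[0, t]) (expR (- lam * s) * k s).
pose psi t := phi t * e t.
pose psi' t := derive1 phi t * e t + lam * (phi t * e t).
have ce : continuous e by exact: continuous_expRZ.
have dpsi (t : R) : is_derive t 1 psi (psi' t).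
  apply: (is_derive_eq (@is_deriveM _ _ phi e t 1 _ _ (C1c_is_derive t phiC)
    (is_derive_expRZ lam t))).
  by rewrite /psi' /e /GRing.scale /=; ring.
have cpsi' : continuous psi'.
  move=> t; apply: cvgD; first by apply: cvgM; [exact: cphi'|exact: ce].
  by apply: cvgMr; apply: cvgM; [exact: cphi|exact: ce].
have ikap : mu.-integrable `[0, T] (EFin \o (fun s => expR (- lam * s) * k s)).
  by apply: continuous_integrableM => //; exact: continuous_expRZ.
have mkap : measurable_fun setT (fun s => expR (- lam * s) * k s).
  by apply: measurable_funM => //; apply: continuous_measurable; exact: continuous_expRZ.
have iX : mu.-integrable `[0, T] (EFin \o (duhamel lam k c)).
  by apply: continuous_itv_integrable; exact: duhamel_continuous.
have iK : mu.-integrable `[0, T] (EFin \o K).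
  by apply: continuous_itv_integrable; exact: parameterized_integral_continuous.
have ipsi' : mu.-integrable `[0, T] (EFin \o psi').
  by apply: continuous_itv_integrable; exact: continuous_subspaceT.
have iphi'X := continuous_integrableM cphi' iX.
have iphiX := continuous_integrableM cphi iX.
have iphik := continuous_integrableM cphi ik.
have ipsi'K := continuous_integrableM cpsi' iK.
have intpsi' s : s \in `[0, T] -> \int[mu]_(t in `[s, T]) psi' t = - psi s.
  rewrite in_itv/= => /andP[_ sT].
  by rewrite (Rintegral_FTC sT dpsi cpsi') /psi phiT mul0r sub0r.
have tri : \int[mu]_(t in `[0, T]) (psi' t * K t) =
    - \int[mu]_(t in `[0, T]) (phi t * k t).
  rewrite Rintegral_triangle//; last exact: continuous_measurable.
  rewrite -[RHS]mulN1r -RintegralZl//; apply: eq_Rintegral => s; rewrite inE => sI.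
  rewrite intpsi'// /psi /e mulNr expRN; field.
  by rewrite gt_eqF// expR_gt0.
have : \int[mu]_(t in `[0, T]) (derive1 phi t * duhamel lam k c t) +
    lam * \int[mu]_(t in `[0, T]) (phi t * duhamel lam k c t) =
    c * \int[mu]_(t in `[0, T]) psi' t + \int[mu]_(t in `[0, T]) (psi' t * K t).
  rewrite -!RintegralZl// -!RintegralD//.
  - by apply: eq_Rintegral => t _; rewrite /duhamel /psi' /K /e; ring.
  - exact: EFin_integrableZ.
  - exact: EFin_integrableZ.
rewrite intpsi' ?in_itv/= ?lexx//= /psi phi0 mul0r oppr0 mulr0 add0r tri => h.
have -> : \int[mu]_(t in `[0, T]) (phi t * (lam * duhamel lam k c t + k t)) =
    lam * \int[mu]_(t in `[0, T]) (phi t * duhamel lam k c t) +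
    \int[mu]_(t in `[0, T]) (phi t * k t).
  rewrite -!RintegralZl// -!RintegralD//.
    by apply: eq_Rintegral => t _; ring.
  exact: EFin_integrableZ.
by rewrite opprD -h; ring.
Qed.

(** The positive part is continuous and its square continuously differentiable, so explicit test
    functions can be built from it. *)
Let pp (t : R) : R := Num.max t 0.

(** A remainder quadratic in [h] across the kink at 0 settles the difference quotient for all [t] at
    once. *)
Lemma pp_sqr_taylor (t h : R) :
  `|pp (h + t) ^+ 2 - pp t ^+ 2 - h * (2 * pp t)| <= h ^+ 2.
Proof.
rewrite /pp ler_norml; case: (leP t 0) => t0; case: (leP (h + t) 0) => ht0;
  apply/andP; split; nra.
Qed.

Lemma is_derive_pp_sqr (t : R) : is_derive t 1 (fun s => pp s ^+ 2) (2 * pp t).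
Proof.
have h : h^-1 *: (pp (h *: 1 + t) ^+ 2 - pp t ^+ 2) @[h --> 0^'] --> 2 * pp t.
  apply/cvgrPdist_le => e e0; near=> h.
  have h0 : h != 0 by near: h; exact: nbhs_dnbhs_neq.
  rewrite /GRing.scale /= mulr1 distrC.
  have -> : h^-1 * (pp (h + t) ^+ 2 - pp t ^+ 2) - 2 * pp t =
    h^-1 * (pp (h + t) ^+ 2 - pp t ^+ 2 - h * (2 * pp t)).
    by rewrite [RHS]mulrBr mulKf.
  rewrite normrM normfV ler_pdivrMl ?normr_gt0//.
  apply: le_trans (pp_sqr_taylor t h) _.
  rewrite -real_normK ?num_real// expr2 ler_wpM2l//.
  by near: h; apply: dnbhs0_le.
have dh : derivable (fun s => pp s ^+ 2) t 1 by apply/cvg_ex; exists (2 * pp t).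
by apply: DeriveDef => //; exact: cvg_lim h.
Unshelve. all: by end_near. Qed.

Let pp_continuous : continuous pp.
Proof. by move=> t; apply: continuous_max; [exact: cvg_id|exact: cvg_cst]. Qed.

(* [hat h c] is supported on [c - h, c + h]; its primitive is constant to the
   right, so that differences of primitives have compact support. *)
Definition hat (h c t : R) : R := pp (t - c + h) - 2 * pp (t - c) + pp (t - c - h).

Definition hat_primitive (h c t : R) : R :=
  2^-1 * (pp (t - c + h) ^+ 2 - 2 * pp (t - c) ^+ 2 + pp (t - c - h) ^+ 2).

Lemma hat_continuous h c : continuous (hat h c).
Proof.
have cs (x : R) : continuous (fun t => pp (t + x)).
  move=> t; apply: (@continuous_comp _ _ _ (fun t => t + x) pp); last exact: pp_continuous.
  by apply: cvgD; [exact: cvg_id|exact: cvg_cst].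
have -> : hat h c = (fun t => pp (t + (- c + h)) - 2 * pp (t + - c) +
    pp (t + (- c - h))).
  by apply/funext => t; rewrite /hat !addrA.
move=> t; apply: cvgD; last exact: cs.
by apply: cvgB; [exact: cs|apply: cvgMr; exact: cs].
Qed.

Lemma hat_primitive_is_derive h c (t : R) :
  is_derive t 1 (hat_primitive h c) (hat h c t).
Proof.
have ds (x : R) : is_derive t 1 (fun s : R => pp (s + x) ^+ 2) (2 * pp (t + x)).
  have h1 : is_derive t (1 : R) (fun s : R => s + x) 1.
    have := @is_deriveD R R R id (cst x) t 1 1 0 (is_derive_id _ _) (is_derive_cst _ _ _).
    by rewrite addr0.
  have := @is_derive1_comp R (fun s => pp s ^+ 2) (fun s => s + x) t _ _
    (is_derive_pp_sqr (t + x)) h1.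
  by rewrite mulr1.
have -> : hat_primitive h c = 2^-1 \*: ((fun s => pp (s + (- c + h)) ^+ 2) -
    2 \*: (fun s => pp (s + - c) ^+ 2) + (fun s => pp (s + (- c - h)) ^+ 2)).
  apply/funext => s; rewrite -[RHS]/(2^-1 * (pp (s + (- c + h)) ^+ 2 -
    2 * pp (s + - c) ^+ 2 + pp (s + (- c - h)) ^+ 2)).
  by rewrite /hat_primitive !addrA.
apply: (is_derive_eq (is_deriveZ _ (is_deriveD (is_deriveB (ds _)
  (is_deriveZ _ (ds _))) (ds _)))).
by rewrite /hat !addrA /GRing.scale /=; field.
Qed.

Lemma hat_ge0 h c t : 0 <= h -> 0 <= hat h c t.
Proof.
by rewrite /hat /pp => h0; case: (leP (t - c + h) 0) => ?; case: (leP (t - c) 0) => ?;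
  case: (leP (t - c - h) 0) => ?; lra.
Qed.

Lemma hat_eq0 h c t : 0 <= h -> h <= `|t - c| -> hat h c t = 0.
Proof.
rewrite /hat /pp ler_normr => h0 /orP hc.
by case: (leP (t - c + h) 0) => ?; case: (leP (t - c) 0) => ?;
  case: (leP (t - c - h) 0) => ?; case: hc => ?; lra.
Qed.

Lemma hat_primitive_eq0 h c t : 0 <= h -> t <= c - h -> hat_primitive h c t = 0.
Proof.
rewrite /hat_primitive /pp => h0 tc.
by case: (leP (t - c + h) 0) => ?; case: (leP (t - c) 0) => ?;
  case: (leP (t - c - h) 0) => ?; nra.
Qed.

Lemma hat_primitive_eq h c t : 0 <= h -> c + h <= t -> hat_primitive h c t = h ^+ 2.
Proof.
rewrite /hat_primitive /pp => h0 tc.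
by case: (leP (t - c + h) 0) => ?; case: (leP (t - c) 0) => ?;
  case: (leP (t - c - h) 0) => ?; nra.
Qed.

Lemma Rintegral_hat h c T : 0 <= h -> 0 <= c - h -> c + h <= T ->
  \int[mu]_(t in `[0, T]) hat h c t = h ^+ 2.
Proof.
move=> h0 ch0 chT; have T0 : 0 <= T by lra.
rewrite (Rintegral_FTC T0 (hat_primitive_is_derive h c) (@hat_continuous h c)).
by rewrite hat_primitive_eq// hat_primitive_eq0// subr0.
Qed.

Lemma C1c_hat_primitiveB h c1 c2 T : 0 < h -> 0 < c1 - h -> 0 < c2 - h ->
  c1 + h < T -> c2 + h < T ->
  C1c T (fun t => hat_primitive h c1 t - hat_primitive h c2 t) /\
  derive1 (fun t => hat_primitive h c1 t - hat_primitive h c2 t) =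
    (fun t => hat h c1 t - hat h c2 t).
Proof.
move=> h0 c10 c20 c1T c2T.
have d (t : R) : is_derive t 1 (fun t => hat_primitive h c1 t - hat_primitive h c2 t)
    (hat h c1 t - hat h c2 t).
  exact: (is_deriveB (hat_primitive_is_derive h c1 t) (hat_primitive_is_derive h c2 t)).
have d1 : derive1 (fun t => hat_primitive h c1 t - hat_primitive h c2 t) =
    (fun t => hat h c1 t - hat h c2 t).
  by apply/funext => t; rewrite derive1E derive_val.
split => //; split.
- by move=> t; apply: ex_derive; exact: d.
- rewrite d1 => t; apply: cvgB; exact: hat_continuous.
exists `[Num.min (c1 - h) (c2 - h), Num.max (c1 + h) (c2 + h)]%classic; split.
- exact: segment_compact.
- move=> t /=; rewrite !in_itv/= => /andP[h1 h2].
  by rewrite (lt_le_trans _ h1) ?lt_min ?c10 ?c20//= (le_lt_trans h2)// gt_max c1T c2T.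
- move=> t /=; rewrite in_itv/= => /negP; rewrite negb_and -!ltNge => /orP[].
    rewrite lt_min => /andP[t1 t2].
    by rewrite !hat_primitive_eq0 ?subrr// ltW.
  rewrite gt_max => /andP[t1 t2].
  by rewrite !hat_primitive_eq ?subrr// ltW.
Qed.

(** Moves the integrating factor onto the test function, where it does not disturb smoothness or
    support. *)
Lemma C1c_mul_expRZ lam T (psi : R -> R) : C1c T psi ->
  C1c T (fun t => psi t * expR (lam * t)) /\
  derive1 (fun t => psi t * expR (lam * t)) =
    (fun t => derive1 psi t * expR (lam * t) + lam * (psi t * expR (lam * t))).
Proof.
move=> psiC; have [_ cpsi' [K [cK KT psiK]]] := psiC.
have d (t : R) : is_derive t 1 (fun t : R => psi t * expR (lam * t))
    (derive1 psi t * expR (lam * t) + lam * (psi t * expR (lam * t))).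
  apply: (is_derive_eq (@is_deriveM _ _ psi (fun t : R => expR (lam * t)) t 1 _ _
    (C1c_is_derive t psiC) (is_derive_expRZ lam t))).
  by rewrite /GRing.scale /=; ring.
have d1 : derive1 (fun t => psi t * expR (lam * t)) =
    (fun t => derive1 psi t * expR (lam * t) + lam * (psi t * expR (lam * t))).
  by apply/funext => t; rewrite derive1E derive_val.
split => //; split.
- by move=> t; apply: ex_derive; exact: d.
- rewrite d1 => t; apply: cvgD.
    by apply: cvgM; [exact: cpsi'|exact: continuous_expRZ].
  apply: cvgMr; apply: cvgM; [exact: (C1c_continuous psiC)|exact: continuous_expRZ].
- by exists K; split => // t tK; rewrite psiK ?mul0r.
Qed.

(* du Bois-Reymond lemma, tested on differences of hat functions *)
Lemma weak_derivative0_le T (v : R -> R) (t1 t2 : R) : {within `[0, T], continuous v} ->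
  (forall psi, C1c T psi -> \int[mu]_(t in `[0, T]) (derive1 psi t * v t) = 0) ->
  t1 \in `]0, T[ -> t2 \in `]0, T[ -> v t1 <= v t2.
Proof.
move=> cv v0 t1T t2T; rewrite leNgt; apply/negP => v21.
have T0 : 0 < T by move: t1T; rewrite in_itv/= => /andP[]; exact: lt_trans.
have mD : measurable `[0, T]%classic by exact: measurable_itv.
have [cvo _ _] := (continuous_within_itvP v T0).1 cv.
(* With these values [v t1 = m + 2 e] and [v t2 = m - 2 e], so a variation below [e] keeps [v] above
   [m + e] near [t1] and below [m - e] near [t2]. Two hats of equal mass then separate the weighted
   integrals. *)
pose m := (v t1 + v t2) / 2; pose e := (v t1 - v t2) / 4.
have e0 : 0 < e by rewrite divr_gt0 ?subr_gt0.
have loc t : t \in `]0, T[ -> exists2 h : R, 0 < h &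
    (forall s : R, `|s - t| < h -> (s \in `]0, T[) /\ (`|v t - v s| < e)).
  move=> tT; have : \forall s \near t, (s \in `]0, T[) /\ (`|v t - v s| < e).
    apply: filterI; first exact: near_in_itvoo.
    by move/cvgrPdist_lt : (cvo t tT) => /(_ _ e0).
  move=> /nbhs_ballP[h /= h0 hb]; exists h => // s st; apply: hb.
  by rewrite /ball /= distrC.
have [h1 h10 b1] := loc _ t1T; have [h2 h20 b2] := loc _ t2T.
pose h := Num.min h1 h2 / 2.
have hm : 0 < Num.min h1 h2 by rewrite lt_min h10.
have h0 : 0 < h by rewrite divr_gt0.
have hh1 : h < h1 
  by rewrite ltr_pdivrMr// gt_min; apply/orP; left; lra.
have hh2 : h < h2 
  by rewrite ltr_pdivrMr// gt_min; apply/orP; right; lra.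
have ends t (r : R) : 0 < h -> h < r ->
    (forall s : R, `|s - t| < r -> (s \in `]0, T[) /\ (`|v t - v s| < e)) ->
    0 < t - h /\ t + h < T.
  move=> _ hk b; split.
    have [|+ _] := b (t - h); first by rewrite addrAC subrr sub0r normrN gtr0_norm.
    by rewrite in_itv/= => /andP[].
  have [|+ _] := b (t + h); first by rewrite addrAC subrr add0r gtr0_norm.
  by rewrite in_itv/= => /andP[].
have [l1 r1] := ends _ _ h0 hh1 b1; have [l2 r2] := ends _ _ h0 hh2 b2.
have [psiC psi'] := C1c_hat_primitiveB h0 l1 l2 r1 r2.
have iv : mu.-integrable `[0, T] (EFin \o v) by exact: continuous_itv_integrable.
have ihv c : mu.-integrable `[0, T] (EFin \o (fun t => hat h c t * v t)).
  by apply: continuous_integrableM => //; exact: hat_continuous.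
have ih c : mu.-integrable `[0, T] (EFin \o (hat h c)).
  by apply: continuous_itv_integrable; apply: continuous_subspaceT; exact: hat_continuous.
have eq12 : \int[mu]_(t in `[0, T]) (hat h t1 t * v t) =
    \int[mu]_(t in `[0, T]) (hat h t2 t * v t).
  have := v0 _ psiC; rewrite psi' => e12.
  apply/eqP; rewrite -subr_eq0 -RintegralB//; apply/eqP; rewrite -[RHS]e12.
  by apply: eq_Rintegral => t _; rewrite mulrBl.
have ge1 : (m + e) * h ^+ 2 <= \int[mu]_(t in `[0, T]) (hat h t1 t * v t).
  rewrite -(@Rintegral_hat h t1 T) ?(ltW h0) ?(ltW l1) ?(ltW r1)// -RintegralZl//.
  apply: le_Rintegral => //; first exact: EFin_integrableZ.
  move=> t _; rewrite mulrC; have [th|th] := ltP `|t - t1| h; last first.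
    by rewrite hat_eq0 ?(ltW h0)// !mul0r.
  rewrite ler_wpM2l ?hat_ge0 ?(ltW h0)//.
  have [_] := b1 t (lt_trans th hh1).
  by rewrite /m /e ltr_norml => /andP[]; lra.
have le2 : \int[mu]_(t in `[0, T]) (hat h t2 t * v t) <= (m - e) * h ^+ 2.
  rewrite -(@Rintegral_hat h t2 T) ?(ltW h0) ?(ltW l2) ?(ltW r2)// -RintegralZl//.
  apply: le_Rintegral => //; first exact: EFin_integrableZ.
  move=> t _; rewrite [leRHS]mulrC; have [th|th] := ltP `|t - t2| h; last first.
    by rewrite hat_eq0 ?(ltW h0)// !mul0r.
  rewrite ler_wpM2l ?hat_ge0 ?(ltW h0)//.
  have [_] := b2 t (lt_trans th hh2).
  by rewrite /m /e ltr_norml => /andP[]; lra.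
have : (m + e) * h ^+ 2 <= (m - e) * h ^+ 2 by rewrite (le_trans ge1)// eq12.
by rewrite ler_pM2r ?exprn_gt0//; lra.
Qed.

(** The product [v] of [d] and [exp (- lam t)] has zero weak derivative, hence is constant, and its
    value at 0 is zero. *)
Lemma weak_exp_ode_eq0 lam T d : 0 < T -> {within `[0, T], continuous d} ->
  d 0 = 0 ->
  (forall phi, C1c T phi -> \int[mu]_(t in `[0, T]) (derive1 phi t * d t) =
    - \int[mu]_(t in `[0, T]) (phi t * (lam * d t))) ->
  forall t, t \in `[0, T] -> d t = 0.
Proof.
move=> T0 cd d0 dw.
have mD : measurable `[0, T]%classic by exact: measurable_itv.
have id : mu.-integrable `[0, T] (EFin \o d) by exact: continuous_itv_integrable.
pose v t := expR (- lam * t) * d t.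
have cv : {within `[0, T], continuous v}.
  move=> t; apply: cvgM; last exact: cd.
  exact: (continuous_subspaceT (@continuous_expRZ _ (- lam))).
have v0 psi : C1c T psi -> \int[mu]_(t in `[0, T]) (derive1 psi t * v t) = 0.
  move=> psiC; have [phiC phi'] := C1c_mul_expRZ (- lam) psiC.
  have := dw _ phiC; rewrite phi' => h.
  have cpsi := C1c_continuous psiC; have [_ cpsi' _] := psiC.
  have iv : mu.-integrable `[0, T] (EFin \o v) by exact: continuous_itv_integrable.
  have i1 := continuous_integrableM cpsi' iv.
  have i2 := continuous_integrableM cpsi iv.
  have : \int[mu]_(t in `[0, T]) (derive1 psi t * v t) +
      (- lam) * \int[mu]_(t in `[0, T]) (psi t * v t) =
      - (lam * \int[mu]_(t in `[0, T]) (psi t * v t)).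
    rewrite -!RintegralZl// -RintegralD//; last exact: (EFin_integrableZ _ mD i2).
    have -> : \int[mu]_(t in `[0, T]) (lam * (psi t * v t)) =
        \int[mu]_(t in `[0, T]) (psi t * expR (- lam * t) * (lam * d t)).
      by apply: eq_Rintegral => t _; rewrite /v; ring.
    by rewrite -h; apply: eq_Rintegral => t _; rewrite /v; ring.
  by rewrite mulNr => /(canRL (subrK _)); rewrite addNr.
have [_ cv0 cvT] := (continuous_within_itvP v T0).1 cv.
(* Test functions see only the open interval. The midpoint is a reference value there, and one-sided
   continuity carries it to the two ends, in particular to 0, where [v] is known. *)
pose th := T / 2.
have thT : th \in `]0, T[ by rewrite in_itv/= divr_gt0//= ltr_pdivrMr//; lra.
have vE t : t \in `]0, T[ -> v t = v th.
  by move=> tT; apply/eqP; rewrite eq_le !(weak_derivative0_le cv v0).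
have v_0 : v 0 = v th.
  rewrite -(cvg_lim (@Rhausdorff R) cv0); apply: lim_near_cst; first exact: Rhausdorff.
  near=> t; apply: vE; rewrite in_itv/=; apply/andP; split; near: t.
    exact: nbhs_right_gt.
  exact: nbhs_right_lt.
have v_T : v T = v th.
  rewrite -(cvg_lim (@Rhausdorff R) cvT); apply: lim_near_cst; first exact: Rhausdorff.
  near=> t; apply: vE; rewrite in_itv/=; apply/andP; split; near: t.
    exact: nbhs_left_gt.
  exact: nbhs_left_lt.
have vth : v th = 0 by rewrite -v_0 /v d0 mulr0.
move=> t; rewrite in_itv/= => /andP[t0 tT].
have : v t = 0.
  rewrite -vth; move: t0; rewrite le_eqVlt => /predU1P[<-//|t0].
  move: tT; rewrite le_eqVlt => /predU1P[->//|tT].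
  by apply: vE; rewrite in_itv/= t0.
by move/eqP; rewrite mulf_eq0 gt_eqF ?expR_gt0//= => /eqP.
Unshelve. all: by end_near. Qed.

End TestFunctions.

(** * The eigenbasis of a Galerkin family *)

Section LinearMaps.
Context {R : realType} {U V : lmodType R} (f : U -> V).
Hypothesis fl : linear f.

Lemma linear_fun0 : f 0 = 0.
Proof. by have := fl (-1) 0 0; rewrite scaler0 addr0 scaleN1r addNr. Qed.

Lemma linear_funD x y : f (x + y) = f x + f y.
Proof. by have := fl 1 x y; rewrite !scale1r. Qed.

Lemma linear_funZ c x : f (c *: x) = c *: f x.
Proof. by have := fl c x 0; rewrite !addr0 linear_fun0 addr0. Qed.

Lemma linear_funB x y : f (x - y) = f x - f y.
Proof. by rewrite -scaleN1r linear_funD linear_funZ scaleN1r. Qed.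

Lemma linear_fun_sum (I : Type) (r : seq I) (P : pred I) (c : I -> R) (x : I -> U) :
  f (\sum_(i <- r | P i) c i *: x i) = \sum_(i <- r | P i) c i *: f (x i).
Proof.
elim/big_rec2: _ => [|i y z _ <-]; first exact: linear_fun0.
by rewrite linear_funD linear_funZ.
Qed.

End LinearMaps.

(** * Orthonormal systems and orthogonal projections *)

Section HilbertSums.
Context {R : realType} {H : hilbertType R}.
Implicit Types x y z : H.

Lemma hdot_suml (I : Type) (r : seq I) (P : pred I) (c : I -> R) (x : I -> H) y :
  hdot (\sum_(i <- r | P i) c i *: x i) y = \sum_(i <- r | P i) c i * hdot (x i) y.
Proof.
elim/big_rec2: _ => [|i u v _ <-]; first exact: hdot0l.
by rewrite hdotDl hdotZl.
Qed.

Lemma hdotDr x y z : hdot x (y + z) = hdot x y + hdot x z.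
Proof. by rewrite !(hdotC x) hdotDl. Qed.

Lemma hdotZr c x y : hdot x (c *: y) = c * hdot x y.
Proof. by rewrite !(hdotC x) hdotZl. Qed.

Lemma hdotBl x y z : hdot (x - y) z = hdot x z - hdot y z.
Proof. by rewrite hdotDl -scaleN1r hdotZl mulN1r. Qed.

Lemma hdotBr x y z : hdot x (y - z) = hdot x y - hdot x z.
Proof. by rewrite !(hdotC x) hdotBl. Qed.

Lemma hdot_inj x y : (forall z, hdot x z = hdot y z) -> x = y.
Proof.
move=> xy; apply/eqP; rewrite -subr_eq0 -normr_eq0 -sqrf_eq0 -hdotxx.
by rewrite hdotBl xy subrr.
Qed.

Lemma hdot_cvg (u : nat -> H) x y : u n @[n --> \oo] --> x ->
  hdot (u n) y @[n --> \oo] --> hdot x y.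
Proof.
move=> ux; rewrite hdotC; under eq_fun do rewrite hdotC.
exact: (cvg_comp _ _ ux (@dual_continuous _ _ (riesz y) x)).
Qed.

Definition orthonormal (e : nat -> H) : Prop :=
  forall i j, hdot (e i) (e j) = (i == j)%:R.

Lemma hdot_orthonormal_sum (e : nat -> H) (r : seq nat) (c d : nat -> R) :
  orthonormal e -> uniq r ->
  hdot (\sum_(i <- r) c i *: e i) (\sum_(i <- r) d i *: e i) =
  \sum_(i <- r) c i * d i.
Proof.
move=> eo ur; rewrite hdot_suml big_seq [RHS]big_seq; apply: eq_bigr => i ir.
rewrite hdotC hdot_suml (bigD1_seq i)//= eo eqxx mulr1 big1 ?addr0// => k ki.
by rewrite eo (negbTE ki) mulr0.
Qed.

Lemma norm_orthonormal_sum (e : nat -> H) (r : seq nat) (c : nat -> R) :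
  orthonormal e -> uniq r ->
  `|\sum_(i <- r) c i *: e i| ^+ 2 = \sum_(i <- r) c i ^+ 2.
Proof. by move=> eo ur; rewrite -hdotxx hdot_orthonormal_sum. Qed.

Lemma bessel (e : nat -> H) x n : orthonormal e ->
  \sum_(i < n) hdot x (e i) ^+ 2 <= `|x| ^+ 2.
Proof.
move=> eo; pose s := \sum_(i < n) hdot x (e i) *: e i.
have ss : hdot s s = \sum_(i < n) hdot x (e i) ^+ 2.
  rewrite /s -(big_mkord xpredT (fun i => hdot x (e i) *: e i)).
  by rewrite hdot_orthonormal_sum ?iota_uniq// big_mkord.
have xs : hdot x s = \sum_(i < n) hdot x (e i) ^+ 2.
  by rewrite hdotC hdot_suml; apply: eq_bigr => i _; rewrite (hdotC (e i)).
have : 0 <= hdot (x - s) (x - s) by rewrite hdotxx exprn_ge0.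
by rewrite hdotBl !hdotBr (hdotC s x) ss xs hdotxx; lra.
Qed.

Lemma projection_dist_le (P : H -> H) (F : set H) x y :
  selfadjoint_projection F P -> F y -> `|x - P x| <= `|x - y|.
Proof.
move=> [Pl PP Psym <-] [z _ zy].
have Py : P y = y by rewrite -zy PP.
rewrite -ler_sqr ?nnegrE// -!hdotxx.
have orth : hdot (x - P x) (P x - y) = 0.
  have -> : P x - y = P (x - y) by rewrite (linear_funB Pl) Py.
  by rewrite -Psym (linear_funB Pl) PP subrr hdot0l.
have -> : x - y = (x - P x) + (P x - y) by rewrite addrA subrK.
move: (x - P x) (P x - y) orth => A B orth.
rewrite [leRHS]hdotDl !hdotDr (hdotC B A) orth.
by rewrite addr0 add0r lerDl hdotxx exprn_ge0.
Qed.

End HilbertSums.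

Section Galerkin.
Context {R : realType} {H W V : hilbertType R}.
Variables (jVW : dense_embedding V W) (jWH : dense_embedding W H).
Variable (Aw : W -> dual V).
Local Notation j := (jWH \o jVW).

(** The form is not assumed symmetric, so the eigenvector relation is recorded in both slots: [e i]
    as argument of [Aw] tested on [V], and [e i] as test vector against every element of [W]. *)
Definition eigen_system (e : nat -> V) (lam : nat -> R) : Prop :=
  [/\ orthonormal (j \o e),
      forall x : H, \sum_(i < n) hdot x (j (e i)) *: j (e i) @[n --> \oo] --> x,
      forall i v, Aw (jVW (e i)) v = lam i * hdot (j (e i)) (j v)
    & forall i w, Aw w (e i) = lam i * hdot (jWH w) (j (e i))].

(** Everything comes from comparing levels [n] and [n + 1], where [Pi n] kills [e n] and [Pi n.+1]
    fixes it. Level [n + 1] replaces a test vector by its projection, which is its level-[n]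
    projection plus its component along [e n]; level [n] says that the former contributes zero. Only
    [Aw (e n) (e n)] is left, and it is the eigenvalue. *)
Lemma galerkin_eigen_system (h : nat -> V) (Pi : nat -> H -> H) :
  linear Aw -> galerkin_family j h Pi ->
  (forall (n : nat) (x : W) (y Pix Piy : V),
    j Pix = Pi n (jWH x) -> j Piy = Pi n (j y) ->
    a_form Aw x Piy = a_form Aw (jVW Pix) y) ->
  exists e lam, eigen_system e lam.
Proof.
move=> Awl [hS hP] comm.
have [jVWl _ jVWi _] := embedP jVW; have [jWHl _ jWHi _] := embedP jWH.
have jl : linear j by move=> c x y; rewrite /= jVWl jWHl.
pose g := j \o h; pose F n := first_span g n.
have Pl n : linear (Pi n) by have [] := hP n.
have Psym n x y : hdot (Pi n x) y = hdot x (Pi n y) by have [] := hP n.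
have PF n x : F n (Pi n x) by have [_ _ _] := hP n; rewrite /F /g => <-; exists x.
have Pid n x : F n x -> Pi n x = x.
  by have [_ PP _ ran] := hP n; rewrite /F /g -ran => -[z _ <-]; rewrite PP.
have FS n x : F n x -> F n.+1 x.
  move=> [c ->]; exists (fun i => if (i < n)%N then c i else 0).
  rewrite big_ord_recr /= ltnn scale0r addr0; apply: eq_bigr => i _.
  by rewrite ltn_ord.
have Fg n : F n.+1 (g n).
  exists (fun i => (i == n)%:R); rewrite big_ord_recr /= eqxx scale1r big1 ?add0r//.
  by move=> i _; rewrite ltn_eqF// scale0r.
have Flin n c x y : F n x -> F n y -> F n (c *: x + y).
  move=> [cx ->] [cy ->]; exists (fun i => c * cx i + cy i).
  rewrite scaler_sumr -big_split /=; apply: eq_bigr => i _.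
  by rewrite scalerDl scalerA.
have F0 n : F n 0.
  by exists (fun=> 0); rewrite big1// => i _; rewrite scale0r.
have PS n x : Pi n (Pi n.+1 x) = Pi n x.
  apply: hdot_inj => y; rewrite !Psym (Pid n.+1)//; exact/FS/PF.
have lift n x : exists v : V, j v = Pi n x.
  have [c ->] := PF n x; exists (\sum_(i < n) c i *: h i).
  by rewrite (linear_fun_sum jl).
have [p jp] := choice (fun n => lift n (g n)).
pose u n := h n - p n.
have ju n : j (u n) = g n - Pi n (g n) by rewrite (linear_funB jl) jp.
have ju0 n : j (u n) != 0.
  apply/eqP; rewrite ju => /eqP; rewrite subr_eq0 => /eqP gn.
  have [c gE] := PF n (g n); rewrite -gn in gE.
  have [c0 [_ uniq0]] := hS 0.
  (* If [g n] belonged to [F n], this would be an expansion of 0 with coefficient -1 at [n], against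
     uniqueness in the basis. *)
  pose d i : R := if (i < n)%N then c i else if i == n then -1 else 0.
  have d0 : \sum_(i < k) d i *: j (h i) @[k --> \oo] --> (0 : H).
    apply: cvg_near_cst; exists n.+1 => // k /= nk.
    rewrite -(big_mkord xpredT (fun i => d i *: j (h i))).
    rewrite (@big_cat_nat _ _ _ n.+1)//= [X in _ + X]big_nat_cond.
    rewrite [X in _ + X]big1 ?addr0 => [|i /andP[/andP[ni _] _]]; last first.
      by rewrite /d ltnNge (ltnW ni)/= gtn_eqF// scale0r.
    rewrite big_mkord big_ord_recr /= /d ltnn eqxx scaleN1r.
    rewrite -[X in _ - X]/(g n) gE; apply/eqP; rewrite subr_eq0; apply/eqP.
    by apply: eq_bigr => i _; rewrite ltn_ord.
  have z0 : \sum_(i < k) (fun=> 0 : R) i *: j (h i) @[k --> \oo] --> (0 : H).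
    by apply: cvg_near_cst; apply: nearW => k; rewrite big1// => i _; rewrite scale0r.
  have := congr1 (fun F => F n) (etrans (esym (uniq0 d d0)) (uniq0 (fun=> 0) z0)).
  by rewrite /d ltnn eqxx => /eqP; rewrite oppr_eq0 oner_eq0.
pose e n := `|j (u n)|^-1 *: u n.
have je n : j (e n) = `|j (u n)|^-1 *: (g n - Pi n (g n)).
  by rewrite (linear_funZ jl) ju.
have Pe0 n : Pi n (j (e n)) = 0.
  by rewrite je (linear_funZ (Pl n)) (linear_funB (Pl n)) (Pid _ _ (PF _ _)) subrr scaler0.
have Fe n : F n.+1 (j (e n)).
  have h1 : F n.+1 (g n - Pi n (g n)).
    by rewrite -scaleN1r addrC; apply: Flin; [exact/FS/PF|exact: Fg].
  by rewrite je -[X in F _ X]addr0; exact: (Flin _ _ _ _ h1 (F0 _)).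
have e1 n : hdot (j (e n)) (j (e n)) = 1.
  rewrite (linear_funZ jl) hdotZl hdotZr hdotxx mulrA -expr2 -exprMn mulVf ?expr1n//.
  by rewrite normr_eq0.
(* The space [F n.+1] is [F n] plus the line of [e n]. Applying [Pi n] identifies the first
   component, and pairing with [e n], which is orthogonal to [F n], identifies the second. *)
have P1 n x : Pi n.+1 x = Pi n x + hdot x (j (e n)) *: j (e n).
  have [q [d [Fq E]]] : exists q d, F n q /\ Pi n.+1 x = q + d *: j (e n).
    have [c ->] := PF n.+1 x; rewrite big_ord_recr /=.
    exists (c n *: Pi n (g n) + \sum_(i < n) c i *: g i), (c n * `|j (u n)|); split.
      by apply: Flin; [exact: PF|exists c].
    rewrite (je n : jWH (jVW (e n)) = _) -scalerA (scalerA `|j (u n)|) mulfV ?normr_eq0// scale1r.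
    rewrite [X in _ = X + _]addrC -addrA scalerBr; congr (_ + _).
    by rewrite addrCA subrr addr0.
  have qE : q = Pi n x.
    by rewrite -PS E (linear_funD (Pl n)) (linear_funZ (Pl n)) Pe0 scaler0 addr0 Pid.
  have dE : d = hdot x (j (e n)).
    rewrite -[in RHS](Pid _ _ (Fe n)) -Psym E hdotDl hdotZl e1 mulr1.
    by rewrite -(Pid _ _ Fq) Psym Pe0 hdot0r add0r.
  by rewrite E qE dE.
have P0 x : Pi 0%N x = 0 by have [c ->] := PF 0%N x; rewrite big_ord0.
have PE n x : Pi n x = \sum_(i < n) hdot x (j (e i)) *: j (e i).
  by elim: n => [|n IH]; rewrite ?P0 ?big_ord0// P1 IH big_ord_recr.
have Fle m n x : (m <= n)%N -> F m x -> F n x.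
  by move=> mn Fx; elim: n mn => [|n IH]; rewrite leq_eqVlt => /predU1P[<-//|//] /IH /FS.
have eo : orthonormal (j \o e).
  have lt_orth m n : (m < n)%N -> hdot (j (e m)) (j (e n)) = 0.
    by move=> mn; rewrite -(Pid n (j (e m))) ?Psym ?Pe0 ?hdot0r//; exact: Fle (Fe m).
  move=> m n; have [->|] := eqVneq m n; first exact: e1.
  by rewrite neq_ltn => /orP[mn|nm]; [exact: lt_orth|rewrite hdotC; exact: lt_orth].
exists e, (fun n => Aw (jVW (e n)) (e n)); split => //.
(* The basis expansion of [x] has its partial sums in [F n], and [Pi n x] is at least as close to
   [x] as they are. *)
- move=> x; have [c [xc _]] := hS x.
  apply/cvgrPdist_le => r r0; move/cvgrPdist_le : xc => /(_ _ r0).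
  apply: filterS => n; apply: le_trans; rewrite -PE.
  by apply: projection_dist_le (hP n) _; exists c.
- move=> n v; have [y0 jy0] := lift n (j v).
  pose y1 := y0 + hdot (j v) (j (e n)) *: e n.
  have jy1 : j y1 = Pi n.+1 (j v).
    by rewrite (linear_funD jl) (linear_funZ jl) jy0 P1.
  have E1 := comm n.+1 (jVW (e n)) v (e n) y1 (esym (Pid _ _ (Fe n))) jy1.
  have E0 := comm n (jVW (e n)) v 0 y0 _ jy0.
  rewrite (linear_fun0 jl) in E0; move: (E0 (esym (Pe0 n))).
  rewrite /a_form (linear_fun0 jVWl) (linear_fun0 Awl) => /oppr_inj e0.
  move: E1; rewrite /a_form => /oppr_inj <-.
  by rewrite pairingDr pairingZr e0 add0r mulrC hdotC.
- move=> n w; have [x0 jx0] := lift n (jWH w).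
  pose x1 := x0 + hdot (jWH w) (j (e n)) *: e n.
  have jx1 : j x1 = Pi n.+1 (jWH w).
    by rewrite (linear_funD jl) (linear_funZ jl) jx0 P1.
  have E1 := comm n.+1 w (e n) x1 (e n) jx1 (esym (Pid _ _ (Fe n))).
  have E0 := comm n w (e n) x0 0 jx0.
  rewrite (linear_fun0 jl) in E0; move: (E0 (esym (Pe0 n))).
  rewrite /a_form pairing0r oppr0 => /esym/eqP; rewrite oppr_eq0 => /eqP e0.
  move: E1; rewrite /a_form => /oppr_inj ->.
  rewrite (linear_funD jVWl) (linear_funD Awl) (linear_funZ jVWl) (linear_funZ Awl).
  by rewrite pairingDl pairingZl e0 add0r mulrC.
Qed.

End Galerkin.

(** * Expansions in the eigenbasis *)

Section SquareSeries.
Context {R : realType}.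

Lemma bounded_series_cvg (K : nat -> R) (M : R) : (forall i, 0 <= K i) ->
  (forall n, \sum_(i < n) K i <= M) -> cvgn (series K).
Proof.
move=> K0 KM; apply: nondecreasing_is_cvgn.
  by apply: nondecreasing_series => *; exact: K0.
by exists M => _ [n _ <-]; rewrite /series /= big_mkord.
Qed.

Lemma series_le_limn (K : nat -> R) (n : nat) : (forall i, 0 <= K i) ->
  cvgn (series K) -> series K n <= limn (series K).
Proof.
move=> K0 cK; apply: nondecreasing_cvgn_le => //.
by apply: nondecreasing_series => *; exact: K0.
Qed.

(** The Cauchy criterion, transferred from the scalar series to the vectors. The tail bound involves
    [K] alone, so it is uniform in any parameter on which [K] does not depend. It serves in [H] with
    [b = 1] and in [W] with the coercivity constant. *)
Lemma sq_series_cvg (X : completeNormedModType R) (w : nat -> X) (K : nat -> R)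
    (b : R) : 0 < b -> (forall i, 0 <= K i) -> cvgn (series K) ->
  (forall p q, b * `|\sum_(p <= i < q) w i| ^+ 2 <= \sum_(p <= i < q) K i) ->
  exists l, series w @ \oo --> l /\
    forall p, b * `|l - series w p| ^+ 2 <= limn (series K) - series K p.
Proof.
move=> b0 K0 cK wK.
have cw : cvgn (series w).
  apply/cauchy_cvgP/cauchy_seriesP => e e0.
  have e20 : 0 < b * e ^+ 2 by rewrite mulr_gt0// exprn_gt0.
  have /cauchy_cvgP/cauchy_seriesP/(_ _ e20) := cK.
  apply: filterS => -[p q] /= h.
  rewrite -ltr_sqr ?nnegrE ?(ltW e0)// -(ltr_pM2l b0).
  by rewrite (le_lt_trans (wK p q))// (le_lt_trans (ler_norm _)).
exists (limn (series w)); split => // p.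
have c1 : b * `|series w q - series w p| ^+ 2 @[q --> \oo] -->
    b * `|limn (series w) - series w p| ^+ 2.
  apply: cvgMr; rewrite expr2; under eq_fun do rewrite expr2.
  by apply: cvgM; apply: cvg_norm; apply: cvgB => //; exact: cvg_cst.
rewrite -(cvg_lim (@Rhausdorff R) c1); apply: limr_le.
  by apply/cvg_ex; eexists; exact: c1.
exists p => // q /= pq; rewrite sub_series_geq//.
rewrite (le_trans (wK p q))// -sub_series_geq// lerB//.
exact: series_le_limn.
Qed.

End SquareSeries.

Section EigenSystem.
Context {R : realType} {H W V : hilbertType R}.
Variables (jVW : dense_embedding V W) (jWH : dense_embedding W H).
Variables (DA : set H) (A : H -> H) (Aw : W -> dual V) (a b : R).
Local Notation j := (jWH \o jVW).
Hypotheses (Awlin : linear Aw) (Awcont : continuous Aw) (Awrange : range Aw = setT)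
  (Aext : extends_operator jVW jWH DA A Aw) (a0 : 0 <= a) (b0 : 0 < b)
  (coercive : forall x : H, DA x -> exists2 w : W, jWH w = x &
    - hdot (A x) x >= b * `|w| ^+ 2 - a * `|x| ^+ 2).
Variables (e : nat -> V) (lam : nat -> R).
Hypothesis es : eigen_system jVW jWH Aw e lam.

Let jVWl : linear jVW. Proof. by have [] := embedP jVW. Qed.
Let jWHl : linear jWH. Proof. by have [] := embedP jWH. Qed.
Let jl : linear j. Proof. by move=> c x y; rewrite /= jVWl jWHl. Qed.
Let jWHi : injective jWH. Proof. by have [] := embedP jWH. Qed.
Let jWHc : continuous jWH. Proof. by have [] := embedP jWH. Qed.
Let eo : orthonormal (j \o e). Proof. by have [] := es. Qed.

Lemma Aw_span (I : Type) (r : seq I) (c : I -> R) (k : I -> nat) (v : V) :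
  Aw (\sum_(i <- r) c i *: jVW (e (k i))) v =
  \sum_(i <- r) c i * (lam (k i) * hdot (j (e (k i))) (j v)).
Proof.
rewrite (linear_fun_sum Awlin); have [_ _ eV _] := es.
elim: r => [|i r ih]; first by rewrite !big_nil.
by rewrite !big_cons pairingDl pairingZl ih eV.
Qed.

(** Coercivity is available only on [DA]. A finite combination of eigenvectors lies there because
    [Aw] sends it to an element of [H], and [Aext] characterizes [DA] by this property. Blocks from
    [p] to [q] are the form that the Cauchy criterion uses. *)
Lemma eigen_coercive (c : nat -> R) (p q : nat) :
  b * `|\sum_(p <= i < q) c i *: jVW (e i)| ^+ 2 <=
  \sum_(p <= i < q) (a - lam i) * c i ^+ 2.
Proof.
set w := \sum_(p <= i < q) c i *: jVW (e i).
pose h := \sum_(p <= i < q) (c i * lam i) *: j (e i).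
have Awh : Aw w = H_to_Vdual jVW jWH h.
  apply: dual_eqP => v; rewrite /w Aw_span.
  rewrite -[RHS]/(hdot h (j v)) /h hdot_suml; apply: eq_bigr => i _.
  by rewrite mulrA.
have [Dw Ah] := (Aext w h).1 Awh.
have [w' /jWHi -> ] := coercive Dw.
have xE : jWH w = \sum_(p <= i < q) c i *: j (e i) by rewrite (linear_fun_sum jWHl).
rewrite Ah xE /h.
rewrite (hdot_orthonormal_sum _ _ eo) ?iota_uniq//.
rewrite (norm_orthonormal_sum _ eo) ?iota_uniq// lerBlDr => /le_trans; apply.
rewrite -sumrN mulr_sumr -big_split /=; apply: ler_sum => i _; nra.
Qed.

Lemma eigen_gap_gt0 i : 0 < a - lam i.
Proof.
have := eigen_coercive (fun=> 1) i i.+1.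
rewrite !big_nat1 scale1r expr1n mulr1; apply: lt_le_trans.
rewrite mulr_gt0// exprn_gt0// normr_gt0; apply/eqP => e0.
have := eo i i; rewrite eqxx /= e0 (linear_fun0 jWHl) hdot0l => /esym/eqP.
by rewrite oner_eq0.
Qed.

(** Test [F] on [y], its representative for the energy on the span. Then [F y = S], while coercivity
    gives [b |y|^2 <= S]; combined with [S <= |F| |y|] this yields [b S^2 <= |F|^2 S], and [S]
    cancels. *)
Lemma dual_coef_sum_le (F : dual W) n :
  \sum_(i < n) F (jVW (e i)) ^+ 2 / (a - lam i) <= `|F| ^+ 2 / b.
Proof.
set S := \sum_(i < n) _.
pose c i := F (jVW (e i)) / (a - lam i).
pose y := \sum_(0 <= i < n) c i *: jVW (e i).
have m0 i := eigen_gap_gt0 i.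
have S0 : 0 <= S by apply: sumr_ge0 => i _; rewrite divr_ge0 ?sqr_ge0 ?(ltW (m0 i)).
have Fy : F y = S.
  rewrite /y /S big_mkord -[LHS]/(dual_fun F _) (linear_fun_sum (dual_linear F)).
  by apply: eq_bigr => i _; rewrite /c /GRing.scale /= mulrAC expr2 -mulrA.
have yS : b * `|y| ^+ 2 <= S.
  rewrite (le_trans (eigen_coercive c 0 n))// big_mkord /S ler_sum// => i _.
  by rewrite /c le_eqVlt; apply/orP; left; apply/eqP; field; rewrite gt_eqF.
have FS : S <= `|F| * `|y|.
  by rewrite -Fy (le_trans (ler_norm _))// dual_normE dual_norm_ub.
rewrite ler_pdivlMr//.
have [->|Sn0] := eqVneq S 0; first by rewrite mul0r sqr_ge0.
have Sp : 0 < S by rewrite lt_neqAle eq_sym Sn0.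
rewrite -(ler_pM2l Sp).
have h : S ^+ 2 <= (`|F| * `|y|) ^+ 2 by rewrite ler_sqr ?nnegrE ?mulr_ge0.
have : b * S ^+ 2 <= `|F| ^+ 2 * (b * `|y| ^+ 2).
  by rewrite [leRHS]mulrCA -exprMn ler_pM2l.
move=> /le_trans /(_ (ler_wpM2l (sqr_ge0 `|F|) yS)) FSS.
have -> : S * (S * b) = b * S ^+ 2 by ring.
by rewrite [S * _]mulrC.
Qed.

(* By surjectivity [F] is [Aw u], and the coefficient bound forces the
   expansion of [u] to converge in [W]. *)
Lemma dual_expansion (F : dual W) (v : V) :
  \sum_(i < n) hdot (j v) (j (e i)) * F (jVW (e i)) @[n --> \oo] --> F (jVW v).
Proof.
have [u _ Fu] : range Aw (dual_embed jVW F) by rewrite Awrange.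
have [_ basis eV eW] := es.
pose c i := hdot (jWH u) (j (e i)).
have FE i : F (jVW (e i)) = lam i * c i.
  by rewrite -eW Fu.
pose K i := (a - lam i) * c i ^+ 2.
have m0 i := eigen_gap_gt0 i.
have K0 i : 0 <= K i by rewrite mulr_ge0 ?sqr_ge0 ?(ltW (m0 i)).
(* For [m = a - lam] one has [lam^2 / m + 2 a - m = a^2 / m >= 0]. So the energy of [u] exceeds the
   weighted coefficient sum of [F] by at most [2 a] times a sum that Bessel bounds. *)
have Kle n : \sum_(i < n) K i <= `|F| ^+ 2 / b + 2 * a * `|jWH u| ^+ 2.
  apply: (@le_trans _ _ (\sum_(i < n) (F (jVW (e i)) ^+ 2 / (a - lam i) +
      2 * a * c i ^+ 2))).
    apply: ler_sum => i _; rewrite FE /K -subr_ge0.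
    have -> : (lam i * c i) ^+ 2 / (a - lam i) + 2 * a * c i ^+ 2 -
        (a - lam i) * c i ^+ 2 = a ^+ 2 * c i ^+ 2 / (a - lam i).
      by field; rewrite gt_eqF.
    by rewrite divr_ge0 ?(ltW (m0 i))// mulr_ge0 ?sqr_ge0.
  rewrite big_split /= lerD ?dual_coef_sum_le// -mulr_sumr ler_wpM2l ?mulr_ge0//.
  exact: (bessel _ _ eo).
have [l [ul _]] := sq_series_cvg b0 K0 (bounded_series_cvg K0 Kle)
  (eigen_coercive c).
have lu : l = u.
  apply: jWHi.
  have h1 : jWH (series (fun i => c i *: jVW (e i)) n) @[n --> \oo] --> jWH l.
    by apply: continuous_cvg => //; exact: jWHc.
  have h2 : \sum_(i < n) hdot (jWH u) (j (e i)) *: j (e i) @[n --> \oo] --> jWH l.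
    apply: cvg_trans h1; apply: near_eq_cvg; apply: nearW => n.
    by rewrite /= /series /= (linear_fun_sum jWHl) big_mkord.
  exact: (cvg_unique (@norm_hausdorff _ H) h2 (basis (jWH u))).
rewrite lu in ul.
have h2 : Aw (series (fun i => c i *: jVW (e i)) n) @[n --> \oo] --> Aw u.
  by apply: continuous_cvg => //; exact: Awcont.
have := pairing_cvg (v := v) h2.
rewrite Fu -[dual_embed jVW F v]/(F (jVW v)).
apply: cvg_trans; apply: near_eq_cvg; apply: nearW => n /=.
rewrite /series /= Aw_span big_mkord; apply: eq_bigr => i _.
by rewrite FE hdotC; ring.
Qed.

End EigenSystem.

(** * Strong measurability *)

Section StrongMeasurability.
Context {R : realType}.
Local Notation mu := (@lebesgue_measure R).
Implicit Types (D : set R).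

Lemma simple_function_sum (X : normedModType R) (n : nat) (s : nat -> R -> X) :
  (forall i, (i < n)%N -> simple_function (s i)) ->
  simple_function (fun t => \sum_(i < n) s i t).
Proof.
elim: n => [|n IH] ss.
  under eq_fun do rewrite big_ord0.
  have := simple_functionM (simple_function_indic (@measurable0 _ R))
    (simple_function_comp (fun=> 0 : X) (simple_function_indic (@measurable0 _ R))).
  by congr simple_function; apply/funext => t; rewrite scaler0.
under eq_fun do rewrite big_ord_recr.
apply: simple_functionD; last exact: ss.
by apply: IH => i ni; apply: ss; exact: ltnW.
Qed.

(** Round down to the grid of step [d] that starts at [- C]. The error is uniform in [t], which
    allows it to be multiplied by vectors and summed. *)
Lemma bounded_measurable_simple_approx D (X : R -> R) (C d : R) :
  measurable D -> measurable_fun D X -> (forall t, D t -> `|X t| <= C) -> 0 < d ->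
  exists q : R -> R^o, simple_function q /\ forall t, D t -> `|(q t : R) - X t| <= d.
Proof.
move=> mD mX XC d0.
pose Y t := (X t + C) / d.
have mY : measurable_fun D Y.
  by apply: measurable_funM => //; exact: measurable_funD.
(* [Y] takes values in [[0, 2 C / d]], so its integer part is at most the truncation of [2 C / d];
   the successor makes that last level count. *)
pose N := (Num.truncn (2 * C / d)).+1.
pose A (i : nat) := D `&` [set t | i%:R <= Y t < i.+1%:R].
have mA i : measurable (A i).
  have mle (c : R) : measurable (D `&` [set t | c <= Y t]).
    exact: measurable_fun_le.
  have -> : A i = (D `&` [set t | i%:R <= Y t]) `\` (D `&` [set t | i.+1%:R <= Y t]).
    apply/seteqP; split => t /=.
      by move=> [Dt /andP[h1 h2]]; split => // -[_]; rewrite leNgt h2.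
    move=> [[Dt h1] h2]; split => //=; apply/andP; split => //.
    by rewrite ltNge; apply/negP => h; exact: h2.
  exact: measurableD.
exists (fun t => \sum_(i < N) (i%:R * d - C) * \1_(A i) t); split.
  apply: (@simple_function_sum _ _ (fun i t => (i%:R * d - C) * \1_(A i) t : R^o)).
  move=> i _; apply: (simple_function_comp (fun x : R^o => (i%:R * d - C) * x : R^o)).
  exact: simple_function_indic.
move=> t Dt.
have := XC t Dt; rewrite ler_norml => /andP[XC1 XC2].
have Y0 : 0 <= Y t by rewrite /Y divr_ge0 ?(ltW d0)//; lra.
have /andP[n1 n2] := truncn_itv Y0.
set n := Num.truncn (Y t) in n1 n2.
have nN : (n < N)%N.
  rewrite /N ltnS; apply: le_truncn.
  by rewrite /Y ler_pM2r ?invr_gt0//; lra.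
have -> : \sum_(i < N) (i%:R * d - C) * \1_(A i) t = n%:R * d - C.
  rewrite (bigD1 (Ordinal nN))//= indicE mem_set ?mulr1; last first.
    by split => //=; rewrite n1 n2.
  rewrite big1 ?addr0// => i /negP ni; rewrite indicE memNset ?mulr0//= => -[_ /= /andP[i1 i2]].
  apply: ni; apply/eqP/val_inj => /=; apply/eqP; rewrite eqn_leq.
  have h1 : (i < n.+1)%N by rewrite -(ltr_nat R) (le_lt_trans i1 n2).
  have h2 : (n < i.+1)%N by rewrite -(ltr_nat R) (le_lt_trans n1 i2).
  by rewrite !ltnS in h1 h2; rewrite h1 h2.
rewrite /Y ler_pdivlMr// in n1; rewrite /Y ltr_pdivrMr// in n2.
by move: n2; rewrite -natr1 mulrDl mul1r => n2; rewrite ler_norml; apply/andP; split; lra.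
Qed.

(** A diagonal choice: the approximant of rank [N] rounds the first [N] coefficients, finely enough
    for the accumulated error to vanish as [N] grows. *)
Lemma strongly_measurable_series (Y : normedModType R) D (w : nat -> Y)
    (X : nat -> R -> R) (C : nat -> R) (x : R -> Y) : measurable D ->
  (forall i, measurable_fun D (X i)) ->
  (forall i t, D t -> `|X i t| <= C i) ->
  (\forall t \ae mu, D t -> series (fun i => X i t *: w i) @ \oo --> x t) ->
  strongly_measurable D x.
Proof.
move=> mD mX XC cvX.
(* This precision makes the total error at most [1 / (N + 1)]; the added 1 keeps the denominator
   positive. *)
pose d (N : nat) : R := N.+1%:R^-1 / (1 + \sum_(i < N) `|w i|).
have sw0 N : 0 < 1 + \sum_(i < N) `|w i| by rewrite ltr_pwDl// sumr_ge0.
have d0 N : 0 < d N by rewrite divr_gt0// invr_gt0.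
have [q qP] := choice (fun p : nat * nat =>
  bounded_measurable_simple_approx mD (mX p.2) (XC p.2) (d0 p.1)).
exists (fun N t => \sum_(i < N) (q (N, val i) t : R) *: w i); split.
  move=> N; apply: (@simple_function_sum _ _ (fun i t => (q (N, i) t : R) *: w i)).
  move=> i _; apply: (simple_function_comp (fun c : R^o => (c : R) *: w i)).
  by have [] := qP (N, i).
apply: ae_mono cvX => t cvX Dt.
have -> : (fun N => \sum_(i < N) (q (N, val i) t : R) *: w i) =
    (fun N => (\sum_(i < N) (q (N, val i) t : R) *: w i - series (fun i => X i t *: w i) N)
      + series (fun i => X i t *: w i) N).
  by apply/funext => N; rewrite subrK.
rewrite -[x t]add0r; apply: cvgD; last exact: cvX.
apply/cvgr0Pnorm_le => eps eps0; near=> N.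
rewrite /series /= big_mkord -sumrB.
apply: (@le_trans _ _ (d N * \sum_(i < N) `|w i|)).
  rewrite (le_trans (ler_norm_sum _ _ _))// mulr_sumr ler_sum// => i _.
  rewrite -scalerBl normrZ ler_wpM2r//.
  by have [_] := qP (N, val i); apply.
apply: (@le_trans _ _ N.+1%:R^-1).
  rewrite /d -mulrA ler_piMr ?invr_ge0// mulrC ler_pdivrMr// mul1r.
  by rewrite lerDr.
by apply: ltW; near: N; apply: (near_infty_natSinv_lt (PosNum eps0)).
Unshelve. all: by end_near. Qed.

Lemma strongly_measurable_comp (X Y : normedModType R) D (g : X -> Y)
    (x : R -> X) : continuous g -> strongly_measurable D x ->
  strongly_measurable D (g \o x).
Proof.
move=> cg [s_ [ss sx]]; exists (fun n => g \o s_ n); split.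
  by move=> n; exact: simple_function_comp.
apply: ae_mono sx => t + Dt => /(_ Dt) st.
by apply: continuous_cvg => //; exact: cg.
Qed.

Lemma strongly_measurableD (X : normedModType R) D (x y : R -> X) :
  strongly_measurable D x -> strongly_measurable D y ->
  strongly_measurable D (fun t => x t + y t).
Proof.
move=> [s_ [ss sx]] [u_ [su uy]]; exists (fun n t => s_ n t + u_ n t); split.
  by move=> n; exact: simple_functionD.
by apply: ae_mono2 sx uy => t + + Dt => /(_ Dt) st /(_ Dt) ut; exact: cvgD.
Qed.

Lemma strongly_measurable_scale (X : normedModType R) D (k : R -> R) (C : R)
    (x : R -> X) : measurable D -> measurable_fun D k ->
  (forall t, D t -> `|k t| <= C) -> strongly_measurable D x ->
  strongly_measurable D (fun t => k t *: x t).
Proof.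
move=> mD mk kC [s_ [ss sx]].
have d0 (n : nat) : 0 < n.+1%:R^-1 :> R by rewrite invr_gt0.
have [q qP] := choice (fun n => bounded_measurable_simple_approx mD mk kC (d0 n)).
exists (fun n t => (q n t : R) *: s_ n t); split.
  by move=> n; apply: simple_functionM => //; have [] := qP n.
apply: ae_mono sx => t + Dt => /(_ Dt) st.
apply: cvgZ => //; apply/cvgrPdist_le => eps eps0; near=> n.
rewrite distrC; have [_ /(_ _ Dt) h] := qP n; apply: (le_trans h).
by apply: ltW; near: n; apply: (near_infty_natSinv_lt (PosNum eps0)).
Unshelve. all: by end_near. Qed.

Lemma linear_continuous_bounded (X Y : normedModType R) (g : X -> Y) :
  linear g -> continuous g -> exists2 C : R, 0 <= C & forall x, `|g x| <= C * `|x|.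
Proof.
move=> gl gc.
pose L := GRing.isLinear.Build R X Y *:%R g gl.
pose f : {linear X -> Y} := HB.pack g L.
have /linear_boundedP[M [Mr h]] := @continuous_linear_bounded _ _ _ 0 f (gc 0).
exists (`|M| + 1); first by rewrite addr_ge0.
by apply: h; rewrite (le_lt_trans (ler_norm _))// ltrDl.
Qed.

Lemma Rintegral_dominated_cvg D (u_ : nat -> R -> R) (u B : R -> R) :
  measurable D -> (forall n, measurable_fun D (u_ n)) -> measurable_fun D u ->
  mu.-integrable D (EFin \o B) ->
  (\forall t \ae mu, D t -> u_ n t @[n --> \oo] --> u t) ->
  (\forall t \ae mu, forall n, D t -> `|u_ n t| <= B t) ->
  mu.-integrable D (EFin \o u) /\
  \int[mu]_(t in D) u_ n t @[n --> \oo] --> \int[mu]_(t in D) u t.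
Proof.
move=> mD mu_ mu' iB cu uB.
have mE n : measurable_fun D (EFin \o u_ n) by apply/measurable_EFinP.
have mEu : measurable_fun D (EFin \o u) by apply/measurable_EFinP.
have cE : {ae mu, forall t, D t -> (EFin \o u_ n) t @[n --> \oo] --> (EFin \o u) t}.
  apply: ae_mono cu => t + Dt => /(_ Dt) h.
  by apply: cvg_EFin; first exact: nearW.
have dom : {ae mu, forall t n, D t -> (`| (EFin \o u_ n) t | <= (EFin \o B) t)%E}.
  by apply: ae_mono uB => t h n Dt; rewrite /= lee_fin h.
have [iu _ h] := @dominated_convergence _ _ R mu D mD (fun n => EFin \o u_ n)
  (EFin \o u) (EFin \o B) mE mEu cE iB dom.
split => //; rewrite /Rintegral; apply: fine_cvg.
by rewrite fineK ?integrable_fin_num.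
Qed.

End StrongMeasurability.

(** * The weak solution *)

Section IntegralSums.
Context {R : realType}.
Local Notation mu := (@lebesgue_measure R).
Implicit Types (D : set R).

Lemma Rintegral_sum D (u : nat -> R -> R) n : measurable D ->
  (forall i, mu.-integrable D (EFin \o u i)) ->
  mu.-integrable D (EFin \o (fun t => \sum_(i < n) u i t)) /\
  \int[mu]_(t in D) (\sum_(i < n) u i t) = \sum_(i < n) \int[mu]_(t in D) u i t.
Proof.
move=> mD iu; elim: n => [|n [ih1 ih2]].
  have -> : (fun t => \sum_(i < 0) u i t) = (fun=> 0).
    by apply/funext => t; rewrite big_ord0.
  by rewrite big_ord0; split; [exact: integrable0|rewrite Rintegral_cst// mul0r].
have -> : (fun t => \sum_(i < n.+1) u i t) = (fun t => \sum_(i < n) u i t + u n t).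
  by apply/funext => t; rewrite big_ord_recr.
by split; [exact: EFin_integrableD|rewrite RintegralD// ih2 big_ord_recr].
Qed.

(** Monotone convergence: bounded sums of integrals make the full sum integrable, hence finite
    almost everywhere. *)
Lemma nonneg_series_majorant D (h : nat -> R -> R) (M : R) : measurable D ->
  (forall i, mu.-integrable D (EFin \o h i)) ->
  (forall i t, D t -> 0 <= h i t) ->
  (forall n, \sum_(i < n) \int[mu]_(t in D) h i t <= M) ->
  exists (E : set R) (G : R -> R),
    [/\ measurable E, E `<=` D, \forall t \ae mu, D t -> E t,
        mu.-integrable D (EFin \o G) & forall t, D t -> 0 <= G t] /\
    forall t n, E t -> \sum_(i < n) h i t <= G t.
Proof.
move=> mD ih h0 hM.
pose e t := (\sum_(0 <= i <oo) (h i t)%:E)%E.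
have mh i : measurable_fun D (EFin \o h i) by case/integrableP: (ih i).
have e0 t : D t -> (0 <= e t)%E.
  by move=> Dt; apply: nneseries_ge0 => i _ _; rewrite lee_fin h0.
have me : measurable_fun D e.
  have hE0 i t : D t -> xpredT i -> (0 <= (h i t)%:E)%E.
    by move=> Dt _; rewrite lee_fin h0.
  exact: (@ge0_emeasurable_sum _ _ R D (fun i t => (h i t)%:E) xpredT hE0
    (fun i _ => mh i)).
have ie : mu.-integrable D e.
  apply/integrableP; split; first exact: me.
  apply: (@le_lt_trans _ _ (\int[mu]_(t in D) e t)%E).
    rewrite le_eqVlt; apply/orP; left; apply/eqP; apply: eq_integral => t.
    by rewrite inE => Dt; rewrite gee0_abs// e0.
  rewrite /e integral_nneseries//.
  apply: (@le_lt_trans _ _ M%:E); last exact: ltry.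
  apply: lime_le.
    by apply: is_cvg_nneseries => i _ _; apply: integral_ge0 => t Dt; rewrite lee_fin h0.
  apply: nearW => n; rewrite big_mkord.
  have -> : (\sum_(i < n) \int[mu]_(t in D) (h i t)%:E =
      (\sum_(i < n) \int[mu]_(t in D) h i t)%R%:E)%E.
    rewrite -sumEFin; apply: eq_bigr => i _.
    by rewrite /Rintegral fineK//; apply: integrable_fin_num => //; exact: ih.
  by rewrite lee_fin hM.
(* Since [fine] sends infinite values to 0, the real function [fine \o e] dominates the partial sums
   on the finiteness set only, while it stays nonnegative on all of [D]. *)
exists (D `&` [set t | e t \is a fin_num]), (fine \o e); split; first split.
- exact: emeasurable_fin_num.
- by move=> t [].
- by apply: ae_mono (@integrable_ae _ _ R mu D mD e ie) => t + Dt => /(_ Dt).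
- apply/integrableP; split.
    by apply/measurable_EFinP; apply: measurableT_comp.
  case/integrableP: ie => _; apply: le_lt_trans.
  apply: lebesgue_ae_le_integral => [t _|t _|]; rewrite ?abse_ge0//.
  by apply: aeW => t Dt /=; case: (e t) => [r| |] //=; exact: leey.
- by move=> t Dt; apply: fine_ge0; exact: e0.
move=> t n [Dt fe]; rewrite -lee_fin fineK// -sumEFin -(big_mkord xpredT (fun i => (h i t)%:E)).
by apply: nneseries_lim_ge => i _ _; rewrite lee_fin h0.
Qed.

End IntegralSums.

(** * Convergence of the mode expansion in [H] and in [W] *)

Section Expansion.
Context {R : realType} {H W V : hilbertType R}.
Local Notation mu := (@lebesgue_measure R).
Variables (jVW : dense_embedding V W) (jWH : dense_embedding W H).
Variables (DA : set H) (A : H -> H) (Aw : W -> dual V) (a b T : R).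
Local Notation j := (jWH \o jVW).
Hypotheses (Awlin : linear Aw) (Awcont : continuous Aw) (Awrange : range Aw = setT)
  (Aext : extends_operator jVW jWH DA A Aw) (a0 : 0 <= a) (b0 : 0 < b) (T0 : 0 < T)
  (coercive : forall x : H, DA x -> exists2 w : W, jWH w = x &
    - hdot (A x) x >= b * `|w| ^+ 2 - a * `|x| ^+ 2).
Variables (e : nat -> V) (lam : nat -> R).
Hypothesis es : eigen_system jVW jWH Aw e lam.
Variables (u_ : nat -> R -> dual W) (F : R -> dual W).
Hypotheses (su : forall n, simple_function (u_ n))
  (uF : forall t, u_ n t @[n --> \oo] --> F t)
  (iF2 : mu.-integrable `[0, T] (EFin \o (fun t => `|F t| ^+ 2))).

Let eo : orthonormal (j \o e). Proof. by have [] := es. Qed.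
Let mD : measurable `[0, T]%classic. Proof. exact: measurable_itv. Qed.
Let gap i := a - lam i.
Let gap0 i : 0 < gap i. Proof. exact: (eigen_gap_gt0 Awlin Aext b0 coercive es). Qed.
Let k i (t : R) : R := F t (jVW (e i)).

Lemma forcing_measurable (y : W) : measurable_fun setT (fun t => F t y).
Proof.
apply: (@measurable_fun_cvg_simple _ (fun n t => u_ n t y : R^o)).
  by move=> n; exact: simple_function_pairing.
by move=> t; exact: (pairing_cvg (v := y) (@uF t)).
Qed.

Lemma forcing_sqr_integrable (y : W) :
  mu.-integrable `[0, T] (EFin \o (fun t => F t y ^+ 2)).
Proof.
apply: (@EFin_integrable_le _ _ _ (fun t => `|y| ^+ 2 * `|F t| ^+ 2)) => //.
- by apply: measurable_funTS; apply: measurable_funX; exact: forcing_measurable.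
- move=> t _; rewrite ger0_norm ?sqr_ge0// mulrC -exprMn -real_normK ?num_real//.
  by rewrite ler_sqr ?nnegrE ?mulr_ge0// dual_normE dual_norm_ub.
- exact: EFin_integrableZ.
Qed.

Lemma forcing_coef_sum_le n : \sum_(i < n) (\int[mu]_(t in `[0, T]) k i t ^+ 2) / gap i <=
  (\int[mu]_(t in `[0, T]) `|F t| ^+ 2) / b.
Proof.
have ik i : mu.-integrable `[0, T] (EFin \o (fun t => (gap i)^-1 * k i t ^+ 2)).
  by apply: EFin_integrableZ => //; exact: forcing_sqr_integrable.
have [i1 E1] := @Rintegral_sum _ _ (fun i t => (gap i)^-1 * k i t ^+ 2) n mD ik.
have -> : \sum_(i < n) (\int[mu]_(t in `[0, T]) k i t ^+ 2) / gap i =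
    \sum_(i < n) \int[mu]_(t in `[0, T]) ((gap i)^-1 * k i t ^+ 2).
  apply: eq_bigr => i _; rewrite mulrC; apply/esym.
  by apply: RintegralZl; [exact: mD|exact: forcing_sqr_integrable].
rewrite -E1 mulrC -RintegralZl//; apply: le_Rintegral => //.
  exact: EFin_integrableZ.
move=> t _; rewrite mulrC (le_trans _ (dual_coef_sum_le Awlin Aext b0 coercive es (F t) n))//.
by apply: ler_sum => i _; rewrite mulrC.
Qed.

Let co (x : H) i := hdot x (j (e i)).
Let X (x : H) i t := duhamel (lam i) (k i) (co x i) t.
Let Kb (x : H) i := duhamel_bound a (gap i) (k i) (co x i) T.

Let lamE i : lam i = a - gap i. Proof. by rewrite /gap opprB addrC subrK. Qed.

Lemma mode_sup_le x i t : t \in `[0, T] -> X x i t ^+ 2 <= Kb x i.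
Proof.
move=> tT; rewrite /X lamE; apply: duhamel_sup_le => //.
- exact: forcing_measurable.
- exact: forcing_sqr_integrable.
Qed.

Lemma mode_L2_le x i : gap i * \int[mu]_(t in `[0, T]) X x i t ^+ 2 <= Kb x i.
Proof.
rewrite /X; under eq_Rintegral do rewrite lamE.
apply: duhamel_L2_le => //; first exact: ltW.
- exact: forcing_measurable.
- exact: forcing_sqr_integrable.
Qed.

Lemma mode_bound_ge0 x i : 0 <= Kb x i.
Proof.
apply: le_trans (sqr_ge0 _) (@mode_sup_le x i 0 _).
by rewrite in_itv/= lexx ltW.
Qed.

Lemma mode_bound_sum_le x n : \sum_(i < n) Kb x i <=
  expR (2 * a * T) * (2 * `|x| ^+ 2 + 2 * ((\int[mu]_(t in `[0, T]) `|F t| ^+ 2) / b)).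
Proof.
rewrite /Kb /duhamel_bound -mulr_sumr ler_wpM2l ?expR_ge0// big_split /=.
apply: lerD; first by rewrite -mulr_sumr ler_wpM2l//; exact: (bessel _ _ eo).
apply: le_trans (ler_wpM2l (ler0n R 2) (forcing_coef_sum_le n)).
rewrite mulr_sumr; apply: ler_sum => i _.
by rewrite le_eqVlt; apply/orP; left; apply/eqP; ring.
Qed.

Lemma mode_bound_series_cvg x : cvgn (series (Kb x)).
Proof. exact: bounded_series_cvg (mode_bound_ge0 x) (mode_bound_sum_le x). Qed.

Lemma mode_continuous x i : {within `[0, T], continuous (X x i)}.
Proof.
apply: duhamel_continuous; first exact: ltW.
apply: integrable_sqr_integrable; first exact: forcing_measurable.
exact: forcing_sqr_integrable.
Qed.

Lemma mode_integrable x i : mu.-integrable `[0, T] (EFin \o (X x i)).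
Proof. by apply: continuous_itv_integrable; exact: mode_continuous. Qed.

Lemma mode_measurable x i : measurable_fun `[0, T] (X x i).
Proof. by apply/measurable_EFinP; case/integrableP: (mode_integrable x i). Qed.

Lemma mode_abs_le x i t : t \in `[0, T] -> `|X x i t| <= 1 + Kb x i.
Proof.
move=> tT; have := mode_sup_le x i tT; rewrite -real_normK ?num_real//.
by have := normr_ge0 (X x i t); nra.
Qed.

(** The value is meaningful for [t] in [[0, T]], where the series converges; elsewhere it is
    whatever [limn] returns. *)
Definition mild_solution (x : H) (t : R) : H :=
  limn (series (fun i => X x i t *: j (e i))).
Local Notation S := mild_solution.

(** The tails are controlled by [Kb x], which does not involve [t]: convergence is uniform on
    [[0, T]]. *)
Lemma mild_solution_cvg x t : t \in `[0, T] ->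
  series (fun i => X x i t *: j (e i)) @ \oo --> S x t /\
  forall p, `|S x t - series (fun i => X x i t *: j (e i)) p| ^+ 2 <=
    limn (series (Kb x)) - series (Kb x) p.
Proof.
move=> tT.
have XK p q : 1 * `|\sum_(p <= i < q) X x i t *: j (e i)| ^+ 2 <= \sum_(p <= i < q) Kb x i.
  rewrite mul1r (norm_orthonormal_sum _ eo) ?iota_uniq//.
  by apply: ler_sum => i _; exact: mode_sup_le.
have [l [hl lK]] := sq_series_cvg ltr01 (mode_bound_ge0 x)
  (@mode_bound_series_cvg x) XK.
have -> : S x t = l by exact: (cvg_lim (@norm_hausdorff _ H) hl).
by split => // p; have := lK p; rewrite mul1r.
Qed.

Lemma mild_solution_continuous x : {within `[0, T], continuous (S x)}.
Proof.
pose g p t := series (fun i => X x i t *: j (e i)) p.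
have cg p : {within `[0, T], continuous (g p)}.
  elim: p => [|p IH].
    have -> : g 0%N = cst 0 by apply/funext => t; rewrite /g /series /= big_geq.
    by move=> t; exact: cvg_cst.
  have -> : g p.+1 = (fun t => g p t + X x p t *: j (e p)).
    by apply/funext => t; rewrite /g /series /= big_nat_recr.
  move=> t; apply: cvgD; first exact: IH.
  by apply: cvgZ; [exact: mode_continuous|exact: cvg_cst].
apply/subspace_continuousP => t tT; apply/cvgrPdist_le => eps eps0.
have e3 : 0 < eps / 3 by rewrite divr_gt0.
(* The index [p] is fixed before any time is chosen, so one continuous partial sum approximates the
   limit at both times of the three-epsilon argument. *)
have [p tail] : exists p, limn (series (Kb x)) - series (Kb x) p <= (eps / 3) ^+ 2.
  have e32 : 0 < (eps / 3) ^+ 2 by rewrite exprn_gt0.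
  have /cvgrPdist_le/(_ _ e32)[p _ hp] := @mode_bound_series_cvg x.
  by exists p; rewrite (le_trans (ler_norm _))//; apply: hp => /=.
have near_g s : s \in `[0, T] -> `|S x s - g p s| <= eps / 3.
  move=> sT; have [_ /(_ p) h] := mild_solution_cvg x sT.
  by rewrite -ler_sqr ?nnegrE ?(ltW e3)//; exact: le_trans h tail.
have /subspace_continuousP/(_ t tT)/cvgrPdist_le/(_ _ e3) := cg p.
rewrite !near_withinE; apply: filterS => s gs sT.
have -> : S x t - S x s = (S x t - g p t) + (g p t - g p s) + (g p s - S x s).
  by rewrite !subrKA.
have e33 : eps = eps / 3 + eps / 3 + eps / 3 by field.
rewrite [leRHS]e33 (le_trans (ler_normD _ _))// lerD//; last first.
  by rewrite distrC; exact: near_g.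
rewrite (le_trans (ler_normD _ _))// lerD//; first exact: near_g.
exact: gs.
Qed.

Lemma mild_solution0 x : S x 0 = x.
Proof.
have t0 : 0 \in `[0, T] by rewrite in_itv/= lexx ltW.
have [Sc _] := mild_solution_cvg x t0; have [_ basis _ _] := es.
apply: (cvg_unique (@norm_hausdorff _ H) Sc).
apply: cvg_trans (basis x); apply: near_eq_cvg; apply: nearW => n.
rewrite /series /= big_mkord; apply: eq_bigr => i _.
by rewrite /X /duhamel mulr0 expR0 mul1r set_itv1 Rintegral_set1 addr0.
Qed.

(** The forcing cancels in the difference, whose modes are multiplied by
    [exp (lam i t) <= exp (a T)]; Bessel applied to [x - y] concludes. *)
Lemma mild_solution_lipschitz x y t : t \in `[0, T] ->
  `|S x t - S y t| <= expR (a * T) * `|x - y|.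
Proof.
move=> tT; have [Sx _] := mild_solution_cvg x tT; have [Sy _] := mild_solution_cvg y tT.
have h : `|series (fun i => X x i t *: j (e i)) n - series (fun i => X y i t *: j (e i)) n|
    @[n --> \oo] --> `|S x t - S y t|.
  by apply: cvg_norm; exact: cvgB.
rewrite -(cvg_lim (@Rhausdorff R) h); apply: limr_le.
  by apply/cvg_ex; eexists; exact: h.
apply: nearW => n /=.
rewrite -ler_sqr ?nnegrE ?mulr_ge0 ?expR_ge0//.
have -> : series (fun i => X x i t *: j (e i)) n - series (fun i => X y i t *: j (e i)) n =
    \sum_(0 <= i < n) (expR (lam i * t) * co (x - y) i) *: j (e i).
  rewrite /series /= -sumrB; apply: eq_bigr => i _; rewrite -scalerBl; congr (_ *: _).
  by rewrite /X /duhamel /co hdotBl; ring.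
rewrite (norm_orthonormal_sum _ eo) ?iota_uniq// big_mkord exprMn.
apply: le_trans (ler_wpM2l _ (bessel (x - y) n eo)); last by rewrite sqr_ge0.
rewrite mulr_sumr; apply: ler_sum => i _; rewrite exprMn ler_wpM2r ?sqr_ge0//.
rewrite ler_sqr ?nnegrE ?expR_ge0// ler_expR.
move: tT; rewrite in_itv/= => /andP[t0 tT].
apply: (@le_trans _ _ (a * t)); last by rewrite ler_wpM2l.
by rewrite ler_wpM2r//; have := gap0 i; rewrite subr_gt0 => /ltW.
Qed.

Lemma mild_solution_bounded x : exists M : R, forall t, t \in `[0, T] -> `|S x t| <= M.
Proof.
have cn : {within `[0, T], continuous (fun t => `|S x t|)}.
  by move=> t; apply: cvg_norm; exact: mild_solution_continuous.
have [M _ hM] := continuous_itv_bounded cn; exists M => t tT.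
by have := hM t tT; rewrite normr_id.
Qed.

(** Produces the representative in [W]. Multiplying by the indicator of [E] removes the times of
    infinite energy, so that the series converges in [W] at every time. The same [G] majorizes the
    partial sums, which allows passing to the limit under integrals, and the limit, which gives
    square integrability. *)
Lemma regular_part x : exists (w : R -> W) (G : R -> R) (E : set R),
  [/\ measurable E, \forall t \ae mu, t \in `[0, T] -> E t,
      mu.-integrable `[0, T] (EFin \o G) & strongly_measurable `[0, T] w] /\
  [/\ forall t, series (fun i => (\1_E t * X x i t) *: jVW (e i)) @ \oo --> w t,
      forall n t, t \in `[0, T] ->
        b * `|series (fun i => (\1_E t * X x i t) *: jVW (e i)) n| ^+ 2 <= G t,
      forall t, t \in `[0, T] -> b * `|w t| ^+ 2 <= G t
    & forall t, E t -> jWH (w t) = S x t].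
Proof.
pose h i t := gap i * X x i t ^+ 2.
have cX2 i : mu.-integrable `[0, T] (EFin \o (fun t => X x i t ^+ 2)).
  by apply: continuous_itv_integrable => t; apply: cvgM; exact: mode_continuous.
have ih i : mu.-integrable `[0, T] (EFin \o h i) by apply: EFin_integrableZ.
have h0 i t : `[0, T]%classic t -> 0 <= h i t.
  by move=> _; rewrite mulr_ge0 ?sqr_ge0 ?(ltW (gap0 i)).
have hsum n : \sum_(i < n) \int[mu]_(t in `[0, T]) h i t <=
    expR (2 * a * T) * (2 * `|x| ^+ 2 + 2 * ((\int[mu]_(t in `[0, T]) `|F t| ^+ 2) / b)).
  apply: le_trans (mode_bound_sum_le x n); apply: ler_sum => i _.
  by rewrite RintegralZl//; exact: mode_L2_le.
have [E [G [[mE EI aeE iG G0] hG]]] := nonneg_series_majorant mD ih h0 hsum.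
pose c t i := \1_E t * X x i t.
have K0 t i : 0 <= gap i * c t i ^+ 2 by rewrite mulr_ge0 ?sqr_ge0 ?(ltW (gap0 i)).
have KE t n : E t -> \sum_(i < n) gap i * c t i ^+ 2 <= G t.
  move=> Et; apply: le_trans (hG t n Et); apply: ler_sum => i _.
  by rewrite /c /h indicE mem_set// mul1r.
have KN t n : ~ E t -> \sum_(i < n) gap i * c t i ^+ 2 = 0.
  by move=> Et; rewrite big1// => i _; rewrite /c indicE memNset// mul0r expr0n mulr0.
(* Off [E] all coefficients vanish, and nonnegativity of [G] suffices. *)
have KG t n : t \in `[0, T] -> \sum_(i < n) gap i * c t i ^+ 2 <= G t.
  by move=> tT; have [/KE//|Et] := pselect (E t); rewrite KN// G0.
have cK t : cvgn (series (fun i => gap i * c t i ^+ 2)).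
  have [Et|Et] := pselect (E t).
    by apply: (bounded_series_cvg (K0 t)) => n; exact: KE.
  by apply: (@bounded_series_cvg _ _ 0 (K0 t)) => n; rewrite KN.
have wP t := sq_series_cvg b0 (K0 t) (cK t)
  (eigen_coercive Awlin Aext coercive es (c t)).
have [w hw] := choice wP.
have sG n t : t \in `[0, T] ->
    b * `|series (fun i => c t i *: jVW (e i)) n| ^+ 2 <= G t.
  move=> tT; apply: le_trans (eigen_coercive Awlin Aext coercive es (c t) 0 n) _.
  by rewrite big_mkord KG.
exists w, G, E; split; split => //.
- apply: (strongly_measurable_series (w := jVW \o e) (X := fun i t => \1_E t * X x i t)
    (C := fun i => 1 + Kb x i)) => //.
  + move=> i; apply: measurable_funM; last exact: mode_measurable.
    exact: measurable_indic.
  + move=> i t tT; rewrite normrM; apply: le_trans (mode_abs_le x i tT).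
    by rewrite ler_piMl// indicE; case: (_ \in _); rewrite ?normr1 ?normr0.
  + by apply: aeW => t _; have [] := hw t.
- by move=> t; have [] := hw t.
(* At index 0 the partial sum is empty, so the tail estimate becomes a bound on [w t] itself. *)
- move=> t tT; have [_ /(_ 0%N)] := hw t.
  rewrite /series /= !big_geq// !subr0 => /le_trans; apply.
  by apply: limr_le; [exact: cK|apply: nearW => n; rewrite /series /= big_mkord KG].
- move=> t Et; have tT := EI _ Et; have [jc jl] : continuous jWH /\ linear jWH.
    by have [] := embedP jWH.
  have [wc _] := hw t; have [Sc _] := mild_solution_cvg x tT.
  apply: (cvg_unique (@norm_hausdorff _ H) _ Sc).
  have h1 : jWH (series (fun i => c t i *: jVW (e i)) n) @[n --> \oo] --> jWH (w t).
    by apply: continuous_cvg => //; exact: jc.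
  apply: cvg_trans h1; apply: near_eq_cvg; apply: nearW => n.
  rewrite /= /series /= (linear_fun_sum jl); apply: eq_bigr => i _.
  by rewrite /c indicE mem_set// mul1r.
Qed.

Hypotheses (HWdual : is_dense_embedding (H_to_Wdual jWH))
  (WVdual : is_dense_embedding (dual_embed jVW)).

Lemma H_to_Vdual_continuous : continuous (H_to_Vdual jVW jWH).
Proof.
have [_ c1 _ _] := HWdual; have [_ c2 _ _] := WVdual.
move=> h; apply: (@continuous_comp _ _ _ (H_to_Wdual jWH) (dual_embed jVW)).
  exact: c1.
exact: c2.
Qed.

Lemma H_to_Vdual_linear : linear (H_to_Vdual jVW jWH).
Proof.
have [l1 _ _ _] := HWdual; have [l2 _ _ _] := WVdual.
by move=> c h g; rewrite /H_to_Vdual l1 l2.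
Qed.

Lemma forcing_strongly_measurable : strongly_measurable `[0, T] F.
Proof. by exists u_; split => //; apply: aeW => t _; exact: uF. Qed.

Lemma mild_solution_strongly_measurable x : strongly_measurable `[0, T] (S x).
Proof.
apply: (strongly_measurable_series (w := j \o e) (X := X x)
  (C := fun i => 1 + Kb x i)) => //.
- by move=> i; exact: mode_measurable.
- by move=> i t tT; exact: mode_abs_le.
- by apply: aeW => t tT; have [] := mild_solution_cvg x tT.
Qed.

(** * The weak derivative of the expansion *)

Section Derivative.
Variables (x : H) (w : R -> W) (G : R -> R) (E : set R) (C : R).
Hypotheses (mE : measurable E) (aeE : \forall t \ae mu, t \in `[0, T] -> E t)
  (iG : mu.-integrable `[0, T] (EFin \o G))
  (smw : strongly_measurable `[0, T] w)
  (sw : forall t, series (fun i => (\1_E t * X x i t) *: jVW (e i)) @ \oo --> w t)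
  (sG : forall n t, t \in `[0, T] ->
    b * `|series (fun i => (\1_E t * X x i t) *: jVW (e i)) n| ^+ 2 <= G t)
  (wG : forall t, t \in `[0, T] -> b * `|w t| ^+ 2 <= G t)
  (C0 : 0 <= C) (AwC : forall y, `|Aw y| <= C * `|y|).

Let sqr_bound (r g : R) : 0 <= r -> b * r ^+ 2 <= g -> r <= 1 + g / b.
Proof.
move=> r0; rewrite mulrC -ler_pdivlMr// => h; nra.
Qed.

(** Continuity of [Aw] carries convergence in [W] to the dual of [V], hence to pairings with any
    [v]. The majorant of the squares becomes one of the norms through [r <= 1 + g / b], and
    dominated convergence applies. *)
Lemma Aw_partial_limit (phi : R -> R) (v : V) : continuous phi ->
  mu.-integrable `[0, T] (EFin \o (fun t => phi t * Aw (w t) v)) /\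
  \sum_(i < n) \int[mu]_(t in `[0, T])
    (phi t * (hdot (j (e i)) (j v) * (lam i * X x i t))) @[n --> \oo] -->
  \int[mu]_(t in `[0, T]) (phi t * Aw (w t) v).
Proof.
move=> cphi.
have [Mphi Mphi0 hMphi] := continuous_itv_bounded
  (@continuous_subspaceT _ _ `[0, T]%classic _ cphi).
have mphi : measurable_fun `[0, T] phi.
  by apply: measurable_funTS; exact: continuous_measurable.
pose sn n t := series (fun i => (\1_E t * X x i t) *: jVW (e i)) n.
have snE n t : Aw (sn n t) v =
    \sum_(i < n) (\1_E t * X x i t) * (lam i * hdot (j (e i)) (j v)).
  by rewrite /sn /series /= (Aw_span Awlin es) big_mkord.
have m1 i : measurable_fun `[0, T] (fun t => \1_E t * X x i t).
  apply: measurable_funM; last exact: mode_measurable.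
  exact: measurable_indic.
have msn n : measurable_fun `[0, T] (fun t => phi t * Aw (sn n t) v).
  apply: measurable_funM => //.
  rewrite (_ : (fun t => Aw (sn n t) v) = (fun t =>
    \sum_(i < n) (\1_E t * X x i t) * (lam i * hdot (j (e i)) (j v)))); last first.
    by apply/funext => t; exact: snE.
  by apply: measurable_sum => i; apply: measurable_funM => //; exact: m1.
have csn t : phi t * Aw (sn n t) v @[n --> \oo] --> phi t * Aw (w t) v.
  apply: cvgMr; apply: pairing_cvg.
  by apply: continuous_cvg; [exact: Awcont|exact: sw].
have mlim : measurable_fun `[0, T] (fun t => phi t * Aw (w t) v).
  by apply: (@measurable_fun_cvg _ _ R _ (fun n t => phi t * Aw (sn n t) v)).
have iB : mu.-integrable `[0, T] (EFin \o
    (fun t => (Mphi * (C * `|v|)) * (1 + b^-1 * G t))).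
  apply: EFin_integrableZ => //; apply: EFin_integrableD => //.
    apply: (@bounded_integrable _ _ _ 1) => //; first exact: lebesgue_itv_lty.
    by move=> t _; rewrite normr1.
  exact: EFin_integrableZ.
have dom n t : t \in `[0, T] -> `|phi t * Aw (sn n t) v| <=
    (Mphi * (C * `|v|)) * (1 + b^-1 * G t).
  move=> tT; rewrite normrM -[leRHS]mulrA; apply: ler_pM => //; first exact: hMphi.
  rewrite (le_trans (dual_norm_ub _ _))// mulrAC ler_wpM2r// -dual_normE.
  rewrite (le_trans (AwC _))// ler_wpM2l// [_ * G t]mulrC.
  by apply: sqr_bound => //; exact: sG.
have [iL cL] : mu.-integrable `[0, T] (EFin \o (fun t => phi t * Aw (w t) v)) /\
    \int[mu]_(t in `[0, T]) (phi t * Aw (sn n t) v) @[n --> \oo] -->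
    \int[mu]_(t in `[0, T]) (phi t * Aw (w t) v).
  apply: (Rintegral_dominated_cvg mD msn mlim iB); apply: aeW => t.
    by move=> _; exact: csn.
  by move=> n; exact: dom.
split => //; apply: cvg_trans cL; apply: near_eq_cvg; apply: nearW => n.
have iu i : mu.-integrable `[0, T] (EFin \o (fun t =>
    phi t * (hdot (j (e i)) (j v) * (lam i * X x i t)))).
  apply: continuous_integrableM => //.
  by do 2 apply: EFin_integrableZ => //; exact: mode_integrable.
have [_ <-] := @Rintegral_sum _ _ (fun i t =>
  phi t * (hdot (j (e i)) (j v) * (lam i * X x i t))) n mD iu.
apply: lebesgue_ae_eq_Rintegral; apply: ae_mono aeE => t + tT => /(_ tT) Et.
rewrite snE mulr_sumr; apply: eq_bigr => i _.
by rewrite indicE mem_set// mul1r; ring.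
Qed.

Lemma mild_partial_limit (phi : R -> R) (v : V) : continuous phi ->
  \sum_(i < n) \int[mu]_(t in `[0, T]) (phi t * (hdot (j (e i)) (j v) * X x i t))
    @[n --> \oo] --> \int[mu]_(t in `[0, T]) (phi t * hdot (S x t) (j v)).
Proof.
move=> cphi.
have [Mphi Mphi0 hMphi] := continuous_itv_bounded
  (@continuous_subspaceT _ _ `[0, T]%classic _ cphi).
have mphi : measurable_fun `[0, T] phi.
  by apply: measurable_funTS; exact: continuous_measurable.
have iu i : mu.-integrable `[0, T] (EFin \o (fun t =>
    phi t * (hdot (j (e i)) (j v) * X x i t))).
  apply: continuous_integrableM => //.
  by apply: EFin_integrableZ => //; exact: mode_integrable.
pose sn n t := \sum_(i < n) phi t * (hdot (j (e i)) (j v) * X x i t).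
have msn n : measurable_fun `[0, T] (sn n).
  apply: measurable_sum => i; case/integrableP: (iu i) => /measurable_EFinP.
  by [].
have snE n t : sn n t = phi t * hdot (series (fun i => X x i t *: j (e i)) n) (j v).
  rewrite /sn /series /= hdot_suml big_mkord mulr_sumr.
  by apply: eq_bigr => i _; ring.
have csn t : t \in `[0, T] -> sn n t @[n --> \oo] --> phi t * hdot (S x t) (j v).
  move=> tT; under eq_fun do rewrite snE.
  by apply: cvgMr; apply: hdot_cvg; have [] := mild_solution_cvg x tT.
have mlim : measurable_fun `[0, T] (fun t => phi t * hdot (S x t) (j v)).
  apply: (@measurable_fun_cvg _ _ R _ sn) => //.
pose B := Mphi * ((1 + limn (series (Kb x))) * `|j v|).
have iB : mu.-integrable `[0, T] (EFin \o (fun=> B)).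
  apply: (@bounded_integrable _ _ _ `|B|) => //; exact: lebesgue_itv_lty.
have dom n t : t \in `[0, T] -> `|sn n t| <= B.
  move=> tT; rewrite snE normrM; apply: ler_pM => //; first exact: hMphi.
  rewrite (le_trans (CauchySchwarz_hdot _ _))// ler_wpM2r//.
  set r := `|_|; have r0 : 0 <= r by exact: normr_ge0.
  suff : r ^+ 2 <= limn (series (Kb x)) by nra.
  rewrite /r (norm_orthonormal_sum _ eo) ?iota_uniq//.
  apply: le_trans (series_le_limn n (mode_bound_ge0 x) (@mode_bound_series_cvg x)).
  by apply: ler_sum => i _; exact: mode_sup_le.
have [_ cL] : mu.-integrable `[0, T] (EFin \o (fun t => phi t * hdot (S x t) (j v))) /\
    \int[mu]_(t in `[0, T]) sn n t @[n --> \oo] -->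
    \int[mu]_(t in `[0, T]) (phi t * hdot (S x t) (j v)).
  apply: (Rintegral_dominated_cvg mD msn mlim iB); apply: aeW => t.
    exact: csn.
  by move=> n; exact: dom.
apply: cvg_trans cL; apply: near_eq_cvg; apply: nearW => n.
by have [_ <-] := @Rintegral_sum _ _ (fun i t =>
  phi t * (hdot (j (e i)) (j v) * X x i t)) n mD iu.
Qed.

(** The equation itself, taken as the definition: it then holds by construction, and what remains to
    be shown is that this is the weak derivative. *)
Definition mild_derivative (t : R) : dual V := Aw (w t) + dual_embed jVW (F t).
Local Notation xd := mild_derivative.

Lemma mild_derivative_strongly_measurable : strongly_measurable `[0, T] xd.
Proof.
have [_ c2 _ _] := WVdual; apply: strongly_measurableD.
  exact: (strongly_measurable_comp Awcont smw).
exact: (strongly_measurable_comp c2 forcing_strongly_measurable).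
Qed.

Lemma mild_derivative_sqr_le : exists2 B : R -> R,
  mu.-integrable `[0, T] (EFin \o B) &
  forall t, t \in `[0, T] -> `|xd t| ^+ 2 <= B t.
Proof.
have [l2 c2 _ _] := WVdual.
have [C' C'0 EC] := linear_continuous_bounded l2 c2.
exists (fun t => (2 * C ^+ 2 / b) * G t + (2 * C' ^+ 2) * `|F t| ^+ 2).
  by apply: EFin_integrableD => //; apply: EFin_integrableZ.
move=> t tT; have h1 := AwC (w t); have h2 := EC (F t); have h3 := wG tT.
have h4 : `|xd t| <= C * `|w t| + C' * `|F t|.
  by rewrite (le_trans (ler_normD _ _))// lerD.
have h5 : `|xd t| ^+ 2 <= (C * `|w t| + C' * `|F t|) ^+ 2.
  by rewrite ler_sqr ?nnegrE// addr_ge0 ?mulr_ge0.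
apply: (le_trans h5).
apply: (@le_trans _ _ (2 * C ^+ 2 * `|w t| ^+ 2 + 2 * C' ^+ 2 * `|F t| ^+ 2)).
  by have := sqr_ge0 (C * `|w t| - C' * `|F t|); nra.
have h6 : `|w t| ^+ 2 <= G t / b by rewrite ler_pdivlMr// mulrC.
have -> : 2 * C ^+ 2 / b * G t = 2 * C ^+ 2 * (G t / b) by ring.
by rewrite lerD2r ler_wpM2l// mulr_ge0 ?sqr_ge0.
Qed.

(** The two Bochner integrals exist by domination and are compared on each [v]. The forcing is first
    integrated against [phi] into one functional [I3] on [W], and only then expanded by
    [dual_expansion]. This avoids expanding each [F t] under the integral and leaves two limits,
    [mild_partial_limit] and [Aw_partial_limit]. *)
Lemma mild_solution_weak_derivative :
  weak_derivative T (H_to_Vdual jVW jWH \o S x) xd.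
Proof.
move=> phi phiC; have [_ cphi' _] := phiC; have cphi := C1c_continuous phiC.
have bnd (f : R -> R) : continuous f -> measurable_fun `[0, T] f /\
    exists2 M : R, 0 <= M & forall t, t \in `[0, T] -> `|f t| <= M.
  move=> cf; split; first by apply: measurable_funTS; exact: continuous_measurable.
  exact: (continuous_itv_bounded (@continuous_subspaceT _ _ `[0, T]%classic _ cf)).
have [mphi [M M0 hM]] := bnd _ cphi; have [mphi' [M' M'0 hM']] := bnd _ cphi'.
have [CH CH0 HC] := linear_continuous_bounded H_to_Vdual_linear H_to_Vdual_continuous.
have [MS hMS] := mild_solution_bounded x.
have finD := lebesgue_itv_lty 0 T.
have i1 (r : R) : mu.-integrable `[0, T] (EFin \o (fun=> r)).
  exact: (@bounded_integrable _ _ _ `|r|).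
have sm1 : strongly_measurable `[0, T] (fun t => derive1 phi t *: H_to_Vdual jVW jWH (S x t)).
  apply: (strongly_measurable_scale mD mphi' hM').
  apply: (strongly_measurable_comp H_to_Vdual_continuous).
  exact: mild_solution_strongly_measurable.
have d1 : \forall t \ae mu, `[0, T]%classic t ->
    `|derive1 phi t *: H_to_Vdual jVW jWH (S x t)| <= M' * (CH * MS).
  apply: aeW => t tT; rewrite normrZ; apply: ler_pM => //; first exact: hM'.
  by rewrite (le_trans (HC _))// ler_wpM2l// hMS.
have [I1 hI1 I1E] := bochner_integral_exists mD finD sm1 (i1 _) d1.
have sm2 : strongly_measurable `[0, T] (fun t => phi t *: xd t).
  exact: (strongly_measurable_scale mD mphi hM mild_derivative_strongly_measurable).
have [B iB hB] := mild_derivative_sqr_le.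
have iB2 : mu.-integrable `[0, T] (EFin \o (fun t => M * (1 + B t))).
  by apply: EFin_integrableZ => //; apply: EFin_integrableD.
have sqr1 (r g : R) : 0 <= r -> r ^+ 2 <= g -> r <= 1 + g by nra.
have d2 : \forall t \ae mu, `[0, T]%classic t -> `|phi t *: xd t| <= M * (1 + B t).
  apply: aeW => t tT; rewrite normrZ; apply: ler_pM => //; first exact: hM.
  by apply: sqr1 => //; exact: hB.
have [I2 hI2 I2E] := bochner_integral_exists mD finD sm2 iB2 d2.
have sm3 : strongly_measurable `[0, T] (fun t => phi t *: F t).
  exact: (strongly_measurable_scale mD mphi hM forcing_strongly_measurable).
have iB3 : mu.-integrable `[0, T] (EFin \o (fun t => M * (1 + `|F t| ^+ 2))).
  by apply: EFin_integrableZ => //; apply: EFin_integrableD.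
have d3 : \forall t \ae mu, `[0, T]%classic t ->
    `|phi t *: F t| <= M * (1 + `|F t| ^+ 2).
  apply: aeW => t tT; rewrite normrZ; apply: ler_pM => //; first exact: hM.
  exact: sqr1.
have [I3 _ I3E] := bochner_integral_exists mD finD sm3 iB3 d3.
have iF y : mu.-integrable `[0, T] (EFin \o (fun t => F t y)).
  apply: integrable_sqr_integrable; first exact: forcing_measurable.
  exact: forcing_sqr_integrable.
exists I1; split => //; suff <- : I2 = - I1 by [].
apply: dual_eqP => v.
have -> : (- I1) v = - I1 v by [].
have [iAw limAw] := Aw_partial_limit v cphi.
have limS := mild_partial_limit (v := v) cphi'.
(* Each term of the expansion of [I3] is rewritten by the scalar weak equation [duhamel_weak];
   uniqueness of limits gives the identity for every [v] of [V]. *)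
have I3v : I3 (jVW v) = - (\int[mu]_(t in `[0, T]) (derive1 phi t * hdot (S x t) (j v))) -
    \int[mu]_(t in `[0, T]) (phi t * Aw (w t) v).
  have lim3 := @dual_expansion _ _ _ _ _ _ _ _ _ _ _ Awlin Awcont
    Awrange Aext a0 b0 coercive _ _ es I3 v.
  apply: (cvg_unique (@Rhausdorff R) lim3).
  have limB : - (\sum_(i < n) \int[mu]_(t in `[0, T])
        (derive1 phi t * (hdot (j (e i)) (j v) * X x i t))) -
      \sum_(i < n) \int[mu]_(t in `[0, T])
        (phi t * (hdot (j (e i)) (j v) * (lam i * X x i t))) @[n --> \oo] -->
      - (\int[mu]_(t in `[0, T]) (derive1 phi t * hdot (S x t) (j v))) -
      \int[mu]_(t in `[0, T]) (phi t * Aw (w t) v).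
    exact: (cvgB (cvgN limS) limAw).
  apply: cvg_trans limB; apply: near_eq_cvg; apply: nearW => n.
  rewrite -!sumrN -big_split /=; apply: eq_bigr => i _.
  rewrite I3E.
  have := @duhamel_weak _ (lam i) (k i) (co x i) T phi (ltW T0)
    (forcing_measurable _) (iF _) phiC.
  rewrite -[duhamel _ _ _]/(X x i) => weak.
  have iphiX := continuous_integrableM cphi (mode_integrable x i).
  have iphi'X := continuous_integrableM cphi' (mode_integrable x i).
  have iphik := continuous_integrableM cphi (iF (jVW (e i))).
  pose c := hdot (j (e i)) (j v).
  have e1 : \int[mu]_(t in `[0, T]) (derive1 phi t * (c * X x i t)) =
      c * \int[mu]_(t in `[0, T]) (derive1 phi t * X x i t).
    by rewrite -RintegralZl//; apply: eq_Rintegral => t _; ring.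
  have e2 : \int[mu]_(t in `[0, T]) (phi t * (c * (lam i * X x i t))) =
      c * (lam i * \int[mu]_(t in `[0, T]) (phi t * X x i t)).
    rewrite mulrA -RintegralZl//; apply: eq_Rintegral => t _; ring.
  have e3 : \int[mu]_(t in `[0, T]) (phi t * (lam i * X x i t + k i t)) =
      lam i * \int[mu]_(t in `[0, T]) (phi t * X x i t) +
      \int[mu]_(t in `[0, T]) (phi t * k i t).
    rewrite -RintegralZl// -RintegralD//; last exact: (EFin_integrableZ _ mD iphiX).
    by apply: eq_Rintegral => t _; ring.
  have e4 : \int[mu]_(t in `[0, T]) ((phi t *: F t) (jVW (e i))) =
      \int[mu]_(t in `[0, T]) (phi t * k i t).
    by apply: eq_Rintegral => t _.
  by rewrite e4 -/c e1 e2 weak e3 [hdot _ _]hdotC -/c; ring.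
have -> : I2 v = \int[mu]_(t in `[0, T]) (phi t * Aw (w t) v) + I3 (jVW v).
  rewrite I2E I3E -RintegralD//; first by apply: eq_Rintegral => t _; rewrite pairingZl mulrDr.
  exact: (continuous_integrableM cphi (iF (jVW v))).
have -> : I1 v = \int[mu]_(t in `[0, T]) (derive1 phi t * hdot (S x t) (j v)).
  by rewrite I1E; apply: eq_Rintegral => t _.
by rewrite I3v; ring.
Qed.

End Derivative.

Lemma mild_solution_weak_solution x (f : R -> dual W) :
  (\forall t \ae mu, t \in `[0, T] -> f t = F t) ->
  weak_solution jVW jWH T Aw x f (S x).
Proof.
move=> fF.
have [w [G [E [[mE aeE iG smw] [sw sG wG jw]]]]] := regular_part x.
have [C C0 AwC] := linear_continuous_bounded Awlin Awcont.
have [MS hMS] := mild_solution_bounded x.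
split.
  split; first exact: mild_solution_strongly_measurable.
  by exists MS; apply: aeW.
(* Since [S x] is continuous into [H], its image in the dual of [V] is its own continuous
   representative. *)
exists w, (H_to_Vdual jVW jWH \o S x), (mild_derivative w); split.
- split; last by apply: ae_mono aeE => t + tT => /(_ tT); exact: jw.
  split=> //; apply: (@le_lt_trans _ _ (\int[mu]_(t in `[0%R, T]) (b^-1 * G t)%:E)%E).
    apply: ge0_le_integral_nomeas => t tT; first by rewrite lee_fin sqr_ge0.
    by rewrite lee_fin ler_pdivlMl// wG.
  apply: integrable_lty => //; exact: (EFin_integrableZ b^-1 mD iG).
- split.
  + move=> t; apply: continuous_cvg; last exact: mild_solution_continuous.
    exact: H_to_Vdual_continuous.
  + by apply: aeW => t _.
  + by rewrite /= mild_solution0.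
- split; last exact: (mild_solution_weak_derivative mE aeE iG smw sw sG wG C0 AwC).
  split; first exact: mild_derivative_strongly_measurable.
  have [B iB hB] := mild_derivative_sqr_le iG wG C0 AwC.
  apply: (@le_lt_trans _ _ (\int[mu]_(t in `[0%R, T]) (B t)%:E)%E).
    apply: ge0_le_integral_nomeas => t tT; first by rewrite lee_fin sqr_ge0.
    by rewrite lee_fin hB.
  exact: integrable_lty.
- apply: ae_mono fF => t + tT => /(_ tT) -> y.
  by rewrite /mild_derivative /a_form pairingDl addrAC subrr add0r.
Qed.

Lemma weak_solution_unique x (f : R -> dual W) (y : R -> H) :
  (\forall t \ae mu, t \in `[0, T] -> f t = F t) ->
  weak_solution jVW jWH T Aw x f y ->
  \forall t \ae mu, t \in `[0, T] -> y t = S x t.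
Proof.
move=> fF [_ [w [xc [x' [[_ jw] [cxc xcy xc0] [_ wd] eq]]]]].
have finD := lebesgue_itv_lty 0 T.
(* Coordinates are read from [xc], not from [y]: the latter matters only almost everywhere, while
   [xc] carries both the continuity and the initial value. *)
pose v i t : R := xc t (e i).
have cv i : {within `[0, T], continuous (v i)}.
  move=> t; apply: (@continuous_cvg _ _ _ _ _ xc (fun G : dual V => G (e i) : R)).
  - exact: nbhs_subspace_filter.
  - exact: (@pairing_continuous _ _ (e i) (xc t)).
  - exact: cxc.
have iv i : mu.-integrable `[0, T] (EFin \o v i) by exact: continuous_itv_integrable.
have vy : \forall t \ae mu, t \in `[0, T] -> forall i, hdot (y t) (j (e i)) = v i t.
  by apply: ae_mono xcy => t + tT i => /(_ tT) E; rewrite /v E.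
(* Here [w t] is only in [W], so the eigenvector relation with [e i] in the test slot is the one
   that applies. *)
have x'E : \forall t \ae mu, t \in `[0, T] ->
    forall i, x' t (e i) = lam i * v i t + k i t.
  have [_ _ _ eW] := es.
  apply: (ae_mono2 _ (ae_mono2 (fun t h1 h2 => conj h1 h2) fF eq)
    (ae_mono2 (fun t h1 h2 => conj h1 h2) jw vy)).
  move=> t [+ +] [+ +] tT i => /(_ tT) E1 /(_ tT) E2 /(_ tT) E3 /(_ tT) E4.
  have := E2 (e i); rewrite /a_form eW E3 E4 E1 => /eqP.
  by rewrite subr_eq => /eqP ->; rewrite addrC.
have ik i : mu.-integrable `[0, T] (EFin \o k i).
  apply: integrable_sqr_integrable; first exact: forcing_measurable.
  exact: forcing_sqr_integrable.
have vX i t : t \in `[0, T] -> v i t = X x i t.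
  move=> tT; apply/eqP; rewrite -subr_eq0; apply/eqP.
  apply: (@weak_exp_ode_eq0 _ (lam i) T (fun t => v i t - X x i t)) tT => //.
  - by move=> s; apply: cvgB; [exact: cv|exact: mode_continuous].
  - rewrite /v xc0 /X /duhamel mulr0 expR0 mul1r set_itv1 Rintegral_set1 addr0.
    by rewrite -[H_to_Vdual _ _ _ _]/(co x i) subrr.
  move=> phi phiC; have [_ cphi' _] := phiC; have cphi := C1c_continuous phiC.
  have [I [hI1 hI2]] := wd phi phiC.
  have E1 := bochner_integral_pairing (e i) mD finD hI1.
  have E2 := bochner_integral_pairing (e i) mD finD hI2.
  have e1 : I (e i) = \int[mu]_(t in `[0, T]) (derive1 phi t * v i t).
    rewrite E1; apply: lebesgue_ae_eq_Rintegral.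
    by apply: ae_mono vy => s + sT => /(_ sT i) <-.
  have e2 : - I (e i) = \int[mu]_(t in `[0, T]) (phi t * (lam i * v i t + k i t)).
    rewrite -[LHS]/((- I) (e i)) E2; apply: lebesgue_ae_eq_Rintegral.
    by apply: ae_mono x'E => s + sT => /(_ sT i) h; rewrite pairingZl h.
  have e3 := @duhamel_weak _ (lam i) (k i) (co x i) T phi (ltW T0)
    (forcing_measurable _) (ik i) phiC.
  rewrite -[duhamel _ _ _]/(X x i) in e3.
  have iX := mode_integrable x i.
  have i1 (g : R -> R) : mu.-integrable `[0, T] (EFin \o g) ->
      mu.-integrable `[0, T] (EFin \o (fun t => lam i * g t + k i t)).
    by move=> ig; apply: EFin_integrableD => //; exact: EFin_integrableZ.
  have -> : \int[mu]_(t in `[0, T]) (derive1 phi t * (v i t - X x i t)) =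
      \int[mu]_(t in `[0, T]) (derive1 phi t * v i t) -
      \int[mu]_(t in `[0, T]) (derive1 phi t * X x i t).
    rewrite -RintegralB//.
    + by apply: eq_Rintegral => s _; rewrite mulrBr.
    + exact: continuous_integrableM.
    + exact: continuous_integrableM.
  rewrite -e1 e3 opprK -[I (e i)]opprK e2 addrC -opprB; congr (- _).
  rewrite -RintegralB//.
  + by apply: eq_Rintegral => s _; ring.
  + by apply: continuous_integrableM => //; exact: i1.
  + by apply: continuous_integrableM => //; exact: i1.
have [_ basis _ _] := es.
apply: ae_mono vy => t + tT => /(_ tT) h.
apply: (cvg_unique (@norm_hausdorff _ H) (basis (y t))).
have [Sc _] := mild_solution_cvg x tT.
apply: cvg_trans Sc; apply: near_eq_cvg; apply: nearW => n.
by rewrite /series /= big_mkord; apply: eq_bigr => i _; rewrite h vX.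
Qed.

End Expansion.

Theorem theorem3p2 (R : realType) (H W V : hilbertType R)
  (hsep : separable H)
  (DA : set H) (A : H -> H)
  (Alin : linear_operator DA A) (Adense : dense DA)
  (Aclosed : closed_operator DA A)
  (jVW : dense_embedding V W) (jWH : dense_embedding W H)
  (HWdual : is_dense_embedding (H_to_Wdual jWH))
  (WVdual : is_dense_embedding (dual_embed jVW))
  (Aw : W -> dual V)
  (Awlin : linear Aw) (Awcont : continuous Aw) (Awrange : range Aw = setT)
  (Aext : extends_operator jVW jWH DA A Aw)
  (a b : R) (hb : 0 < b) (hab : b <= a)
  (coercive : forall x : H, DA x -> exists2 w : W, jWH w = x &
    - hdot (A x) x >= b * `|w| ^+ 2 - a * `|x| ^+ 2)
  (T : R) (hT : 0 < T)
  (galerkin : exists (h : nat -> V) (Pi : nat -> H -> H),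
    galerkin_family (jWH \o jVW) h Pi /\
    forall (n : nat) (x : W) (y Pix Piy : V),
      jWH (jVW Pix) = Pi n (jWH x) ->
      jWH (jVW Piy) = Pi n (jWH (jVW y)) ->
      a_form Aw x Piy = a_form Aw (jVW Pix) y)
  (f : R -> dual W) (hf : in_L2 T f) :
  exists S : H -> R -> H,
    (forall x0 : H,
      [/\ weak_solution jVW jWH T Aw x0 f (S x0),
          forall x : R -> H, weak_solution jVW jWH T Aw x0 f x ->
            \forall t \ae @lebesgue_measure R, t \in `[0, T] -> x t = S x0 t
        & {within `[0, T], continuous (S x0)}]) /\
    (forall t : R, t \in `[0, T] -> continuous (fun x0 : H => S x0 t)).
Proof.
have a0 : 0 <= a by rewrite (le_trans (ltW hb)).
have [h [Pi [gal comm]]] := galerkin.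
have [e [lam es]] := galerkin_eigen_system Awlin gal comm.
have mD : measurable `[0, T]%classic by exact: measurable_itv.
have [smf foo] := hf.
(* The forcing is replaced by a version that is an everywhere limit of simple functions; solutions
   are insensitive to the change, which [fF] confines to a null set of [[0, T]]. *)
have [F [u_ [su uF _ fF]]] := strongly_measurable_normalize mD smf.
have mF : measurable_fun setT (fun t => `|F t|).
  apply: (@measurable_fun_cvg_simple _ (fun n t => `|u_ n t| : R^o)).
    by move=> n; exact: (simple_function_comp (fun G : dual W => `|G| : R^o) (su n)).
  by move=> t; apply: cvg_norm; exact: uF.
have iF2 : (@lebesgue_measure R).-integrable `[0, T] (EFin \o (fun t => `|F t| ^+ 2)).
  apply/integrableP; split.
    by apply/measurable_EFinP; apply: measurable_funTS; exact: measurable_funX.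
  apply: le_lt_trans foo; rewrite le_eqVlt; apply/orP; left; apply/eqP.
  apply: lebesgue_ae_eq_integral; apply: ae_mono fF => t + tT => /(_ tT) ->.
  by rewrite /= ger0_norm ?sqr_ge0.
exists (mild_solution jVW jWH e lam F); split=> [x0|t tT].
  split.
  - exact: (mild_solution_weak_solution Awlin Awcont Awrange Aext a0 hb hT
      coercive es su uF iF2 HWdual WVdual x0 fF).
  - move=> x; exact: (weak_solution_unique Awlin Aext a0 hb hT coercive es su uF iF2 fF).
  - exact: (mild_solution_continuous Awlin Aext a0 hb hT coercive es su uF iF2 (x := x0)).
move=> x0; apply/cvgrPdist_le => eps eps0; near=> y0.
rewrite (le_trans (mild_solution_lipschitz Awlin Aext a0 hb hT coercive es su uF iF2 x0 y0 tT))//.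
rewrite -ler_pdivlMl ?expR_gt0//; near: y0.
apply: cvgr_dist_le; first exact: cvg_id.
by rewrite mulr_gt0// invr_gt0 expR_gt0.
Unshelve. all: by end_near. Qed.
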